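(* Let $T>0$ be arbitrary, let $G_0$ be a nonempty open subset of $G$, and consider the controlled stochastic transport equation $$ \left\{\begin{array}{ll} dy+U\cdot\nabla y\,dt=\Big[a_1y+\int_{S^{d-1}}a_2(t,x,U,V)y(t,x,V)\,dS^{d-1}(V)+f\Big]dt+(a_3y+v)\,dB(t) & \text{in }(0,T)\times G\times S^{d-1},\\ y=u & \text{on }(0,T)\times\Gamma_S^-,\\ y(0)=y_0 & \text{in }G\times S^{d-1}. \end{array}\right. $$ If $v\equiv0$ in $(0,T)\times G_0\times S^{d-1}$ (i.e. only controls $(u,v)\in L^2_{\mathcal F}(0,T;L^2_w(\Gamma_S^-))\times L^2_{\mathcal F}(0,T;L^2(G\times S^{d-1}))$ with $v=0$ in $(0,T)\times G_0\times S^{d-1}$ are admitted), then the system is not exactly controllable at any time $T$. That is, it is not true that for every $y_0\in L^2(G\times S^{d-1})$ and $y_1\in L^2(\Omega,\mathcal F_T,P;L^2(G\times S^{d-1}))$ there is an admitted control pair $(u,v)$ for which the solution with $y(0)=y_0$ satisfies $y(T)=y_1$.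
   Context: **Geometry.** $d\in\mathbb N$, $G\subset\mathbb R^d$ is a strictly convex bounded domain with $C^1$ boundary $\Gamma$, $\nu(x)$ is the unit outward normal at $x\in\Gamma$, and $S^{d-1}=\{x\in\mathbb R^d:|x|=1\}$ with surface measure $dS^{d-1}$. Set $\Gamma_S^-=\{(x,U)\in\Gamma\times S^{d-1}:U\cdot\nu(x)\le 0\}$ and $\Gamma_S^+=(\Gamma\times S^{d-1})\setminus\Gamma_S^-$. $L^2_w(\Gamma_S^-)$ is the Hilbert space obtained as the completion of the smooth compactly supported functions on $\Gamma_S^-$ under the norm $|h|_{L^2_w(\Gamma_S^-)}=\big(-\int_{\Gamma_S^-}U\cdot\nu\,|h|^2\,d\Gamma_S^-\big)^{1/2}$ (the $L^2$ space on $\Gamma_S^-$ with weight $-U\cdot\nu$). $\nabla$ is the gradient in $x$. **Probability.** $(\Omega,\mathcal F,\{\mathcal F_t\}_{t\ge0},P)$ is a complete filtered probability space carrying a one-dimensional standard Brownian motion $B$, where $\{\mathcal F_t\}$ is the natural filtration of $B$ augmented by all $P$-null sets. For a Banach space $H$: $L^2_{\mathcal F}(0,T;H)$ is the space of $H$-valued adapted processes $X$ with $\mathbb E|X|^2_{L^2(0,T;H)}<\infty$; $L^\infty_{\mathcal F}(0,T;H)$ is the space of $H$-valued adapted bounded processes; $L^2_{\mathcal F}(\Omega;C([0,T];H))$ is the space of $H$-valued adapted continuous processes with $\mathbb E|X|^2_{C([0,T];H)}<\infty$; $L^\infty_{\mathcal F}(\Omega;C([0,T];H))$ is the space of $H$-valued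 adapted continuous processes whose $C([0,T];H)$-norm is essentially bounded on $\Omega$. **Data.** $a_1,a_3\in L^\infty_{\mathcal F}(0,T;L^\infty(G\times S^{d-1}))$, $a_2\in L^\infty_{\mathcal F}(\Omega;C([0,T];C(\overline G\times S^{d-1}\times S^{d-1})))$, $f\in L^2_{\mathcal F}(0,T;L^2(G\times S^{d-1}))$ are given. **Solution.** For $y_0\in L^2(G\times S^{d-1})$, $u\in L^2_{\mathcal F}(0,T;L^2_w(\Gamma_S^-))$ and $v\in L^2_{\mathcal F}(0,T;L^2(G\times S^{d-1}))$, a solution is a process $y\in L^2_{\mathcal F}(\Omega;C([0,T];L^2(G\times S^{d-1})))$ such that for every $t\in[0,T]$ and every $\phi\in C^1(\overline G\times S^{d-1})$ with $\phi=0$ on $\Gamma_S^+$, $P$-a.s., $$ \begin{aligned} &\int_G\int_{S^{d-1}}y(t)\phi\,dS^{d-1}dx-\int_G\int_{S^{d-1}}y_0\phi\,dS^{d-1}dx-\int_0^t\int_G\int_{S^{d-1}}y\,U\cdot\nabla\phi\,dS^{d-1}dxds+\int_0^t\int_{\Gamma_S^-}u\,\phi\,U\cdot\nu\,d\Gamma_S^-ds\\ &=\int_0^t\int_G\int_{S^{d-1}}(a_1y+f)\phi\,dS^{d-1}dxds+\int_0^t\int_G\int_{S^{d-1}}\Big[\int_{S^{d-1}}a_2(s,x,U,V)y(s,x,V)\,dS^{d-1}(V)\Big]\phi(x,U)\,dS^{d-1}(U)dxds\\ &\quad+\int_0^t\int_G\int_{S^{d-1}}(a_3y+v)\phi\,dS^{d-1}dx\,dB(s).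 \end{aligned} $$ The system has a unique solution for all such data. *)

(* Defs.v *)
From HB Require Import structures.
From mathcomp Require Import all_boot all_order all_algebra.
From mathcomp Require Import all_classical all_reals all_analysis.
From mathcomp Require Import measurable_realfun.

Set Implicit Arguments.
Unset Strict Implicit.
Unset Printing Implicit Defensive.

Import Order.TTheory GRing.Theory Num.Theory.
Import numFieldNormedType.Exports.

Local Open Scope classical_set_scope.
Local Open Scope ring_scope.

(* 'rV[R]_n gets the product sigma-algebra of its n coordinates, as n.-tuple
   does in the library; it is the Borel sigma-algebra. *)
Section rV_measurable.
Context {R : realType} {n : nat}.

Let coord (i : 'I_n) (x : 'rV[R]_n) : measurableTypeR R := x 0 i.

Let rV_set0 : g_sigma_preimage coord set0.
Proof. exact: sigma_algebra0. Qed.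

Let rV_setC A : g_sigma_preimage coord A -> g_sigma_preimage coord (~` A).
Proof. exact: sigma_algebraC. Qed.

Let rV_bigcup (F : (set _)^nat) : (forall i, g_sigma_preimage coord (F i)) ->
  g_sigma_preimage coord (\bigcup_i (F i)).
Proof. exact: sigma_algebra_bigcup. Qed.

HB.instance Definition _ := @isMeasurable.Build
  (measure_tuple_display default_measure_display) 'rV[R]_n
  (g_sigma_preimage coord) rV_set0 rV_setC rV_bigcup.

Lemma measurable_coord (i : 'I_n) :
  measurable_fun [set: 'rV[R]_n] (fun x => x 0 i : measurableTypeR R).
Proof.
move=> _ Y mY; rewrite setTI; apply: sub_sigma_algebra => /=.
rewrite -bigcup_seq/=; exists i => /=; first by rewrite mem_index_enum.
by exists Y => //; rewrite setTI.
Qed.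

Lemma measurable_fun_coordP d (T : measurableType d) (f : T -> 'rV[R]_n) :
  (forall i, measurable_fun setT (fun t => f t 0 i : measurableTypeR R)) ->
  measurable_fun setT f.
Proof.
move=> mf _ A mA; rewrite setTI; move: A mA.
apply: (@smallest_sub _ (sigma_algebra setT) _ [set A | measurable (f @^-1` A)]).
  split => /=.
  - by rewrite preimage_set0.
  - by move=> A mA; rewrite setTD preimage_setC; exact: measurableC.
  - by move=> F mF; rewrite preimage_bigcup; exact: bigcup_measurable.
rewrite -bigcup_seq; apply: bigcup_sub => i _ A [B mB <-].
by rewrite /= setTI -comp_preimage -[X in measurable X]setTI; exact: mf.
Qed.

End rV_measurable.

Section volume.
Context {R : realType}.
Notation leb := (@lebesgue_measure R).

Definition vcons n (p : measurableTypeR R * 'rV[R]_n) : 'rV[R]_n.+1 :=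
  \row_i (if unlift ord0 i is Some j then p.2 0 j else p.1).

Lemma measurable_vcons n : measurable_fun setT (@vcons n).
Proof.
apply: measurable_fun_coordP => i.
under eq_fun do rewrite mxE.
case: unliftP => [j _|_]; last exact: measurable_fst.
exact: (measurableT_comp (measurable_coord j) measurable_snd).
Qed.

Definition vuncons n (v : 'rV[R]_n.+1) : measurableTypeR R * 'rV[R]_n :=
  (v 0 ord0, \row_j v 0 (lift ord0 j)).

Lemma measurable_vuncons n : measurable_fun setT (@vuncons n).
Proof.
apply/measurable_fun_pair; first exact: measurable_coord.
apply: measurable_fun_coordP => i.
under eq_fun do rewrite mxE.
exact: measurable_coord.
Qed.

Lemma vconsK n : cancel (@vcons n) (@vuncons n).
Proof.
move=> [a v]; rewrite /vuncons /vcons mxE unlift_none; congr pair.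
by apply/rowP => j; rewrite !mxE liftK.
Qed.

Section step.
Variables (n : nat) (m : {sigma_finite_measure set 'rV[R]_n -> \bar R}).

Definition vol_step : set 'rV[R]_n.+1 -> \bar R :=
  pushforward (leb \x m)%E (@vcons n).

HB.instance Definition _ := Measure.copy vol_step
  (measure_function_pushforward__canonical__measure_function_Measure
     (leb \x m)%E (@measurable_vcons n)).

Let vol_step_sigma_finite : sigma_finite setT vol_step.
Proof.
have /sigma_finiteP[F [TF ndF Foo]] := sigma_finiteT leb.
have /sigma_finiteP[G [TG ndG Goo]] := sigma_finiteT m.
exists (fun k => @vuncons n @^-1` (F k `*` G k)).
  apply/seteqP; split => // v _ /=.
  have : setT (@vuncons n v).1 by [].
  rewrite TF => -[i _ Fi].
  have : setT (@vuncons n v).2 by [].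
  rewrite TG => -[j _ Gj].
  exists (maxn i j) => //=; split.
  - by move: Fi; exact/subsetPset/ndF/leq_maxl.
  - by move: Gj; exact/subsetPset/ndG/leq_maxr.
move=> k; have [mF Fk] := Foo k; have [mG Gk] := Goo k; split.
  rewrite -[X in measurable X]setTI; apply: measurable_vuncons => //.
  exact: measurableX.
rewrite /vol_step /pushforward -comp_preimage (_ : _ \o _ = id); last first.
  by apply/funext => p /=; rewrite vconsK.
by rewrite preimage_id product_measure1E//= lte_mul_pinfty// ge0_fin_numE.
Qed.

HB.instance Definition _ := @Measure_isSigmaFinite.Build _ _ _ vol_step
  vol_step_sigma_finite.
End step.

(* Lebesgue measure on R^n as an iterated product; see [vol_box]. *)
Fixpoint vol n : {sigma_finite_measure set 'rV[R]_n -> \bar R} :=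
  match n with
  | 0 => \d_(0 : 'rV[R]_0)
  | n'.+1 => vol_step (vol n')
  end.

Lemma measurable_box n (A : 'I_n -> set (measurableTypeR R)) :
  (forall i, measurable (A i)) ->
  measurable [set x : 'rV[R]_n | forall i, A i (x 0 i)].
Proof.
move=> mA; rewrite [X in measurable X](_ : _ = \bigcap_(i in setT)
   ((fun x : 'rV[R]_n => x 0 i : measurableTypeR R) @^-1` A i)).
  apply: fin_bigcap_measurable => // i _.
  by rewrite -[X in measurable X]setTI; apply: measurable_coord.
by apply/seteqP; split => x /= h i; [move=> _|]; exact: h.
Qed.

Lemma vol_box n (A : 'I_n -> set (measurableTypeR R)) :
  (forall i, measurable (A i)) ->
  vol n [set x | forall i, A i (x 0 i)] = (\prod_(i < n) leb (A i))%E.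
Proof.
elim: n A => [|n IH] A mA.
  rewrite big_ord0 /= diracE mem_set //; by case.
rewrite big_ord_recl -IH => [|i]; last exact: mA.
have mB : measurable [set x : 'rV[R]_n | forall i, A (lift ord0 i) (x 0 i)].
  by apply: (@measurable_box n (fun i => A (lift ord0 i))) => i; exact: mA.
rewrite -product_measure1E //=.
rewrite /vol_step /pushforward; congr (product_measure1 _ _ _).
apply/seteqP; split => -[a v] /=.
  move=> h; split; first by have := h ord0; rewrite mxE unlift_none.
  by move=> i; have := h (lift ord0 i); rewrite mxE liftK.
move=> [h1 h2] i; rewrite mxE.
by case: unliftP => [j ->|->].
Qed.

End volume.
Arguments vol {R} n.

Section sphere.
Context {R : realType}.
Variable d : nat.
Definition dot (x y : 'rV[R]_d) : R := \sum_i x 0 i * y 0 i.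
Definition enorm (x : 'rV[R]_d) : R := Num.sqrt (dot x x).
Definition sphere : set 'rV[R]_d := [set U | enorm U = 1].

Lemma measurable_dotxx : measurable_fun setT (fun x => dot x x).
Proof.
apply: measurable_sum => i; apply: measurable_funM; exact: measurable_coord.
Qed.

Lemma measurable_enorm : measurable_fun setT enorm.
Proof.
apply: (measurableT_comp _ measurable_dotxx).
by apply: continuous_measurable_fun; exact: sqrt_continuous.
Qed.

Definition unit_ball : set 'rV[R]_d := [set x | 0 < enorm x <= 1].
Lemma measurable_unit_ball : measurable unit_ball.
Proof.
rewrite (_ : unit_ball = enorm @^-1` `]0, 1]).
  rewrite -[X in measurable X]setTI; exact: measurable_enorm.
by apply/seteqP; split => x /=; rewrite in_itv.
Qed.
Definition direction (x : 'rV[R]_d) : 'rV[R]_d := (enorm x)^-1 *: x.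
Lemma measurable_direction : measurable_fun setT direction.
Proof.
apply: measurable_fun_coordP => i.
under eq_fun do rewrite mxE.
apply: measurable_funM; last exact: measurable_coord.
rewrite [X in measurable_fun _ X](_ : _ = (fun x => enorm x `^ (-1))).
  exact: (measurableT_comp (measurable_powR (-1 : R)) measurable_enorm).
by apply/funext => x; rewrite powR_inv1 ?sqrtr_ge0.
Qed.

Lemma vol_unit_ball_lty : (vol d unit_ball < +oo)%E.
Proof.
pose I (i : 'I_d) : set (measurableTypeR R) := `[-1, 1]%classic.
have mI i : measurable (I i) by exact: measurable_itv.
apply: (@le_lt_trans _ _ (vol d [set x | forall i, I i (x 0 i)])).
  apply: le_measure; rewrite ?inE; [exact: measurable_unit_ball|exact: measurable_box mI|].
  move=> x /= /andP[_ x1] i; rewrite /I /= in_itv /= -ler_norml.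
  apply: le_trans x1; rewrite -sqrtr_sqr ler_wsqrtr// /dot (bigD1 i)//= -expr2.
  by rewrite lerDl sumr_ge0// => j _; rewrite -expr2 sqr_ge0.
rewrite (vol_box mI).
have /andP[] // : (0 <= \prod_(i < d) lebesgue_measure (I i) < +oo)%E.
elim/big_ind: _ => [|x y /andP[x0 xoo] /andP[y0 yoo]|i _].
- by rewrite lee01 ltry.
- by rewrite mule_ge0//= lte_mul_pinfty// ge0_fin_numE.
- rewrite measure_ge0 /= /I lebesgue_measure_itv /=.
  by case: ifP; rewrite -?EFinB ltry.
Qed.

(* Surface measure of the unit sphere, read off polar coordinates
   dx = r^(d-1) dr dS: S(A) is d times the volume of the cone
   {x | 0 < |x| <= 1, x / |x| in A}. For d = 1 it is the counting measure on
   {-1, 1}. *)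
Definition sphere_measure : set 'rV[R]_d -> \bar R :=
  pushforward (mscale d%:R%:nng (mrestr (vol d) measurable_unit_ball)) direction.

HB.instance Definition _ := Measure.copy sphere_measure
  (measure_function_pushforward__canonical__measure_function_Measure
     (mscale d%:R%:nng (mrestr (vol d) measurable_unit_ball))
     measurable_direction).

Let sphere_measure_fin : fin_num_fun sphere_measure.
Proof.
apply: lty_fin_num_fun; apply: lte_mul_pinfty => //.
by rewrite /= /mrestr preimage_setT setTI; exact: vol_unit_ball_lty.
Qed.

HB.instance Definition _ := @Measure_isFinite.Build _ _ _ sphere_measure
  sphere_measure_fin.

End sphere.

Arguments sphere {R} d.
Arguments sphere_measure {R} d.

Section hausdorff.
Context {R : realType} {d : nat}.
Local Open Scope ereal_scope.

Definition diameter (A : set 'rV[R]_d) : \bar R :=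
  ereal_sup [set (enorm (p.1 - p.2))%:E | p in A `*` A].

(* The [if] makes the empty set contribute nothing also when k = 0. *)
Definition hausdorff_gauge (k : nat) (A : set 'rV[R]_d) : \bar R :=
  if A == set0 then 0
  else vol k [set x | (enorm x <= 1)%R] * (diameter A * (2^-1)%:E) ^+ k.

Definition hausdorff_content (k : nat) (e : R) (A : set 'rV[R]_d) : \bar R :=
  ereal_inf [set \sum_(i <oo) hausdorff_gauge k (F i) |
    F in [set F : (set 'rV[R]_d)^nat |
          A `<=` \bigcup_i F i /\ forall i, diameter (F i) <= e%:E]].

(* The k-dimensional Hausdorff outer measure, normalised to agree with the
   k-dimensional area of C^1 submanifolds; it is only evaluated on Borel sets,
   on which it is countably additive. *)
Definition hausdorff (k : nat) (A : set 'rV[R]_d) : \bar R :=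
  ereal_sup [set hausdorff_content k e A | e in [set e : R | (0 < e)%R]].

End hausdorff.

Section geometry.
Context {R : realType} {d : nat}.
Notation Rd := 'rV[R]_d.
Implicit Types (G : set Rd) (nu : Rd -> Rd).

Definition C1 (V : normedModType R) (h : V -> R) : Prop :=
  (forall x, differentiable h x) /\ forall v, continuous (fun x => 'D_v h x).

Definition grad (h : Rd -> R) (x : Rd) : Rd :=
  \row_i 'D_(delta_mx 0 i) h x.

Definition strictly_convex G : Prop :=
  forall x y, closure G x -> closure G y -> x != y ->
  forall t, 0 < t < 1 -> G^° (t *: x + (1 - t) *: y).

Definition boundary G : set Rd := closure G `\` G^°.

(* Near x, G is the sublevel set {h < 0} of a C^1 function h without critical
   point; equivalently G lies locally on one side of a C^1 graph. *)
Definition local_defining_function G (x : Rd) (h : Rd -> R) : Prop :=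
  [/\ C1 h, grad h x != 0 & \forall y \near x, G y <-> h y < 0].

Definition C1_boundary G : Prop :=
  forall x, boundary G x -> exists h, local_defining_function G x h.

Definition unit_outward_normal G nu : Prop :=
  forall x, boundary G x -> forall h, local_defining_function G x h ->
  nu x = direction (grad h x).

Definition strictly_convex_C1_domain G : Prop :=
  [/\ open G, connected G & G !=set0] /\
  [/\ bounded_set G, strictly_convex G & C1_boundary G].

(* Points of [Rd * Rd] are pairs z = (x, U), those of [Rd * Rd * Rd] are
   triples ((x, U), V). *)
Definition GammaS_minus G nu : set (Rd * Rd) :=
  [set z | [/\ boundary G z.1, sphere d z.2 & dot z.2 (nu z.1) <= 0]].

Definition GammaS_plus G nu : set (Rd * Rd) :=
  (boundary G `*` sphere d) `\` GammaS_minus G nu.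

(* Integral over Gamma_S^- against dGamma_S^-, written as an iterated one. *)
Definition integral_GammaS_minus G nu (h : Rd * Rd -> R) : \bar R :=
  (\int[hausdorff d.-1]_(x in boundary G)
    \int[sphere_measure d]_(U in [set U | GammaS_minus G nu (x, U)])
      (h (x, U))%:E)%E.

Definition sqnorm_L2w G nu (h : Rd * Rd -> R) : \bar R :=
  integral_GammaS_minus G nu (fun z => - dot z.2 (nu z.1) * h z ^+ 2).

Definition phase_measure : set (Rd * Rd) -> \bar R :=
  (vol d \x sphere_measure d)%E.

HB.instance Definition _ := Measure.on phase_measure.

Definition sqnorm_L2 G (h : Rd * Rd -> R) : \bar R :=
  (\int[phase_measure]_(z in G `*` sphere d) (h z ^+ 2)%:E)%E.

(* A function of class C^1 on the compact set closure G * S^{d-1} is the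
   restriction of a C^1 function on the whole of Rd * Rd, G being convex. *)
Definition test_function G nu (phi : Rd * Rd -> R) : Prop :=
  C1 phi /\ forall z, GammaS_plus G nu z -> phi z = 0.

Definition gradx (phi : Rd * Rd -> R) (z : Rd * Rd) : Rd :=
  \row_i 'D_((delta_mx 0 i, 0) : Rd * Rd) phi z.

End geometry.

Section stochastic.
Context {R : realType} {dO : measure_display} {Omega : measurableType dO}.
Variables (P : probability Omega R) (B : R -> Omega -> R).
Notation Rt := (measurableTypeR R).
Notation leb := (@lebesgue_measure R).

Definition filtration_gen (t : R) : set (set Omega) :=
  [set A | exists s (C : set Rt),
     [/\ 0 <= s <= t, measurable C & A = B s @^-1` C]] `|`
  [set A | P.-negligible A].

Definition filtered (t : R) := g_sigma_algebraType (filtration_gen t).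

HB.instance Definition _ (t : R) := Measurable.on (filtered t).

Definition brownian_motion : Prop :=
  [/\ forall t, 0 <= t -> measurable_fun setT (B t),
      {ae P, forall w, B 0 w = 0},
      {ae P, forall w, {within `[0, +oo[, continuous (fun t => B t w)}} &
      forall s t, 0 <= s < t -> forall (A : set (filtered s)) (C : set Rt),
        measurable A -> measurable C ->
        P (A `&` [set w | C (B t w - B s w)]) =
        (P A * normal_prob 0 (Num.sqrt (t - s)) C)%E].

Record simple_process (t : R) := SimpleProcess {
  sp_size : nat;
  sp_time : nat -> R;
  sp_val : nat -> Omega -> R;
  sp_time_first : sp_time 0 = 0;
  sp_time_last : sp_time sp_size = t;
  sp_time_incr : forall i, (i < sp_size)%N -> sp_time i <= sp_time i.+1;
  sp_val_adapted : forall i, (i < sp_size)%N ->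
    measurable_fun setT (sp_val i : filtered (sp_time i) -> R);
  sp_val_bounded : exists M, forall i w, (i < sp_size)%N ->
    `|sp_val i w| <= M }.

Definition sp_eval t (h : simple_process t) (s : R) (w : Omega) : R :=
  \sum_(i < sp_size h)
    sp_val h i w * \1_(`]sp_time h i, sp_time h i.+1] : set R) s.

Definition sp_integral t (h : simple_process t) (w : Omega) : R :=
  \sum_(i < sp_size h)
    sp_val h i w * (B (sp_time h i.+1) w - B (sp_time h i) w).

(* [I] is a version of the Ito integral of [X] over [0, t]: the L^2(P)-limit of
   the integrals of simple processes converging to [X] in L^2([0, t] * Omega).
   Measurability is required explicitly because the library integral of a
   nonnegative nonmeasurable function is only a lower integral. *)
Definition is_ito_integral (t : R) (X : R -> Omega -> R) (I : Omega -> R) :=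
  [/\ measurable_fun (`[0, t] `*` setT) (fun p : Rt * Omega => X p.1 p.2),
      measurable_fun setT I &
      exists h : nat -> simple_process t,
        (fun n => \int[P]_w \int[leb]_(s in `[0%R, t])
           ((sp_eval (h n) s w - X s w) ^+ 2)%:E)%E @ \oo --> 0%E /\
        (fun n => \int[P]_w ((sp_integral (h n) w - I w) ^+ 2)%:E)%E
           @ \oo --> 0%E].

(* An adapted process with values in a space of (classes of) functions on
   [D : set Z] is represented by a jointly measurable function of (t, w, z)
   whose section at each time t is measurable in (w, z) for F_t and the
   sigma-algebra of Z. *)

Definition adapted d (Z : measurableType d) (T : R) (D : set Z)
    (X : R -> Omega -> Z -> R) : Prop :=
  measurable_fun (`[0, T] `*` setT `*` D)
    (fun p : Rt * Omega * Z => X p.1.1 p.1.2 p.2) /\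
  forall t, 0 <= t <= T ->
    measurable_fun (setT `*` D) (fun p : filtered t * Z => X t p.1 p.2).

(* L^2_F(0, T; H), [sqnorm] being the square of the norm of H *)
Definition L2F d (Z : measurableType d) (T : R) (D : set Z)
    (sqnorm : (Z -> R) -> \bar R) (X : R -> Omega -> Z -> R) : Prop :=
  adapted T D X /\
  (\int[P]_w \int[leb]_(t in `[0%R, T]) sqnorm (X t w) < +oo)%E.

(* L^oo_F(0, T; L^oo(D)) *)
Definition LooF d (Z : measurableType d) (mu : set Z -> \bar R) (T : R)
    (D : set Z) (X : R -> Omega -> Z -> R) : Prop :=
  adapted T D X /\
  exists M, {ae leb, forall t, 0 <= t <= T ->
    {ae P, forall w, {ae mu, forall z, D z -> `|X t w z| <= M}}}.

(* L^2_F(Omega; C([0, T]; H)), [sqnorm] being the square of the norm of H *)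
Definition L2FC d (Z : measurableType d) (T : R) (D : set Z)
    (sqnorm : (Z -> R) -> \bar R) (X : R -> Omega -> Z -> R) : Prop :=
  [/\ adapted T D X,
      {ae P, forall w, forall t, 0 <= t <= T ->
        (fun s => sqnorm (X s w \- X t w)) @ within `[0, T] (nbhs t) --> 0%E} &
      (\int[P]_w ereal_sup [set sqnorm (X t w) | t in `[0%R, T]] < +oo)%E].

Section system.
Context {d : nat}.
Notation Rd := 'rV[R]_d.

(* L^oo_F(Omega; C([0, T]; C(D))) *)
Definition LooFC (T : R) (D : set (Rd * Rd * Rd))
    (X : R -> Omega -> Rd * Rd * Rd -> R) : Prop :=
  adapted T D X /\
  exists M, {ae P, forall w,
    [/\ forall t, 0 <= t <= T -> {within D, continuous (X t w)},
        forall t, 0 <= t <= T -> forall e, 0 < e ->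
          \forall s \near within `[0, T] (nbhs t),
            forall z, D z -> `|X s w z - X t w z| <= e &
        forall t z, 0 <= t <= T -> D z -> `|X t w z| <= M]}.

Variables (G : set Rd) (nu : Rd -> Rd) (T : R).
Variables (a1 : R -> Omega -> Rd * Rd -> R)
  (a2 : R -> Omega -> Rd * Rd * Rd -> R)
  (a3 f : R -> Omega -> Rd * Rd -> R).

Notation D := (G `*` sphere d).
Notation mu := (@phase_measure R d).

Definition coefficients : Prop :=
  [/\ LooF mu T D a1,
      LooFC T (closure G `*` sphere d `*` sphere d) a2,
      LooF mu T D a3 &
      L2F T D (sqnorm_L2 G) f].

Definition initial_state (y0 : Rd * Rd -> R) : Prop :=
  measurable_fun D y0 /\ (sqnorm_L2 G y0 < +oo)%E.

(* L^2(Omega, F_T, P; L^2(G x S^{d-1})) *)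
Definition final_state (y1 : Omega -> Rd * Rd -> R) : Prop :=
  measurable_fun (setT `*` D)
    (fun p : filtered T * (Rd * Rd) => y1 p.1 p.2) /\
  (\int[P]_w sqnorm_L2 G (y1 w) < +oo)%E.

Definition boundary_control (u : R -> Omega -> Rd * Rd -> R) : Prop :=
  L2F T (GammaS_minus G nu) (sqnorm_L2w G nu) u.

Definition internal_control (v : R -> Omega -> Rd * Rd -> R) : Prop :=
  L2F T D (sqnorm_L2 G) v.

Definition solution (y0 : Rd * Rd -> R)
    (u v y : R -> Omega -> Rd * Rd -> R) : Prop :=
  L2FC T D (sqnorm_L2 G) y /\
  forall t, 0 <= t <= T -> forall phi, test_function G nu phi ->
  exists2 I : Omega -> R,
    is_ito_integral t
      (fun s w => \int[mu]_(z in D) ((a3 s w z * y s w z + v s w z) * phi z)) I &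
    {ae P, forall w,
      \int[mu]_(z in D) (y t w z * phi z) - \int[mu]_(z in D) (y0 z * phi z)
      - \int[leb]_(s in `[0, t])
          \int[mu]_(z in D) (y s w z * dot z.2 (gradx phi z))
      + \int[leb]_(s in `[0, t])
          fine (integral_GammaS_minus G nu
                  (fun z => u s w z * phi z * dot z.2 (nu z.1)))
      = \int[leb]_(s in `[0, t])
          \int[mu]_(z in D) ((a1 s w z * y s w z + f s w z) * phi z)
      + \int[leb]_(s in `[0, t])
          \int[mu]_(z in D)
            ((\int[sphere_measure d]_(V in sphere d)
                (a2 s w (z, V) * y s w (z.1, V))) * phi z)
      + I w}.

(* v = 0 in (0, T) x G0 x S^{d-1} *)
Definition vanishes_on (G0 : set Rd) (v : R -> Omega -> Rd * Rd -> R) : Prop :=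
  {ae leb, forall t, 0 < t < T ->
    {ae P, forall w, {ae mu, forall z, (G0 `*` sphere d) z -> v t w z = 0}}}.

Definition exactly_controllable_off (G0 : set Rd) : Prop :=
  forall y0 y1, initial_state y0 -> final_state y1 ->
  exists u v, [/\ boundary_control u, internal_control v, vanishes_on G0 v &
    exists2 y, solution y0 u v y &
      {ae P, forall w, {ae mu, forall z, D z -> y T w z = y1 w z}}].

End system.
End stochastic.

(* Main.v *)
Require Import Defs.
From HB Require Import structures.
From mathcomp Require Import all_boot all_order all_algebra.
From mathcomp Require Import all_classical all_reals all_analysis.
From mathcomp Require Import measurable_realfun ring lra.
Import Order.TTheory GRing.Theory Num.Theory.
Import numFieldNormedType.Exports.
Set Implicit Arguments.
Unset Strict Implicit.
Unset Printing Implicit Defensive.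
Local Open Scope classical_set_scope.
Local Open Scope ring_scope.

(** The idea is to test the equation with a function that both controls miss,
    and to observe that what remains is a scalar stochastic equation whose
    noise is prescribed near the terminal time, so that it cannot reach every
    terminal value.

    Let [phi] be a bump function of the position [x] alone, supported in a ball
    inside [G0]. It is a test function that vanishes on the whole boundary, so
    the boundary control does not appear in the equation tested with [phi], and
    neither does the internal control, because it vanishes where [phi] does
    not. With [Y t] the integral of [y t * phi], this leaves
    [dY = r dt + X dB], where [r] is square-integrable and [X] is the integral
    of [a3 * y * phi]. Suppose that the target is [y T = xi], random but
    constant over the phase space. Then [Y T = c * xi], where [c > 0] is the
    integral of [phi], and since [y] is continuous in mean square, [X] is close
    to [alpha * xi] near [T], where the bounded process [alpha] is the integral
    of [a3 * phi]. The point is that [alpha] does not depend on the controls, on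
    the solution or on the target.

    To extract this information, the difference of the equations at [T] and at
    [t] is multiplied by [Z * (B T - B t)], where [Z] is known at time [t], and
    averaged. The value [Y t] drops out; by the Ito isometry ([ito_test]) the
    stochastic integral turns into the integral over the times after [t] of the
    mean of [Z * X]; and the drift contributes an error that is small compared
    with [T - t] ([rest_bound]), as does the replacement of [X] by [alpha * xi]
    ([drift_bound]). Up to that error, the mean of
    [c * Z * (B T - B t) * xi] is therefore the integral after [t] of the mean
    of [Z * alpha * xi]. This is [terminal_relation], applied to the controlled
    equation in [controlled_relation].

    Exact controllability would give this relation, with the same [alpha], for
    [xi = 1] and for [xi = B T - B 0]. From [xi = 1] and [Z = B t - B 0] it
    follows that [alpha] is almost uncorrelated with [B t - B 0] after [t]; from
    [xi = B T - B 0] and [Z = 1] it follows that the integral of this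
    correlation is close to [c * (T - t)], because [B T] and [B t] differ too
    little to matter. The two are incompatible
    ([tested_relations_incompatible]).

    The normal second moment [normal_var] stands for the factor 1 in the Ito
    isometry; it multiplies both sides of the comparison, so that its value is
    never computed. *)

(** * Integrals, square-integrable functions, and product measures *)

Section integral_tools.
Context d (T : measurableType d) {R : realType}.
Variable mu : {measure set T -> \bar R}.
Implicit Types (D : set T) (f g : T -> R).

(** The integral of a nonnegative function is a supremum over the simple
    functions below it, so that monotonicity asks for no measurability; this
    matters for suprema over uncountably many times. *)
Lemma ge0_le_integral_dom D (f1 f2 : T -> \bar R) :
  (forall x, D x -> 0 <= f1 x)%E -> (forall x, D x -> f1 x <= f2 x)%E ->
  (\int[mu]_(x in D) f1 x <= \int[mu]_(x in D) f2 x)%E.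
Proof.
move=> f10 f12; rewrite ge0_integralE// [leRHS]ge0_integralE//; last first.
  by move=> x Dx; exact: le_trans (f10 _ Dx) (f12 _ Dx).
apply: ereal_sup_le => _ [h hf <-]; exists h => // x.
apply: le_trans (hf x) _; rewrite /patch; case: ifPn => //.
by rewrite inE; exact: f12.
Qed.

Lemma normr_Rintegral_le D f : measurable D -> measurable_fun D f ->
  (`|\int[mu]_(x in D) f x|%:E <= \int[mu]_(x in D) `|f x|%:E)%E.
Proof.
move=> mD mf.
have := @le_abse_integral _ _ _ mu D (EFin \o f) mD.
move=> /(_ _)/wrap[]; first exact/measurable_EFinP.
apply: le_trans; rewrite /Rintegral /comp.
by case: (integral mu D _) => [r| |]//=; rewrite normr0 leey.
Qed.

(** Takes the place of the Cauchy-Schwarz inequality throughout: it makes sense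
    for infinite integrals, and the free weight [l] is tuned in each use. *)
Lemma integral_amgm D f g (l : R) : measurable D ->
    measurable_fun D f -> measurable_fun D g -> 0 < l ->
  (\int[mu]_(x in D) `|f x * g x|%:E <=
   (l / 2)%:E * \int[mu]_(x in D) (f x ^+ 2)%:E +
   (l^-1 / 2)%:E * \int[mu]_(x in D) (g x ^+ 2)%:E)%E.
Proof.
move=> mD mf mg l0.
have l20 : 0 <= l / 2 by rewrite divr_ge0// ltW.
have l20' : 0 <= l^-1 / 2 by rewrite divr_ge0// invr_ge0 ltW.
have mf2 : measurable_fun D (fun x => (f x ^+ 2)%:E).
  by apply/measurable_EFinP; exact: measurable_funX.
have mg2 : measurable_fun D (fun x => (g x ^+ 2)%:E).
  by apply/measurable_EFinP; exact: measurable_funX.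
rewrite -!ge0_integralZl ?lee_fin//; last 2 first.
- by move=> x _; rewrite lee_fin sqr_ge0.
- by move=> x _; rewrite lee_fin sqr_ge0.
rewrite -ge0_integralD//; last 4 first.
- by move=> x _; rewrite mule_ge0// lee_fin sqr_ge0.
- exact: measurable_funeM.
- by move=> x _; rewrite mule_ge0// lee_fin sqr_ge0.
- exact: measurable_funeM.
apply: ge0_le_integral_dom => x _; first by rewrite lee_fin.
rewrite -!EFinM -EFinD lee_fin normrM -(real_normK (num_real (f x))).
rewrite -(real_normK (num_real (g x))).
have : 0 <= (l * `|f x| - `|g x|) ^+ 2 / l by rewrite divr_ge0 ?sqr_ge0// ltW.
rewrite (_ : _ / l = l * `|f x| ^+ 2 + l^-1 * `|g x| ^+ 2 - 2 * (`|f x| * `|g x|)).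
  lra.
by field; rewrite gt_eqF.
Qed.

(** Jensen's inequality, in the quadratic case. The number [a] is the
    absolute value of an integral in the applications, while the integral on
    the right may be infinite. The proof uses [integral_amgm] with the weight
    that is optimal for a constant function of integral [a]. *)
Lemma sqr_le_integral_sqr D g (a m : R) : measurable D -> measurable_fun D g ->
    (mu D <= m%:E)%E -> 0 < m -> 0 <= a ->
  (a%:E <= \int[mu]_(x in D) `|g x|%:E)%E ->
  ((a ^+ 2)%:E <= m%:E * \int[mu]_(x in D) (g x ^+ 2)%:E)%E.
Proof.
move=> mD mg Dm m0 a0 ag.
have g20 : (0 <= \int[mu]_(x in D) (g x ^+ 2)%:E)%E.
  by apply: integral_ge0 => x _; rewrite lee_fin sqr_ge0.
have [->|a_neq0] := eqVneq a 0.
  by rewrite expr0n/=; apply: mule_ge0 => //; rewrite lee_fin ltW.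
have {a_neq0} {}a0 : 0 < a by rewrite lt_neqAle eq_sym a_neq0.
have l0 : 0 < a / m by rewrite divr_gt0.
have := @integral_amgm D (cst 1) g (a / m) mD (measurable_cst _) mg l0.
under eq_integral do rewrite /= mul1r.
under [X in (_ <= _ * X + _)%E -> _]eq_integral do rewrite /= expr1n.
have -> : (\int[mu]_(x in D) 1%:E = mu D)%E by rewrite integral_cst// mul1e.
move=> H; have {}H := le_trans ag H.
have {H} : (a%:E <= (a / m / 2)%:E * m%:E +
    ((a / m)^-1 / 2)%:E * \int[mu]_(x in D) (g x ^+ 2)%:E)%E.
  apply: le_trans H _; apply: leeD => //; apply: lee_pmul => //.
  by rewrite lee_fin divr_ge0// ltW.
move: g20; case: (\int[mu]_(x in D) _)%E => [b| |]//.
  rewrite lee_fin => b0; rewrite -!EFinM -!EFinD !lee_fin => H.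
  have : a * (2 * a) <= (a / m / 2 * m + (a / m)^-1 / 2 * b) * (2 * a).
    by rewrite ler_wpM2r// ltW// mulr_gt0.
  rewrite [leRHS](_ : _ = a ^+ 2 + m * b); last by field; rewrite !gt_eqF.
  lra.
by move=> _ _; rewrite gt0_muley ?leey// lte_fin.
Qed.

Definition sq_integrable D f :=
  measurable_fun D f /\ (\int[mu]_(x in D) (f x ^+ 2)%:E < +oo)%E.

Lemma sq_integrableM D f g : measurable D ->
  sq_integrable D f -> sq_integrable D g ->
  mu.-integrable D (EFin \o (f \* g)).
Proof.
move=> mD [mf f2] [mg g2]; apply/integrableP; split.
  by apply/measurable_EFinP; exact: measurable_funM.
apply: le_lt_trans (integral_amgm mD mf mg ltr01) _.
by apply: lte_add_pinfty; apply: lte_mul_pinfty => //;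
  rewrite lee_fin divr_ge0// invr_ge0.
Qed.

Lemma sq_integrableD D f g : measurable D ->
  sq_integrable D f -> sq_integrable D g -> sq_integrable D (f \+ g).
Proof.
move=> mD [mf f2] [mg g2]; split; first exact: measurable_funD.
have mf2 : measurable_fun D (fun x => (f x ^+ 2)%:E).
  by apply/measurable_EFinP; exact: measurable_funX.
have mg2 : measurable_fun D (fun x => (g x ^+ 2)%:E).
  by apply/measurable_EFinP; exact: measurable_funX.
apply: (@le_lt_trans _ _
  (\int[mu]_(x in D) (2%:E * (f x ^+ 2)%:E + 2%:E * (g x ^+ 2)%:E))%E).
  apply: ge0_le_integral_dom => x _; rewrite -?EFinM -?EFinD lee_fin/= ?sqr_ge0//.
  by have := sqr_ge0 (f x - g x); rewrite !expr2; nra.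
rewrite ge0_integralD//; last 4 first.
- by move=> x _; rewrite mule_ge0// lee_fin sqr_ge0.
- exact: measurable_funeM.
- by move=> x _; rewrite mule_ge0// lee_fin sqr_ge0.
- exact: measurable_funeM.
rewrite !ge0_integralZl//; try by move=> x _; rewrite lee_fin sqr_ge0.
by apply: lte_add_pinfty; apply: lte_mul_pinfty.
Qed.

Lemma sq_integrableMb D f g (M : R) : measurable D -> sq_integrable D f ->
  measurable_fun D g -> (forall x, D x -> `|g x| <= M) ->
  sq_integrable D (g \* f).
Proof.
move=> mD [mf f2] mg gM; split; first exact: measurable_funM.
apply: (@le_lt_trans _ _ (\int[mu]_(x in D) ((M ^+ 2)%:E * (f x ^+ 2)%:E))%E).
  apply: ge0_le_integral_dom => x Dx; rewrite -?EFinM lee_fin/= ?sqr_ge0//.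
  rewrite exprMn ler_wpM2r ?sqr_ge0// -[leLHS]real_normK ?num_real//.
  by rewrite lerXn2r ?nnegrE ?gM// (le_trans _ (gM _ Dx)).
rewrite ge0_integralZl//.
- by apply: lte_mul_pinfty => //; rewrite lee_fin sqr_ge0.
- by apply/measurable_EFinP; exact: measurable_funX.
- by move=> x _; rewrite lee_fin sqr_ge0.
- by rewrite lee_fin sqr_ge0.
Qed.

Lemma sq_integrableZ D f (k : R) : measurable D -> sq_integrable D f ->
  sq_integrable D (fun x => k * f x).
Proof.
by move=> mD If; apply: (@sq_integrableMb D f (cst k) `|k|).
Qed.

Lemma sq_integrableB D f g : measurable D ->
  sq_integrable D f -> sq_integrable D g -> sq_integrable D (f \- g).
Proof.
move=> mD If Ig; have := sq_integrableD mD If (sq_integrableZ (-1) mD Ig).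
by rewrite (_ : f \+ _ = f \- g)//; apply/funext => x /=; rewrite mulN1r.
Qed.

Lemma sq_integrable_cst D (k : R) : measurable D -> (mu D < +oo)%E ->
  sq_integrable D (cst k).
Proof.
move=> mD Doo; split => //.
rewrite (@integral_cst _ _ _ mu D mD (k ^+ 2)%:E).
by rewrite lte_mul_pinfty// lee_fin sqr_ge0.
Qed.

Lemma sq_integrable_int D f : measurable D -> (mu D < +oo)%E ->
  sq_integrable D f -> mu.-integrable D (EFin \o f).
Proof.
move=> mD Doo If; have := sq_integrableM mD (sq_integrable_cst 1 mD Doo) If.
by apply: eq_integrable => // x _ /=; rewrite mul1r.
Qed.

End integral_tools.

Section product_tools.
Context d1 d2 (T1 : measurableType d1) (T2 : measurableType d2) {R : realType}.
Variable m2 : {sigma_finite_measure set T2 -> \bar R}.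

Lemma measurable_integral_param (A : set T1) (D : set T2)
    (g : T1 * T2 -> \bar R) : measurable A -> measurable D ->
  measurable_fun (A `*` D) g ->
  measurable_fun A (fun x => \int[m2]_(y in D) g (x, y))%E.
Proof.
move=> mA mD mg; have mAD := measurableX mA mD.
pose h := g \_ (A `*` D).
have mh : measurable_fun setT h := (measurable_restrictT g mAD).1 mg.
have F (k : T1 * T2 -> \bar R) : measurable_fun setT k -> (forall z, 0 <= k z)%E ->
    measurable_fun setT (fun x => \int[m2]_y k (x, y))%E.
  move=> mk k0; exact: (measurable_fun_fubini_tonelli_F (m2 := m2) k mk k0).
apply: (@eq_measurable_fun _ _ _ _ _
    (fun x => \int[m2]_y (h^\+ (x, y)) - \int[m2]_y (h^\- (x, y)))%E).
  move=> x; rewrite inE => Ax; rewrite [RHS]integral_mkcond.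
  have -> : (fun y => g (x, y)) \_ D = (fun y => h (x, y)).
    apply/funext => y; rewrite /h /patch in_setX (mem_set Ax)/=.
    by case: ifPn.
  rewrite [RHS]integralE; congr (_ - _)%E; apply: eq_integral => y _.
    by rewrite !funeposE.
  by rewrite !funenegE.
apply: measurable_funTS; apply: emeasurable_funB; apply: F => //.
- exact: measurable_funepos.
- exact: measurable_funeneg.
Qed.

Lemma measurable_Rintegral_param (A : set T1) (D : set T2) (g : T1 * T2 -> R) :
  measurable A -> measurable D -> measurable_fun (A `*` D) g ->
  measurable_fun A (fun x => \int[m2]_(y in D) g (x, y)).
Proof.
move=> mA mD mg.
apply: (measurableT_comp (fine_measurable measurableT)).
apply: (@measurable_integral_param A D (EFin \o g)) => //.
exact/measurable_EFinP.
Qed.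

Variable m1 : {sigma_finite_measure set T1 -> \bar R}.

Lemma ge0_integral_setX (A : set T1) (D : set T2) (g : T1 * T2 -> \bar R) :
  measurable A -> measurable D -> measurable_fun (A `*` D) g ->
  (forall z, (A `*` D) z -> 0 <= g z)%E ->
  (\int[m1 \x m2]_(z in A `*` D) g z
   = \int[m1]_(x in A) \int[m2]_(y in D) g (x, y))%E.
Proof.
move=> mA mD mg g0; rewrite integral_mkcond fubini_tonelli1//; first last.
- by apply: erestrict_ge0 => z; exact: g0.
- by apply: (measurable_restrictT _ _).1 => //; exact: measurableX.
rewrite [RHS]integral_mkcond; apply: eq_integral => x _.
rewrite /fubini_F /patch; case: ifPn => Ax.
  rewrite [RHS]integral_mkcond; apply: eq_integral => y _.
  by rewrite in_setX/= Ax /patch.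
by rewrite integral0_eq// => y _; rewrite in_setX/= (negbTE Ax).
Qed.

Lemma ge0_integral_setX_swap (A : set T1) (D : set T2) (g : T1 * T2 -> \bar R) :
  measurable A -> measurable D -> measurable_fun (A `*` D) g ->
  (forall z, (A `*` D) z -> 0 <= g z)%E ->
  (\int[m1 \x m2]_(z in A `*` D) g z
   = \int[m2]_(y in D) \int[m1]_(x in A) g (x, y))%E.
Proof.
move=> mA mD mg g0; rewrite integral_mkcond fubini_tonelli2//; first last.
- by apply: erestrict_ge0 => z; exact: g0.
- by apply: (measurable_restrictT _ _).1 => //; exact: measurableX.
rewrite [RHS]integral_mkcond; apply: eq_integral => y _.
rewrite /fubini_G /patch; case: ifPn => Dy.
  rewrite [RHS]integral_mkcond; apply: eq_integral => x _.
  by rewrite in_setX/= Dy andbT /patch.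
by rewrite integral0_eq// => x _; rewrite in_setX/= (negbTE Dy) andbF.
Qed.

Lemma negligible_setX (E : set (T1 * T2)) : measurable E ->
  {ae m2, forall y, m1 (ysection E y) = 0%E} -> (m1 \x m2)%E E = 0%E.
Proof.
move=> mE H; rewrite -[E]setIT -integral_indic//.
have mI : measurable_fun setT (fun z => (\1_E z)%:E : \bar R).
  by apply/measurable_EFinP; exact: measurable_indic.
rewrite (fubini_tonelli2 _ mI); last by move=> z; rewrite lee_fin.
have mF : measurable_fun setT (m1 \o ysection E).
  exact: measurable_fun_ysection.
rewrite (_ : fubini_G _ _ = m1 \o ysection E); last first.
  apply/funext => y; rewrite /fubini_G/= -[ysection E y]setIT -integral_indic//.
    by apply: eq_integral => x _; rewrite !indicE mem_ysection.
  exact: measurable_ysection.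
rewrite (@ae_eq_integral _ _ _ m2 setT (cst 0%E))//; first exact: integral0.
by apply: filterS H => y /= Hy _; rewrite Hy.
Qed.

End product_tools.

(** * The first two moments of a centred normal law *)

Section density.
Local Open Scope ereal_scope.
Context d (T : measurableType d) {R : realType}.
Variables (mu nu : {measure set T -> \bar R}) (p : T -> R).
Hypotheses (mp : measurable_fun setT p) (p0 : forall x, (0 <= p x)%R).
Hypothesis nuE : forall A, measurable A -> nu A = \int[mu]_(x in A) (p x)%:E.
Import HBNNSimple.

(** Holds for indicators by assumption, hence for simple functions, hence for
    nonnegative functions by monotone convergence. *)
Lemma ge0_integral_density (f : T -> \bar R) :
  measurable_fun setT f -> (forall x, 0 <= f x) ->
  \int[nu]_x f x = \int[mu]_x (f x * (p x)%:E).
Proof.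
move=> mf f0; pose h := nnsfun_approx measurableT mf.
have mpE : measurable_fun setT (EFin \o p) by exact/measurable_EFinP.
have hE n : \int[nu]_x (h n x)%:E = \int[mu]_x ((h n x)%:E * (p x)%:E).
  under [LHS]eq_integral do rewrite fimfunE -fsumEFin//.
  rewrite [LHS]ge0_integral_fsum//; last 2 first.
  - by move=> r; exact/measurable_EFinP/measurableT_comp.
  - by move=> k x _; rewrite EFinM nnfun_muleindic_ge0.
  under [RHS]eq_integral.
    move=> x xD; rewrite fimfunE -fsumEFin// ge0_mule_fsuml; last first.
      by move=> r; rewrite EFinM nnfun_muleindic_ge0.
    over.
  rewrite [RHS]ge0_integral_fsum//; last 2 first.
  - move=> r; apply: emeasurable_funM => //.
    by apply/measurable_EFinP; apply/measurableT_comp.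
  - move=> k x _; apply: mule_ge0; last by rewrite lee_fin.
    by rewrite EFinM nnfun_muleindic_ge0.
  apply: eq_fsbigr => r; rewrite inE/= => -[x _ hx].
  have r0 : (0 <= r)%R by rewrite -hx.
  have mhr : measurable (h n @^-1` [set r]) by [].
  under eq_integral do rewrite EFinM.
  rewrite ge0_integralZl//; last exact/measurable_EFinP.
  rewrite integral_indic// setIT nuE//.
  rewrite [in LHS]integral_mkcond -ge0_integralZl ?lee_fin//; last 2 first.
  - by apply: (measurable_restrictT _ _).1 => //; exact: measurable_funTS.
  - by move=> y _; rewrite patchE; case: ifP => // _; rewrite lee_fin.
  apply: eq_integral => y _; rewrite EFinM -muleA; congr (_ * _).
  by rewrite patchE indicE; case: ifPn => _; rewrite ?mul1e ?mul0e.
have cvg_h x : (h n x)%:E @[n --> \oo] --> f x.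
  by apply: cvg_nnsfun_approx.
transitivity (lim (\int[nu]_x (h n x)%:E @[n --> \oo])).
  rewrite -monotone_convergence//=.
  - by apply: eq_integral => x _; apply/esym/cvg_lim => //; exact: cvg_h.
  - by move=> n; exact/measurable_EFinP/measurable_funTS.
  - by move=> n ? _; rewrite lee_fin.
  - by move=> ? _ ? ? mn; rewrite lee_fin; exact/lefP/nd_nnsfun_approx.
under eq_fun do rewrite hE.
rewrite -monotone_convergence//=.
- apply: eq_integral => x _; apply/cvg_lim => //.
  by apply: cvgeZr => //; exact: cvg_h.
- by move=> n; apply: emeasurable_funM => //; exact/measurable_EFinP.
- by move=> n x _; rewrite mule_ge0// lee_fin.
- move=> x _ a b ab; rewrite lee_wpmul2r ?lee_fin//.
  exact/lefP/nd_nnsfun_approx.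
Qed.

End density.

Section normal_moments.
Context {R : realType}.
Notation leb := (@lebesgue_measure R).

Lemma ge0_integral_normal_prob (m s : R) (f : R -> \bar R) :
  measurable_fun setT f -> (forall x, 0 <= f x)%E ->
  (\int[normal_prob m s]_x f x = \int[leb]_x (f x * (normal_pdf m s x)%:E))%E.
Proof.
move=> mf f0; apply: ge0_integral_density => //.
- exact: measurable_normal_pdf.
- exact: normal_pdf_ge0.
Qed.

Lemma normal_pdf_scale (s x : R) : 0 < s ->
  normal_pdf 0 s x = normal_pdf 0 1 (x / s) * s^-1.
Proof.
move=> s0; rewrite !normal_pdfE ?gt_eqF// /normal_peak /normal_fun.
rewrite !subr0 expr1n mul1r -(mulrnAr (s ^+ 2)) sqrtrM ?sqr_ge0// sqrtr_sqr gtr0_norm//.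
rewrite invfM -[LHS]mulrA [LHS]mulrC; congr (_ * _ * _).
congr expR; rewrite !mulNr exprMn exprVn; congr (- _).
by field; rewrite gt_eqF.
Qed.

(** The second moment of the standard normal law. Its value, 1, does not
    matter: every use is through positivity, finiteness and scaling. *)
Definition normal_var : R := fine (\int[normal_prob 0 1]_x (x ^+ 2)%:E).

(** One half of the Gaussian exponent absorbs the square, and the other half is
    the density of a normal law of twice the variance. *)
Lemma normal_moment2_fin :
  (\int[normal_prob (0 : R) 1]_x (x ^+ 2)%:E < +oo)%E.
Proof.
rewrite ge0_integral_normal_prob; last 2 first.
- by apply/measurable_EFinP; exact: measurable_funX.
- by move=> x; rewrite lee_fin sqr_ge0.
pose s : R := Num.sqrt 2.
have s0 : 0 < s by rewrite sqrtr_gt0.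
pose c := normal_peak (1 : R) * 4 / normal_peak s.
have pks := normal_peak_gt0 (lt0r_neq0 s0).
have c0 : 0 <= c.
  by rewrite /c !mulr_ge0 ?invr_ge0 ?normal_peak_ge0.
apply: (@le_lt_trans _ _ (\int[leb]_x (c%:E * (normal_pdf 0 s x)%:E))%E).
  apply: ge0_le_integral_dom => x _.
    by rewrite mule_ge0// lee_fin ?sqr_ge0// normal_pdf_ge0.
  rewrite -!EFinM lee_fin !normal_pdfE ?gt_eqF// /normal_fun !subr0.
  rewrite expr1n sqr_sqrtr//; pose e := expR (- (x ^+ 2 / 4)).
  have -> : - x ^+ 2 / (1 *+ 2) = - (x ^+ 2 / 4) + - (x ^+ 2 / 4) :> R by lra.
  have -> : - x ^+ 2 / (2 *+ 2) = - (x ^+ 2 / 4) :> R by lra.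
  have xe : x ^+ 2 * e <= 4.
    rewrite /e expRN ler_pdivrMr ?expR_gt0//.
    by have := expR_ge1Dx (x ^+ 2 / 4); lra.
  rewrite expRD -/e /c.
  rewrite [leLHS](_ : _ = normal_peak 1 * e * (x ^+ 2 * e)); last by ring.
  rewrite [leRHS](_ : _ = normal_peak 1 * e * 4); last by field; rewrite gt_eqF.
  by rewrite ler_wpM2l// mulr_ge0 ?normal_peak_ge0 ?expR_ge0.
rewrite ge0_integralZl//.
- by rewrite integral_normal_pdf mule1 ltry.
- by apply/measurable_EFinP; exact: measurable_normal_pdf.
- by move=> x _; rewrite lee_fin normal_pdf_ge0.
Qed.

Lemma normal_varE : (\int[normal_prob 0 1]_x (x ^+ 2)%:E = normal_var%:E)%E.
Proof.
rewrite fineK// ge0_fin_numE ?normal_moment2_fin//.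
by apply: integral_ge0 => x _; rewrite lee_fin sqr_ge0.
Qed.

(** Otherwise the law would be concentrated at 0, but it has no atoms. *)
Lemma normal_var_gt0 : 0 < normal_var.
Proof.
rewrite -lte_fin -normal_varE lt_neqAle integral_ge0 ?andbT; last first.
  by move=> x _; rewrite lee_fin sqr_ge0.
apply/eqP => H.
have mq : measurable_fun setT (fun x : measurableTypeR R => (x ^+ 2)%:E : \bar R).
  by apply/measurable_EFinP; exact: measurable_funX.
have := (ae_eq_integral_abs (normal_prob 0 1) measurableT mq).1.
under eq_integral do rewrite gee0_abs ?lee_fin ?sqr_ge0//.
rewrite -H => /(_ erefl) [N [mN N0 sN]].
have : normal_prob 0 1 (setT : set (measurableTypeR R)) = 0%E.
  have NE : normal_prob 0 1 (N `|` [set 0] : set (measurableTypeR R)) = 0%E.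
    apply/eqP; rewrite eq_le measure_ge0 andbT.
    apply: le_trans (measureU2 _ mN (measurable_set1 0)) _.
    have N1 : normal_prob 0 1 [set (0 : R)] = 0%E by exact: integral_set1.
    by rewrite -[leRHS]adde0; apply: leeD; rewrite le_eqVlt; apply/orP;
      left; apply/eqP; [exact: N0|exact: N1].
  apply/eqP; rewrite eq_le measure_ge0 andbT -[leRHS]NE.
  apply: le_measure; rewrite ?inE//; first exact: measurableU.
  move=> x _; have [->|x0] := eqVneq x 0; first by right.
  left; apply: sN => /= /(_ Logic.I) [/eqP]; rewrite sqrf_eq0.
  by rewrite (negbTE x0).
by rewrite probability_setT => /eqP; rewrite onee_eq0.
Qed.

Lemma normal_moment2 (s : R) : 0 < s ->
  (\int[normal_prob 0 s]_x (x ^+ 2)%:E = (s ^+ 2 * normal_var)%:E)%E.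
Proof.
move=> s0; have si0 : 0 < s^-1 by rewrite invr_gt0.
have mq : measurable_fun setT (fun x : R => (x ^+ 2)%:E : \bar R).
  by apply/measurable_EFinP; exact: measurable_funX.
have q0 (x : R) : (0 <= (x ^+ 2)%:E :> \bar R)%E by rewrite lee_fin sqr_ge0.
rewrite EFinM -normal_varE !ge0_integral_normal_prob//.
pose F (x : R) := x / s; pose G (u : R) := u ^+ 2 * normal_pdf 0 1 u.
have F'E : F^`()%classic = cst s^-1.
  by apply/funext => x; rewrite /F derive1E deriveM// derive_cst scaler0 add0r derive_id [LHS]mulr1.
rewrite (_ : \int[leb]_x ((x ^+ 2)%:E * (normal_pdf 0 1 x)%:E)%E
    = \int[leb]_x (G x)%:E)%E; last by [].
rewrite (@increasing_ge0_integration_by_substitutionT _ F G)//.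
- rewrite -ge0_integralZl//.
  + apply: eq_integral => x _; rewrite F'E/= !fctE -!EFinM /G /F; congr EFin.
    by rewrite (@normal_pdf_scale s)//; field; rewrite gt_eqF.
  + apply/measurable_EFinP/measurable_funM; last by rewrite F'E.
    apply: measurable_funM.
      by apply: measurable_funX; exact: measurable_funM.
    apply: (measurableT_comp (measurable_normal_pdf 0 1)).
    exact: measurable_funM.
  + move=> x _; rewrite lee_fin mulr_ge0//; last by rewrite F'E/= ltW.
    by rewrite /G/= mulr_ge0 ?sqr_ge0// normal_pdf_ge0.
- by move=> x y xy; rewrite /F ltr_pM2r.
- by rewrite F'E => x; exact: cvg_cst.
- by rewrite F'E; exact: is_cvg_cst.
- by rewrite F'E; exact: is_cvg_cst.
- by apply/gt0_cvgMlNy => //; exact: cvg_id.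
- by apply/gt0_cvgMly => //; exact: cvg_id.
- move=> x; apply: cvgM; first exact: sqr_continuous.
  by apply: continuous_normal_pdf; rewrite oner_eq0.
- by move=> x; rewrite mulr_ge0 ?sqr_ge0// normal_pdf_ge0.
Qed.

Lemma sq_integrable_normal (s : R) : 0 < s ->
  sq_integrable (normal_prob 0 s) setT (@idfun R).
Proof.
move=> s0; split => //.
  exact: measurable_id.
exact: (eq_ind_r (fun z => z < +oo)%E (ltry _) (normal_moment2 s0)).
Qed.

Lemma integrable_normal (s : R) : 0 < s ->
  (normal_prob 0 s).-integrable setT (fun x : measurableTypeR R => x%:E).
Proof.
move=> s0; have := sq_integrable_int measurableT _ (sq_integrable_normal s0).
apply; exact: (eq_ind_r (fun z => z < +oo)%E (ltry _) (probability_setT _)).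
Qed.

(** The density is even, so that the positive and the negative part of the
    identity have the same integral. *)
Lemma normal_mean (s : R) : 0 < s -> (\int[normal_prob 0 s]_x x%:E = 0)%E.
Proof.
move=> s0; rewrite integralE.
have mid : measurable_fun setT (fun x : R => x%:E) by exact/measurable_EFinP.
have fin0 : (\int[normal_prob 0 s]_x (fun x : R => x%:E)^\+ x)%E \is a fin_num.
  exact: integrable_pos_fin_num (integrable_normal s0).
rewrite [X in (_ - X)%E](_ : _ =
    (\int[normal_prob 0 s]_x (fun x : R => x%:E)^\+ x))%E ?subee//.
have mpos := measurable_funepos mid; have mneg := measurable_funeneg mid.
rewrite !ge0_integral_normal_prob//.
transitivity (\int[pushforward leb (-%R : _ -> measurableTypeR R)]_x
    ((fun x : R => x%:E)^\+ x * (normal_pdf 0 s x)%:E))%E; last first.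
  by apply: eq_measure_integral => A mA _; exact: lebesgue_measureN.
have mp : measurable_fun setT (fun x : R =>
    (fun x : R => x%:E)^\+ x * (normal_pdf 0 s x)%:E)%E.
  apply: emeasurable_funM => //.
  by apply/measurable_EFinP; exact: measurable_normal_pdf.
rewrite ge0_integral_pushforward//; last first.
  by move=> x _; rewrite mule_ge0// lee_fin normal_pdf_ge0.
rewrite preimage_setT; apply: eq_integral => x _ /=; congr (_ * _)%E.
  by rewrite funenegE funeposE.
by rewrite !normal_pdfE ?gt_eqF// /normal_fun !subr0 sqrrN.
Qed.

End normal_moments.

(** * Independence of the Brownian increments *)

Section brownian.
Context {R : realType} {dO : measure_display} {Omega : measurableType dO}.
Variables (P : probability Omega R) (B : R -> Omega -> R).
Hypotheses (hP : measure_is_complete P) (hB : brownian_motion P B).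
Notation Rt := (measurableTypeR R).

Lemma filtration_gen_measurable (t : R) (A : set Omega) :
  filtration_gen P B t A -> measurable A.
Proof.
have [mB _ _ _] := hB.
case=> [[s [C [/andP[s0 _] mC ->]]]|/hP //].
by rewrite -[X in measurable X]setTI; exact: mB.
Qed.

(** Completeness of [P] is what makes the null sets that augment the filtration
    measurable. *)
Lemma filtered_sub (t : R) (A : set Omega) :
  measurable (A : set (filtered P B t)) -> measurable A.
Proof.
move=> mA; apply: (smallest_sub _ _ mA).
  exact: sigma_algebra_measurable.
exact: filtration_gen_measurable.
Qed.

Lemma filtered_homo (s t : R) (A : set Omega) : s <= t ->
  measurable (A : set (filtered P B s)) ->
  measurable (A : set (filtered P B t)).
Proof.
move=> st mA; apply: (smallest_sub _ _ mA).
  exact: (@sigma_algebra_measurable _ (filtered P B t)).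
move=> C gC; apply: sub_sigma_algebra; move: gC => [[r [D [/andP[r0 rs] mD ->]]]|nC]; last by right.
by left; exists r, D; split => //; rewrite r0 (le_trans rs).
Qed.

Lemma measurable_filtered (t : R) (f : Omega -> R) :
  measurable_fun setT (f : filtered P B t -> R) -> measurable_fun setT f.
Proof. by move=> mf _ C mC; exact: filtered_sub (mf measurableT _ mC). Qed.

Lemma measurable_filtered_homo (s t : R) (f : Omega -> R) : s <= t ->
  measurable_fun setT (f : filtered P B s -> R) ->
  measurable_fun setT (f : filtered P B t -> R).
Proof. by move=> st mf _ C mC; exact: filtered_homo st (mf measurableT _ mC). Qed.

Lemma measurable_brownian (s t : R) : 0 <= s <= t ->
  measurable_fun setT (B s : filtered P B t -> R).
Proof.
move=> st _ C mC; rewrite setTI; apply: sub_sigma_algebra.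
by left; exists s, C.
Qed.

Lemma measurable_increment (s t u : R) : 0 <= s <= u -> 0 <= t <= u ->
  measurable_fun setT ((fun w => B t w - B s w) : filtered P B u -> R).
Proof.
by move=> su tu; apply: (@measurable_funB _ (filtered P B u)) => //; exact: measurable_brownian.
Qed.

Definition mfun_of d d' (T : measurableType d) (T' : measurableType d')
  (f : T -> T') (mf : measurable_fun setT f) : {mfun T >-> T'} :=
  MeasurableFun.Pack (MeasurableFun.Class (isMeasurableFun.Build _ _ _ _ _ mf)).

Section independence.
Variables (s t : R) (xi : Omega -> R).
Hypotheses (s0 : 0 <= s) (st : s < t).
Hypothesis mxi : measurable_fun setT (xi : filtered P B s -> R).

Let t0 : 0 <= t. Proof. exact: le_trans s0 (ltW st). Qed.
Let sts : 0 < Num.sqrt (t - s). Proof. by rewrite sqrtr_gt0 subr_gt0. Qed.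
Let N := normal_prob 0 (Num.sqrt (t - s)).
Let incr w := B t w - B s w.
Let mincr : measurable_fun setT (incr : Omega -> Rt).
Proof.
apply: (@measurable_filtered t); apply: measurable_increment.
  by rewrite s0 ltW.
by rewrite t0 lexx.
Qed.
Let mxi' : measurable_fun setT (xi : Omega -> Rt).
Proof. exact: measurable_filtered mxi. Qed.
Let pair w : Rt * Rt := (xi w, incr w).
Let mpair : measurable_fun setT pair.
Proof. exact/measurable_fun_pair. Qed.

(** The definition of Brownian motion gives the joint law on rectangles, which
    determines it. *)
Lemma increment_law (X : set (Rt * Rt)) : measurable X ->
  (distribution P (mfun_of mxi') \x N)%E X = distribution P (mfun_of mpair) X.
Proof.
apply: product_measure_unique => A C mA mC.
have [_ _ _ indep] := hB.
rewrite /distribution /pushforward /=.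
have := indep s t; rewrite s0 st => /(_ isT (xi @^-1` A) C _ mC) <- //.
by rewrite -[X in measurable X]setTI; exact: mxi.
Qed.

Variable h : Rt -> R.
Hypotheses (mh : measurable_fun setT h).
Hypothesis ih : N.-integrable setT (EFin \o h).
Hypothesis ixi : P.-integrable setT (EFin \o xi).

Let f (z : Rt * Rt) : \bar R := (z.1 * h z.2)%:E.
Let mf : measurable_fun setT f.
Proof.
apply/measurable_EFinP/measurable_funM; first exact: measurable_fst.
exact: (measurableT_comp mh measurable_snd).
Qed.

Let int_f : (distribution P (mfun_of mxi') \x N)%E.-integrable setT f.
Proof.
apply/(integrable12ltyP _ _ mf).
rewrite (_ : (\int[_]_x _)%E = \int[distribution P (mfun_of mxi')]_x
    (`|x|%:E * \int[N]_y `|h y|%:E))%E; last first.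
  apply: eq_integral => x _; rewrite -ge0_integralZl//.
  - by apply: eq_integral => y _; rewrite /f/= normrM EFinM.
  - by apply/measurable_EFinP; exact: measurableT_comp.
have mabs : measurable_fun setT (fun x : Rt => `|x|%:E : \bar R).
  by apply/measurable_EFinP; exact: normr_measurable.
rewrite ge0_integralZr//; last exact: integral_ge0.
rewrite ge0_integral_distribution//.
have /integrableP[_ Ioo] := ixi; have /integrableP[_ Hoo] := ih.
have I0 : (0 <= \int[P]_w `|xi w|%:E)%E by apply: integral_ge0.
by apply: lte_mul_pinfty => //; rewrite ge0_fin_numE.
Qed.

(** The joint law of [xi] and of the increment is the product of their laws, so
    that Fubini's theorem factors the expectation. *)
Lemma increment_independent :
  P.-integrable setT (EFin \o (fun w => xi w * h (B t w - B s w))) /\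
  (\int[P]_w (xi w * h (B t w - B s w))%:E
   = \int[N]_x (h x)%:E * \int[P]_w (xi w)%:E)%E.
Proof.
have int_pair : (distribution P (mfun_of mpair)).-integrable setT f.
  apply/integrableP; split => //; have /integrableP[_] := int_f.
  by apply: le_lt_trans; rewrite le_eqVlt; apply/orP; left; apply/eqP;
    apply: eq_measure_integral => A mA _; exact/esym/increment_law.
have int_P : P.-integrable setT (f \o pair).
  apply/integrableP; split; first exact: (measurableT_comp mf mpair).
  have /integrableP[_] := int_pair.
  have maf : measurable_fun setT (abse \o f) by exact: measurableT_comp.
  have af0 z : (0 <= (abse \o f) z)%E by rewrite /=.
  by rewrite (@ge0_integral_distribution _ _ _ _ _ P (mfun_of mpair) _ maf af0).
split; first exact: int_P.
rewrite [LHS](_ : _ = \int[P]_w (f \o pair) w)%E//.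
rewrite -(@integral_distribution _ _ _ _ _ P (mfun_of mpair))//.
transitivity (\int[(distribution P (mfun_of mxi') \x N)%E]_z f z)%E.
  by apply: eq_measure_integral => A mA _; exact/esym/increment_law.
rewrite -integral12_prod_meas1//.
have [c hc] : exists c, (\int[N]_x (h x)%:E = c%:E)%E.
  have := integrable_fin_num measurableT ih.
  by case: (integral N _ _) => [c| |]// _; exists c.
transitivity (\int[distribution P (mfun_of mxi')]_x (c%:E * x%:E))%E.
  apply: eq_integral => x _; rewrite /fubini_F -hc muleC -integralZl//.
have mcx : measurable_fun setT (fun x : Rt => c%:E * x%:E : \bar R)%E.
  by apply: emeasurable_funM => //; exact/measurable_EFinP.
rewrite (@integral_distribution _ _ _ _ _ P (mfun_of mxi') _ mcx); last first.
  exact: (integrableZl measurableT).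
by rewrite hc -integralZl.
Qed.
End independence.
End brownian.

(** * Testing an increment of the Brownian motion *)

Lemma cvge0_lt {R : realType} {I : Type} {F : set_system I} {FF : Filter F}
    (f : I -> \bar R) (e : R) :
  f @ F --> 0%E -> 0 < e -> \forall i \near F, (f i < e%:E)%E.
Proof.
move=> f0 e0; apply: (f0 [set x | x < e%:E]%E).
by exact: nbhs_open_ereal_lt.
Qed.

Section sq_convergence.
Context d (T : measurableType d) {R : realType}.
Variable mu : {measure set T -> \bar R}.
Variables (D : set T) (mD : measurable D) (f g : T -> R) (h : nat -> T -> R).
Hypotheses (If : sq_integrable mu D f) (mg : measurable_fun D g).
Hypothesis Ih : forall n, sq_integrable mu D (h n).
Hypothesis hg :
  (fun n => \int[mu]_(x in D) ((h n x - g x) ^+ 2)%:E)%E @ \oo --> 0%E.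

Lemma sq_integrable_lim : sq_integrable mu D g.
Proof.
have [n hn] : exists n, (\int[mu]_(x in D) ((h n x - g x) ^+ 2)%:E < +oo)%E.
  have : \forall n \near \oo,
      (\int[mu]_(x in D) ((h n x - g x) ^+ 2)%:E < 1%:E)%E.
    exact: cvge0_lt hg ltr01.
  by case=> n _ /(_ n (leqnn n)) H; exists n; apply: lt_trans H _; rewrite ltry.
have Id : sq_integrable mu D (h n \- g).
  by split => //; apply: measurable_funB => //; have [] := Ih n.
rewrite (_ : g = h n \- (h n \- g)); first exact: sq_integrableB.
by apply/funext => x /=; rewrite opprB addrC subrK.
Qed.

(** Pairing with a fixed square-integrable function is continuous for
    convergence in mean square. *)
Lemma cvg_Rintegral_sq :
  (fun n => \int[mu]_(x in D) (f x * h n x)) @ \oo -->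
  \int[mu]_(x in D) (f x * g x).
Proof.
have Ig := sq_integrable_lim.
have [mf ff] := If.
pose c := fine (\int[mu]_(x in D) (f x ^+ 2)%:E).
have c0 : 0 <= c.
  by apply: fine_ge0; apply: integral_ge0 => x _; rewrite lee_fin sqr_ge0.
have cE : (\int[mu]_(x in D) (f x ^+ 2)%:E = c%:E)%E.
  rewrite fineK// ge0_fin_numE//.
  by apply: integral_ge0 => x _; rewrite lee_fin sqr_ge0.
apply/cvgrPdist_le => e e0.
pose l := e / (c + 1).
have l0 : 0 < l by rewrite divr_gt0// ltr_wpDl.
have H : \forall n \near \oo, (\int[mu]_(x in D) ((h n x - g x) ^+ 2)%:E <
    (e * l)%:E)%E.
  by apply: cvge0_lt hg _; rewrite mulr_gt0.
near=> n.
have Hn : (\int[mu]_(x in D) ((h n x - g x) ^+ 2)%:E < (e * l)%:E)%E.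
  by near: n.
have Ihn := Ih n.
have Id : sq_integrable mu D (h n \- g) by exact: sq_integrableB.
rewrite distrC -RintegralB//; [|exact: sq_integrableM..].
rewrite (_ : Rintegral _ _ _ = \int[mu]_(x in D) (f x * (h n \- g) x)); last first.
  by apply: eq_Rintegral => x _; rewrite mulrBr.
rewrite -lee_fin; apply: le_trans (normr_Rintegral_le _ mD _) _.
  by apply: measurable_funM => //; case: Id.
apply: le_trans (integral_amgm mu mD mf _ l0) _; first by case: Id.
rewrite cE -EFinM.
apply: (@le_trans _ _ ((l / 2 * c)%:E + (l^-1 / 2)%:E * (e * l)%:E))%E.
  by rewrite leeD2l// lee_pmul2l ?lte_fin ?divr_gt0 ?invr_gt0// ltW.
rewrite -EFinM -EFinD lee_fin.
rewrite (_ : l^-1 / 2 * (e * l) = e / 2); last by field; rewrite gt_eqF.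
have : l * c <= e.
  by rewrite /l mulrAC ler_pdivrMr ?ltr_wpDl// mulrDr mulr1 lerDl ltW.
lra.
Unshelve. all: by end_near. Qed.

End sq_convergence.

Section ito.
Context {R : realType} {dO : measure_display} {Omega : measurableType dO}.
Variables (P : probability Omega R) (B : R -> Omega -> R).
Hypotheses (hP : measure_is_complete P) (hB : brownian_motion P B).
Notation Rt := (measurableTypeR R).
Notation leb := (@lebesgue_measure R).
Notation kappa := (@normal_var R).

Let PToo : (P setT < +oo)%E.
Proof. by rewrite probability_setT ltry. Qed.

Lemma Rintegral_factor (a b : \bar R) (c : R) : a = (c%:E * b)%E ->
  b \is a fin_num -> fine a = c * fine b.
Proof. by move=> ->; case: b. Qed.

Lemma increment_mean (s t : R) (xi : Omega -> R) : 0 <= s <= t ->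
  measurable_fun setT (xi : filtered P B s -> R) ->
  P.-integrable setT (EFin \o xi) ->
  P.-integrable setT (EFin \o (fun w => xi w * (B t w - B s w))) /\
  \int[P]_w (xi w * (B t w - B s w)) = 0.
Proof.
move=> /andP[s0]; rewrite le_eqVlt => /predU1P[<- _ _|st mxi ixi].
  rewrite (_ : (fun w => _) = cst 0).
    by split; [exact: integrable0|rewrite /Rintegral integral0].
  by apply/funext => w; rewrite subrr mulr0.
have sts : 0 < Num.sqrt (t - s) by rewrite sqrtr_gt0 subr_gt0.
have mid : measurable_fun setT (id : Rt -> R) by exact: measurable_id.
have iid : (normal_prob 0 (Num.sqrt (t - s))).-integrable setT
    (EFin \o (id : Rt -> R)) by exact: integrable_normal.
have [I1 I2] := increment_independent hP hB s0 st mxi mid iid ixi.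
split => //; rewrite /Rintegral I2.
by rewrite [X in (X * _)%E](normal_mean sts) mul0e.
Qed.

Lemma increment_moment2 (s t : R) (xi : Omega -> R) : 0 <= s <= t ->
  measurable_fun setT (xi : filtered P B s -> R) ->
  P.-integrable setT (EFin \o xi) ->
  P.-integrable setT (EFin \o (fun w => xi w * (B t w - B s w) ^+ 2)) /\
  (\int[P]_w (xi w * (B t w - B s w) ^+ 2)%:E
  = (kappa * (t - s))%:E * \int[P]_w (xi w)%:E)%E.
Proof.
move=> /andP[s0]; rewrite le_eqVlt => /predU1P[<- _ _|st mxi ixi].
  rewrite subrr mulr0 mul0e.
  rewrite (_ : (fun w => _) = cst 0).
    split; first exact: integrable0.
    by rewrite integral0_eq// => w _; rewrite subrr expr0n mulr0.
  by apply/funext => w; rewrite subrr expr0n mulr0.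
have sts : 0 < Num.sqrt (t - s) by rewrite sqrtr_gt0 subr_gt0.
have mq : measurable_fun setT (fun x : Rt => x ^+ 2) by exact: measurable_funX.
have iq : (normal_prob 0 (Num.sqrt (t - s))).-integrable setT
    (EFin \o (fun x : Rt => x ^+ 2)).
  apply/integrableP; split; first exact/measurable_EFinP.
  under eq_integral do rewrite /= ger0_norm ?sqr_ge0//.
  exact: (eq_ind_r (fun z => z < +oo)%E (ltry _) (normal_moment2 sts)).
have [I1 I2] := increment_independent hP hB s0 st mxi mq iq ixi.
split => //; rewrite I2; congr (_ * _)%E.
rewrite [LHS](normal_moment2 sts) sqr_sqrtr ?subr_ge0 ?ltW//.
by rewrite mulrC.
Qed.

Lemma sq_mul_increment (s t : R) (xi : Omega -> R) : 0 <= s <= t ->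
  measurable_fun setT (xi : filtered P B s -> R) ->
  sq_integrable P setT xi ->
  sq_integrable P setT (fun w => xi w * (B t w - B s w)) /\
  (\int[P]_w ((xi w * (B t w - B s w)) ^+ 2)%:E
  = (kappa * (t - s))%:E * \int[P]_w (xi w ^+ 2)%:E)%E.
Proof.
move=> /[dup] st /andP[s0 s_t] mxi [mxi' xi2].
have mxi2 : measurable_fun setT ((fun w => xi w ^+ 2) : filtered P B s -> R).
  exact: measurable_funX.
have ixi2 : P.-integrable setT (EFin \o (fun w => xi w ^+ 2)).
  apply/integrableP; split; first exact/measurable_EFinP/measurable_funX.
  by under eq_integral do rewrite /= ger0_norm ?sqr_ge0//.
have [I1 I2] := increment_moment2 st mxi2 ixi2.
have I3 : (\int[P]_w ((xi w * (B t w - B s w)) ^+ 2)%:E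
  = (kappa * (t - s))%:E * \int[P]_w (xi w ^+ 2)%:E)%E.
  by rewrite -I2; apply: eq_integral => w _; rewrite exprMn.
split => //; split.
  apply: measurable_funM => //; apply: (measurable_filtered hP hB (t := t)).
  by apply: measurable_increment; rewrite ?st// (le_trans s0 s_t) lexx.
rewrite I3 lte_mul_pinfty//.
by rewrite lee_fin mulr_ge0 ?subr_ge0// ltW// normal_var_gt0.
Qed.

Section test.
Variables (T t : R) (Z : Omega -> R).
Hypotheses (t0 : 0 <= t) (tT : t <= T).
Hypothesis mZ : measurable_fun setT (Z : filtered P B t -> R).
Hypothesis IZ : sq_integrable P setT Z.

Let W w := Z w * (B T w - B t w).

Lemma sq_test : sq_integrable P setT W.
Proof. by have [|] := sq_mul_increment _ mZ IZ (t := T); rewrite ?t0. Qed.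

Section test_increment.
Variables (h : Omega -> R) (M : R).
Hypothesis hM : forall w, `|h w| <= M.

Lemma sq_bounded_increment (a b : R) : 0 <= a <= b ->
  measurable_fun setT (h : filtered P B a -> R) ->
  sq_integrable P setT (fun w => h w * (B b w - B a w)).
Proof.
move=> ab mh; have mh' := measurable_filtered hP hB mh.
have Ih : sq_integrable P setT h.
  rewrite (_ : h = h \* cst 1); last by apply/funext => w /=; rewrite mulr1.
  apply: (@sq_integrableMb _ _ _ _ _ _ _ M) => //.
  exact: (sq_integrable_cst _ measurableT PToo).
by have [] := sq_mul_increment ab mh Ih.
Qed.

(* [Z * h * (B b - B a)] is known at time [t]. *)
Let before (a b : R) : 0 <= a <= b -> b <= t ->
  measurable_fun setT (h : filtered P B a -> R) ->
  \int[P]_w (W w * (h w * (B b w - B a w))) = 0.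
Proof.
move=> /[dup] ab /andP[a0 a_b] bt mh.
have Id := sq_bounded_increment ab mh.
have : P.-integrable setT (EFin \o (Z \* (fun w => h w * (B b w - B a w)))).
  exact: sq_integrableM.
move=> /increment_mean -/(_ t T); rewrite t0 tT => /(_ isT)[].
  apply: (@measurable_funM _ (filtered P B t)) => //.
  apply: (@measurable_funM _ (filtered P B t)).
    by apply: measurable_filtered_homo mh; exact: le_trans bt.
  apply: measurable_increment => //; rewrite ?a0 ?(le_trans a_b)//.
  by rewrite (le_trans a0).
move=> _ <-; apply: eq_Rintegral => w _; rewrite /W /=; ring.
Qed.

(* Cut [B T - B t] at [a] and [b]: the middle piece is squared, and the other two
   have mean zero given the factors that they multiply. *)
Let after (a b : R) : t <= a <= b -> b <= T ->
  measurable_fun setT (h : filtered P B a -> R) ->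
  \int[P]_w (W w * (h w * (B b w - B a w)))
  = kappa * (b - a) * \int[P]_w (Z w * h w).
Proof.
move=> /andP[ta ab] bT mh; have a0 := le_trans t0 ta; have b0 := le_trans a0 ab.
have mh' := measurable_filtered hP hB mh.
have mZa := measurable_filtered_homo ta mZ.
have IZh : sq_integrable P setT (h \* Z) by exact: (@sq_integrableMb _ _ _ _ _ _ _ M).
have mZh : measurable_fun setT ((h \* Z) : filtered P B a -> R).
  exact: (@measurable_funM _ (filtered P B a)).
have iZh : P.-integrable setT (EFin \o (h \* Z)) by exact: sq_integrable_int.
have aab : 0 <= a <= b by rewrite a0.
have tta : 0 <= t <= a by rewrite t0.
have bbT : 0 <= b <= T by rewrite b0.
have [IZhd _] := sq_mul_increment aab mZh IZh.
have mZhd : measurable_fun setT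
    ((fun w => (h \* Z) w * (B b w - B a w)) : filtered P B b -> R).
  apply: (@measurable_funM _ (filtered P B b)).
    exact: measurable_filtered_homo mZh.
  by apply: measurable_increment; rewrite ?a0 ?b0 ?lexx.
have [IZd _] := sq_mul_increment tta mZ IZ.
have IhZd : sq_integrable P setT (h \* (fun w => Z w * (B a w - B t w))).
  exact: (@sq_integrableMb _ _ _ _ _ _ _ M).
have mhZd : measurable_fun setT
    ((h \* (fun w => Z w * (B a w - B t w))) : filtered P B a -> R).
  apply: (@measurable_funM _ (filtered P B a)) => //.
  apply: (@measurable_funM _ (filtered P B a)) => //.
  by apply: measurable_increment; rewrite ?t0 ?a0 ?lexx.
have [i1 e1] := increment_mean bbT mZhd (sq_integrable_int measurableT PToo IZhd).
have [i2 e2] := increment_moment2 aab mZh iZh.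
have [i3 e3] := increment_mean aab mhZd (sq_integrable_int measurableT PToo IhZd).
transitivity (\int[P]_w ((h \* Z) w * (B b w - B a w) * (B T w - B b w)
   + (h \* Z) w * (B b w - B a w) ^+ 2
   + (h \* (fun w => Z w * (B a w - B t w))) w * (B b w - B a w))).
  by apply: eq_Rintegral => w _; rewrite /W/=; ring.
rewrite RintegralD//; last exact: (integrableD measurableT i1 i2).
rewrite RintegralD// e1 e3 addr0 add0r.
rewrite (_ : \int[P]_w (Z w * h w) = \int[P]_w (h \* Z) w); last first.
  by apply: eq_Rintegral => w _ /=; rewrite mulrC.
by apply: Rintegral_factor e2 _; exact: integrable_fin_num iZh.
Qed.

(** The increments of [B] over disjoint intervals are uncorrelated given the
    past. With [W = Z * (B T - B t)], only the part of the interval from [a] to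
    [b] that lies after [t] contributes, and it contributes [kappa] times its length. *)
Lemma test_increment (a b : R) : 0 <= a <= b -> b <= T ->
  measurable_fun setT (h : filtered P B a -> R) ->
  \int[P]_w (W w * (h w * (B b w - B a w)))
  = kappa * (Num.max b t - Num.max a t) * \int[P]_w (Z w * h w).
Proof.
move=> /[dup] a0b /andP[a0 ab] bT mh; have [bt|tb] := leP b t.
  rewrite before// max_r ?(le_trans ab)// subrr mulr0 mul0r//.
have [at_|ta] := leP a t; last first.
  by rewrite after// ?(ltW ta).
have mht := measurable_filtered_homo at_ mh.
have att : 0 <= a <= t by rewrite a0.
have ttb : 0 <= t <= b by rewrite t0 ltW.
have tbt : t <= t <= b by rewrite lexx ltW.
rewrite -(after tbt bT mht) -[RHS]addr0 -(before att (lexx t) mh).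
have i1 := sq_integrableM measurableT sq_test (sq_bounded_increment ttb mht).
have i2 := sq_integrableM measurableT sq_test (sq_bounded_increment att mh).
by rewrite -RintegralD//; apply: eq_Rintegral => w _; ring.
Qed.

End test_increment.
End test.
End ito.

(** * Testing a stochastic integral *)

Section sums.
Context d (T : measurableType d) {R : realType}.
Variable mu : {measure set T -> \bar R}.
Variables (D : set T) (mD : measurable D).

Lemma sq_integrable_sum n (F : 'I_n -> T -> R) :
  (forall i, sq_integrable mu D (F i)) ->
  sq_integrable mu D (fun x => \sum_(i < n) F i x).
Proof.
elim: n F => [|n IH] F IF.
  rewrite (_ : (fun _ => _) = cst 0); last by apply/funext => x; rewrite big_ord0.
  by split => //; rewrite integral0_eq ?ltry// => x _; rewrite expr0n.
under eq_fun do rewrite big_ord_recr.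
by apply: (sq_integrableD mD (IH _ _) (IF ord_max)) => i; exact: IF.
Qed.

Lemma Rintegral_sum n (F : 'I_n -> T -> R) :
  (forall i, mu.-integrable D (EFin \o F i)) ->
  mu.-integrable D (EFin \o (fun x => \sum_(i < n) F i x)) /\
  \int[mu]_(x in D) (\sum_(i < n) F i x) = \sum_(i < n) \int[mu]_(x in D) F i x.
Proof.
elim: n F => [|n IH] F IF.
  rewrite (_ : (fun _ => _) = cst 0); last by apply/funext => x; rewrite big_ord0.
  by split; [exact: integrable0|rewrite /Rintegral integral0 big_ord0].
have [I1 I2] := IH (fun i => F (widen_ord (leqnSn n) i)) (fun i => IF _).
have E : (fun x => \sum_(i < n.+1) F i x) =
    (fun x => \sum_(i < n) F (widen_ord (leqnSn n) i) x + F ord_max x).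
  by apply/funext => x; rewrite big_ord_recr.
rewrite E; split; first exact: (integrableD mD I1 (IF ord_max)).
by rewrite RintegralD// I2 big_ord_recr.
Qed.

End sums.

Section product_integrals.
Context d1 d2 (T1 : measurableType d1) (T2 : measurableType d2) {R : realType}.
Variable m1 : {sigma_finite_measure set T1 -> \bar R}.
Variable m2 : {sigma_finite_measure set T2 -> \bar R}.

Lemma measurable_swap_setX d (T3 : measurableType d) (A : set T1) (D : set T2)
    (f : T1 * T2 -> T3) : measurable A -> measurable D ->
  measurable_fun (A `*` D) f ->
  measurable_fun (D `*` A) (fun q => f (q.2, q.1)).
Proof.
move=> mA mD mf.
have ms : measurable_fun (D `*` A) (fun q : T2 * T1 => (q.2, q.1)).
  by apply: measurable_funTS; apply/measurable_fun_pair.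
have sub : (fun q : T2 * T1 => (q.2, q.1)) @` (D `*` A) `<=` A `*` D.
  by move=> _ [[y x] [/= Dy Ax] <-].
exact: (measurable_comp (measurableX mA mD) sub mf ms).
Qed.

Lemma integral_fst (A : set T2) (xi : T1 -> R) : measurable A ->
  (m2 A < +oo)%E -> m1.-integrable setT (EFin \o xi) ->
  (m1 \x m2)%E.-integrable (setT `*` A) (EFin \o (xi \o fst)) /\
  \int[(m1 \x m2)%E]_(p in setT `*` A) xi p.1 = \int[m1]_x xi x * fine (m2 A).
Proof.
move=> mA Aoo ixi; have [mxi xioo] := (integrableP _ _ _ ixi).
have mxi' : measurable_fun setT xi by exact/measurable_EFinP.
have mTA : measurable (setT `*` A : set (T1 * T2)) by exact: measurableX.
have mf : measurable_fun setT (xi \o fst : T1 * T2 -> R).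
  exact: (measurableT_comp mxi' measurable_fst).
have i1 : (m1 \x m2)%E.-integrable (setT `*` A) (EFin \o (xi \o fst)).
  apply/integrableP; split; first exact/measurable_EFinP/measurable_funTS.
  rewrite ge0_integral_setX//; last first.
    apply: measurable_funTS; apply: measurableT_comp => //.
    exact/measurable_EFinP.
  rewrite [ltLHS](_ : _ = \int[m1]_x (`|xi x|%:E * m2 A))%E; last first.
    by apply: eq_integral => x _; exact: (integral_cst m2 mA `|xi x|%:E).
  have ma : measurable_fun setT (fun x => `|xi x|%:E).
    by apply/measurable_EFinP; exact: measurableT_comp.
  rewrite ge0_integralZr//.
  by rewrite lte_mul_pinfty ?integral_ge0// ge0_fin_numE ?integral_ge0.
split => //; rewrite /Rintegral integral_mkcond.
have /integral12_prod_meas1 <- : (m1 \x m2)%E.-integrable setT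
    ((fun p : T1 * T2 => (xi p.1)%:E) \_ (setT `*` A)).
  exact/(integrable_mkcond _ mTA).
transitivity (fine (\int[m1]_x ((xi x)%:E * (fine (m2 A))%:E))%E).
  congr fine; apply: eq_integral => x _; rewrite /fubini_F fineK ?ge0_fin_numE//.
  rewrite -[RHS](integral_cst m2 mA) [RHS]integral_mkcond; apply: eq_integral => y _.
  by rewrite /patch in_setX in_setT.
rewrite integralZr// fineM//; exact: integrable_fin_num.
Qed.

End product_integrals.

Section slab.
Context {R : realType} {dO : measure_display} {Omega : measurableType dO}.
Variable P : probability Omega R.
Notation Rt := (measurableTypeR R).
Notation leb := (@lebesgue_measure R).
Notation PL := (P \x leb)%E.

Lemma measurable_slab (A : set Rt) : measurable A ->
  measurable (setT `*` A : set (Omega * Rt)).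
Proof. exact: measurableX. Qed.

Lemma lebesgue_itv_oc (a b : R) : a <= b -> leb `]a, b] = (b - a)%:E.
Proof.
rewrite lebesgue_measure_itv/= lte_fin le_eqVlt => /predU1P[->|->//].
by rewrite ltxx subrr.
Qed.

Lemma measure_slab (A : set Rt) : measurable A -> PL (setT `*` A) = leb A.
Proof.
by move=> mA; rewrite product_measure1E// [X in (X * _)%E]probability_setT mul1e.
Qed.

Lemma integral_sqr_fst (Z : Omega -> R) (A : set Rt) : measurable A ->
  measurable_fun setT Z ->
  (\int[PL]_(p in setT `*` A) ((Z p.1) ^+ 2)%:E =
   leb A * \int[P]_w (Z w ^+ 2)%:E)%E.
Proof.
move=> mA mZ; rewrite ge0_integral_setX_swap//; last 2 first.
- apply/measurable_EFinP/measurable_funX.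
  by apply: measurable_funTS; exact: (measurableT_comp mZ measurable_fst).
- by move=> p _; rewrite lee_fin sqr_ge0.
rewrite muleC.
exact: (integral_cst leb mA (\int[P]_w (Z w ^+ 2)%:E)%E).
Qed.

Lemma sq_integrable_fst (Z : Omega -> R) (A : set Rt) : measurable A ->
  (leb A < +oo)%E -> sq_integrable P setT Z ->
  sq_integrable PL (setT `*` A) (Z \o fst).
Proof.
move=> mA Aoo [mZ Z2]; split.
  by apply: measurable_funTS; exact: (measurableT_comp mZ measurable_fst).
rewrite integral_sqr_fst// lte_mul_pinfty// ge0_fin_numE//.
Qed.

Lemma lebesgue_itv_lty (b : bool) (a c : R) :
  (leb [set` Interval (BSide b a) (BRight c)] < +oo)%E.
Proof.
by rewrite lebesgue_measure_itv/=; case: ifP => _; rewrite ?ltry// -EFinB ltry.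
Qed.

Lemma slab_lty (b : bool) (a c : R) :
  (PL (setT `*` [set` Interval (BSide b a) (BRight c)]) < +oo)%E.
Proof. by rewrite measure_slab// lebesgue_itv_lty. Qed.

Lemma tail_sub_slab (t T : R) : 0 <= t ->
  (setT `*` `]t, T] : set (Omega * Rt)) `<=` setT `*` `[0, T].
Proof.
move=> t0 [w s] /= [_]; rewrite !in_itv/= => /andP[ts ->]; split => //.
by rewrite (le_trans t0) ?ltW.
Qed.

End slab.

Section ito.
Context {R : realType} {dO : measure_display} {Omega : measurableType dO}.
Variables (P : probability Omega R) (B : R -> Omega -> R).
Hypotheses (hP : measure_is_complete P) (hB : brownian_motion P B).
Notation Rt := (measurableTypeR R).
Notation leb := (@lebesgue_measure R).
Notation kappa := (@normal_var R).
Notation PL := (P \x leb)%E.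

Let PToo : (P setT < +oo)%E.
Proof. by rewrite probability_setT ltry. Qed.

Section simple.
Variables (tau : R) (h : simple_process P B tau).

Lemma sp_time_le i j : (i <= j <= sp_size h)%N -> sp_time h i <= sp_time h j.
Proof.
elim: j => [|j IH]; first by rewrite leqn0 => /andP[/eqP->].
rewrite leq_eqVlt => /andP[/orP[/eqP->//|ij] jn].
by rewrite (le_trans (IH _)) ?sp_time_incr// -ltnS ij ltnW.
Qed.

Lemma sp_time_ge0 i : (i <= sp_size h)%N -> 0 <= sp_time h i.
Proof. by move=> ih; rewrite -(sp_time_first h) sp_time_le. Qed.

Lemma sp_time_le_last i : (i <= sp_size h)%N -> sp_time h i <= tau.
Proof. by move=> ih; rewrite -[leRHS](sp_time_last h) sp_time_le ?ih/=. Qed.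

Lemma sp_time_itv (i : 'I_(sp_size h)) : 0 <= sp_time h i <= sp_time h i.+1.
Proof. by rewrite sp_time_ge0 ?sp_time_incr// ltnW. Qed.

Lemma measurable_sp_eval :
  measurable_fun setT (fun p : Omega * Rt => sp_eval h p.2 p.1).
Proof.
apply: measurable_sum => i; apply: measurable_funM.
  apply: (measurableT_comp _ measurable_fst).
  exact: measurable_filtered (sp_val_adapted (ltn_ord i)).
apply: (measurableT_comp _ measurable_snd); exact: measurable_indic.
Qed.

Lemma sp_eval_bounded : exists M, forall s w, `|sp_eval h s w| <= M.
Proof.
have [M hM] := sp_val_bounded h.
exists (\sum_(i < sp_size h) M) => s w.
apply: le_trans (ler_norm_sum _ _ _) _; apply: ler_sum => i _.
apply: le_trans (hM i w (ltn_ord i)); rewrite normrM ler_piMr//.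
by rewrite indicE; case: (_ \in _); rewrite ?normr1 ?normr0.
Qed.

Lemma sq_sp_integral : sq_integrable P setT (sp_integral h).
Proof.
have [M hM] := sp_val_bounded h.
apply: sq_integrable_sum => // i.
apply: (sq_bounded_increment hP hB (M := M)) => //.
- by move=> w; exact: hM.
- exact: sp_time_itv.
- exact: sp_val_adapted.
Qed.

Variables (T t : R) (Z : Omega -> R).
Hypotheses (t0 : 0 <= t) (tT : t <= T) (tauT : tau <= T).
Hypothesis mZ : measurable_fun setT (Z : filtered P B t -> R).
Hypothesis IZ : sq_integrable P setT Z.

Lemma test_simple :
  \int[P]_w (Z w * (B T w - B t w) * sp_integral h w) =
  kappa * \sum_(i < sp_size h)
   ((Num.max (sp_time h i.+1) t - Num.max (sp_time h i) t)
     * \int[P]_w (Z w * sp_val h i w)).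
Proof.
have [M hM] := sp_val_bounded h.
rewrite mulr_sumr.
have IW := sq_test hP hB t0 tT mZ IZ.
have Ii (i : 'I_(sp_size h)) : sq_integrable P setT (fun w => sp_val h i w *
    (B (sp_time h i.+1) w - B (sp_time h i) w)).
  apply: (sq_bounded_increment hP hB (M := M)) => //.
  - by move=> w; exact: hM.
  - exact: sp_time_itv.
  - exact: sp_val_adapted.
have [_ E] := Rintegral_sum measurableT (fun i => sq_integrableM measurableT IW (Ii i)).
transitivity (\int[P]_w (\sum_(i < sp_size h) (Z w * (B T w - B t w) *
   (sp_val h i w * (B (sp_time h i.+1) w - B (sp_time h i) w))))).
  by apply: eq_Rintegral => w _; rewrite /sp_integral mulr_sumr.
rewrite [LHS]E; apply: eq_bigr => i _; rewrite mulrA.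
apply: (test_increment hP hB t0 tT mZ IZ (M := M)).
- by move=> w; exact: hM.
- exact: sp_time_itv.
- by apply: le_trans tauT; exact: sp_time_le_last.
- exact: sp_val_adapted.
Qed.

Lemma lebesgue_itvI (a b : R) : a <= b -> b <= T ->
  leb (`]t, T] `&` `]a, b]) = (Num.max b t - Num.max a t)%:E.
Proof.
move=> ab bT; rewrite (_ : _ `&` _ = `]Num.max a t, b]%classic); last first.
  apply/seteqP; split => x /=; rewrite !in_itv/= gt_max.
    by move=> [/andP[-> _] /andP[-> ->]].
  move=> /andP[/andP[-> ->] xb]; split; last by [].
  by rewrite (le_trans xb).
rewrite lebesgue_measure_itv/= lte_fin gt_max.
have [bt|tb] := leP b t.
  by rewrite andbF max_r ?subrr// (le_trans ab).
rewrite andbT; move: ab; rewrite le_eqVlt => /predU1P[->|->//].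
by rewrite ltxx max_l ?subrr// ltW.
Qed.

Let mtT : measurable (setT `*` `]t, T] : set (Omega * Rt)).
Proof. exact: measurableX. Qed.

(** The same sum as in [test_simple]: each step contributes the length of its
    part after [t]. *)
Lemma integral_simple :
  \int[PL]_(p in setT `*` `]t, T]) (Z p.1 * sp_eval h p.2 p.1) =
  \sum_(i < sp_size h)
   ((Num.max (sp_time h i.+1) t - Num.max (sp_time h i) t)
     * \int[P]_w (Z w * sp_val h i w)).
Proof.
have [M hM] := sp_val_bounded h.
pose A (i : 'I_(sp_size h)) : set Rt := `]sp_time h i, sp_time h i.+1]%classic.
have mA i : measurable (A i) by exact: measurable_itv.
pose F (i : 'I_(sp_size h)) (p : Omega * Rt) := (Z p.1 * sp_val h i p.1) * \1_(A i) p.2.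
have mtA i : measurable (`]t, T] `&` A i : set Rt) by exact: measurableI.
have AE (i : 'I_(sp_size h)) : leb (`]t, T] `&` A i) =
   (Num.max (sp_time h i.+1) t - Num.max (sp_time h i) t)%:E.
  apply: lebesgue_itvI; first by have /andP[] := sp_time_itv i.
  by apply: le_trans tauT; exact: sp_time_le_last.
have Aoo i : (leb (`]t, T] `&` A i) < +oo)%E by rewrite AE ltry.
have iZv (i : 'I_(sp_size h)) : P.-integrable setT (EFin \o (fun w => Z w * sp_val h i w)).
  have mv : measurable_fun setT (sp_val h i).
    exact: measurable_filtered (sp_val_adapted (ltn_ord i)).
  apply: sq_integrable_int => //.
  under eq_fun do rewrite mulrC.
  by apply: (@sq_integrableMb _ _ _ _ _ _ _ M) => // w _; exact: hM.
have EF i : (fun p : Omega * Rt => (F i p)%:E) \_ (setT `*` `]t, T]) =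
   (fun p => (Z p.1 * sp_val h i p.1)%:E) \_ (setT `*` (`]t, T] `&` A i)).
  apply/funext => -[w s]; rewrite /patch !in_setX !in_setT /F/= in_setI indicE.
  by case: (s \in `]t, T]%classic) => //=; case: (s \in A i); rewrite ?mulr1 ?mulr0.
have IF i : PL.-integrable (setT `*` `]t, T]) (EFin \o F i) /\
    \int[PL]_(p in setT `*` `]t, T]) F i p =
    (Num.max (sp_time h i.+1) t - Num.max (sp_time h i) t)
     * \int[P]_w (Z w * sp_val h i w).
  have [J1 J2] := integral_fst (mtA i) (Aoo i) (iZv i).
  split.
    apply/(integrable_mkcond _ mtT); rewrite [X in _.-integrable _ X]EF.
    by apply/(integrable_mkcond _ (measurableX measurableT (mtA i))).
  rewrite /Rintegral integral_mkcond EF -integral_mkcond.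
  by apply: etrans J2 _; rewrite mulrC; congr (_ * _); exact: (congr1 fine (AE i)).
have [_ E] := Rintegral_sum mtT (fun i => (IF i).1).
transitivity (\int[PL]_(p in setT `*` `]t, T]) (\sum_(i < sp_size h) F i p)).
  apply: eq_Rintegral => p _; rewrite /sp_eval mulr_sumr; apply: eq_bigr => i _.
  by rewrite /F mulrA.
by rewrite [LHS]E; apply: eq_bigr => i _; rewrite (IF i).2.
Qed.

End simple.

Variables (T t : R) (Z : Omega -> R).
Hypotheses (t0 : 0 <= t) (tT : t <= T).
Hypothesis mZ : measurable_fun setT (Z : filtered P B t -> R).
Hypothesis IZ : sq_integrable P setT Z.
Variables (X : R -> Omega -> R) (I : Omega -> R).

Lemma sq_ito (tau : R) : is_ito_integral P B tau X I -> sq_integrable P setT I.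
Proof.
move=> [_ mI [h [_ hI]]].
exact: (sq_integrable_lim measurableT mI (fun n => sq_sp_integral (h n)) hI).
Qed.

(** The integral up to time [t] is known at time [t], hence orthogonal to the
    later increment. *)
Lemma ito_test_past : is_ito_integral P B t X I ->
  \int[P]_w (Z w * (B T w - B t w) * I w) = 0.
Proof.
move=> [_ mI [h [_ hI]]].
have IW := sq_test hP hB t0 tT mZ IZ.
have := cvg_Rintegral_sq measurableT IW mI (fun n => sq_sp_integral (h n)) hI.
under eq_fun.
  move=> n; rewrite (test_simple (h n) t0 tT tT mZ IZ) big1 ?mulr0; last first.
    move=> i _; have ile := sp_time_le_last (h := h n) (ltn_ord i).
    rewrite !max_r ?subrr ?mul0r// sp_time_le_last//.
    exact: ltnW.
  over.
move=> C; rewrite -(cvg_lim (@Rhausdorff R) C); exact: lim_cst.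
Qed.

(** A form of the Ito isometry, polarized between the integral of [X] and that
    of [Z] over the times after [t]. It is exact for simple processes, by
    [test_simple] and [integral_simple], and passes to the limit because both
    sides are pairings with a fixed square-integrable function. *)
Lemma ito_test : is_ito_integral P B T X I ->
  sq_integrable PL (setT `*` `[0, T]) (fun p => X p.2 p.1) /\
  \int[P]_w (Z w * (B T w - B t w) * I w) =
  kappa * \int[PL]_(p in setT `*` `]t, T]) (Z p.1 * X p.2 p.1).
Proof.
move=> [mX mI [h [hX hI]]].
have IW := sq_test hP hB t0 tT mZ IZ.
have m0T : measurable (setT `*` `[0, T] : set (Omega * Rt)) by exact: measurableX.
have mtT : measurable (setT `*` `]t, T] : set (Omega * Rt)) by exact: measurableX.
have mX' : measurable_fun (setT `*` `[0, T]) (fun p : Omega * Rt => X p.2 p.1).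
  exact: (measurable_swap_setX _ _ mX).
have I0T := lebesgue_itv_lty true 0 T; have ItT := lebesgue_itv_lty false t T.
have Isp (A : set Rt) n : measurable A -> (leb A < +oo)%E ->
    sq_integrable PL (setT `*` A) (fun p => sp_eval (h n) p.2 p.1).
  move=> mA Aoo; have [M hM] := sp_eval_bounded (h n).
  have mTA : measurable (setT `*` A : set (Omega * Rt)) by exact: measurableX.
  have := @sq_integrableMb _ _ _ PL (setT `*` A) (cst 1)
    (fun p => sp_eval (h n) p.2 p.1) M mTA.
  rewrite (_ : _ \* cst 1 = (fun p => sp_eval (h n) p.2 p.1)); last first.
    by apply/funext => p /=; rewrite mulr1.
  apply => //; first by apply: sq_integrable_cst; [exact: mTA|rewrite [ltLHS](measure_slab P mA)].
  by apply: measurable_funTS; exact: measurable_sp_eval.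
have hX' : (fun n => \int[PL]_(p in setT `*` `[0%R, T])
    ((sp_eval (h n) p.2 p.1 - X p.2 p.1) ^+ 2)%:E)%E @ \oo --> 0%E.
  move: hX; rewrite [X in X @ _ --> _ -> _](_ : _ = (fun n => \int[PL]_(p in
      setT `*` `[0%R, T]) ((sp_eval (h n) p.2 p.1 - X p.2 p.1) ^+ 2)%:E)%E)//.
  apply/funext => n; rewrite ge0_integral_setX//.
  - apply/measurable_EFinP/measurable_funX/measurable_funB => //.
    by apply: measurable_funTS; exact: measurable_sp_eval.
  - by move=> p _; rewrite lee_fin sqr_ge0.
have IX : sq_integrable PL (setT `*` `[0, T]) (fun p => X p.2 p.1).
  exact: (sq_integrable_lim m0T mX' (fun n => Isp _ n _ I0T) hX').
split => //.
have sub := @tail_sub_slab _ _ Omega t T t0.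
have hX2 : (fun n => \int[PL]_(p in setT `*` `]t, T])
    ((sp_eval (h n) p.2 p.1 - X p.2 p.1) ^+ 2)%:E)%E @ \oo --> 0%E.
  apply: (squeeze_cvge _ (cvg_cst 0%E) hX'); apply: nearW => n.
  rewrite integral_ge0/=; last by move=> p _; rewrite lee_fin sqr_ge0.
  apply: ge0_subset_integral => //; last by move=> p _; rewrite lee_fin sqr_ge0.
  apply/measurable_EFinP/measurable_funX/measurable_funB => //.
  by apply: measurable_funTS; exact: measurable_sp_eval.
have IZ' := sq_integrable_fst (measurable_itv `]t, T]) ItT IZ.
have C1 := cvg_Rintegral_sq measurableT IW mI (fun n => sq_sp_integral (h n)) hI.
have C2 := cvg_Rintegral_sq mtT IZ' (measurable_funS m0T sub mX')
   (fun n => Isp _ n _ ItT) hX2.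
move: C1; under eq_fun do rewrite (test_simple _ t0 tT (lexx T) mZ IZ).
move=> C1; rewrite -(cvg_lim (@Rhausdorff R) C1).
apply: (cvg_lim (@Rhausdorff R)).
apply: cvgM; first exact: cvg_cst.
have -> : (fun n => \sum_(i < sp_size (h n))
     (Num.max (sp_time (h n) i.+1) t - Num.max (sp_time (h n) i) t) *
     (\int[P]_w (Z w * sp_val (h n) i w))) =
   (fun n => \int[PL]_(p in setT `*` `]t, T]) (Z p.1 * sp_eval (h n) p.2 p.1)).
  by apply/funext => n; apply/esym; exact: integral_simple.
exact: C2.
Qed.

End ito.

(** * The relation satisfied by the terminal value *)

(** Testing at time [t] means pairing with [Z * (B T - B t)], with [Z] known at
    time [t]. The relation says that the test of the terminal value
    [c * xi] is that of a stochastic integral with the integrand [alpha * xi]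
    after [t], up to an error small compared with [T - t]. *)
Definition tested_relation {R : realType} {dO : measure_display}
    {Omega : measurableType dO} (P : probability Omega R) (B : R -> Omega -> R)
    (T c : R) (alpha : Omega * measurableTypeR R -> R) (xi : Omega -> R) : Prop :=
  forall C eps : R, 0 < C -> 0 < eps ->
  exists2 d, 0 < d & forall t (Z : Omega -> R), 0 <= t -> T - d < t < T ->
    measurable_fun setT (Z : filtered P B t -> R) ->
    (\int[P]_w (Z w ^+ 2)%:E <= C%:E)%E ->
  `|c * \int[P]_w (Z w * (B T w - B t w) * xi w) - normal_var *
    \int[(P \x lebesgue_measure)%E]_(p in setT `*` `]t, T])
      (Z p.1 * (alpha p * xi p.1))| <= eps * (T - t).

Section core.
Context {R : realType} {dO : measure_display} {Omega : measurableType dO}.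
Variables (P : probability Omega R) (B : R -> Omega -> R).
Hypotheses (hP : measure_is_complete P) (hB : brownian_motion P B).
Notation Rt := (measurableTypeR R).
Notation leb := (@lebesgue_measure R).
Notation kappa := (@normal_var R).
Notation PL := (P \x leb)%E.
Variable T : R.
Hypothesis T0 : 0 < T.

Let PToo : (P setT < +oo)%E.
Proof. by rewrite probability_setT ltry. Qed.

Lemma ae_integrable_slab (g : Omega * Rt -> R) :
  sq_integrable PL (setT `*` `[0, T]) g ->
  {ae P, forall w, leb.-integrable `[0, T] (fun s => (g (w, s))%:E)}.
Proof.
have m0T : measurable (setT `*` `[0, T] : set (Omega * Rt)) by exact: measurable_slab.
move=> Ig; have ig := sq_integrable_int m0T (slab_lty P true 0 T) Ig.
have := (integrable_mkcond _ m0T).1 ig.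
move=> /ae_integrable1; apply: filterS => w H.
apply: (integrable_mkcond (fun s => (g (w, s))%:E) (measurable_itv `[0, T])).2.
move: H; congr (_.-integrable _ _); apply/funext => s.
by rewrite /patch in_setX in_setT.
Qed.

(** Absolute continuity of the integral at the terminal time, by dominated
    convergence along the times [u n]. *)
Lemma integral_slab_tail (g : Omega * Rt -> \bar R) (e : R) :
  measurable_fun (setT `*` `[0, T]) g -> (forall p, 0 <= g p)%E ->
  (\int[PL]_(p in setT `*` `[0%R, T]) g p < +oo)%E -> 0 < e ->
  exists2 d, 0 < d & forall t, 0 <= t -> T - d < t ->
    (\int[PL]_(p in setT `*` `]t, T]) g p <= e%:E)%E.
Proof.
move=> mg g0 goo e0.
have m0T : measurable (setT `*` `[0, T] : set (Omega * Rt)) by exact: measurable_slab.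
pose u n := T - T / n.+1%:R.
have u0 n : 0 <= u n.
  by rewrite subr_ge0 ler_pdivrMr// ler_peMr ?ler1n// ltW.
pose f n := g \_ (setT `*` `]u n, T] : set (Omega * Rt)).
have mut n : measurable (setT `*` `]u n, T] : set (Omega * Rt)) by exact: measurable_slab.
have mf n : measurable_fun (setT `*` `[0, T]) (f n).
  have mgn := measurable_funS m0T (tail_sub_slab (u0 n)) mg.
  exact: measurable_funTS ((measurable_restrictT g (mut n)).1 mgn).
have ucvg s : s < T -> exists N, forall n, (N <= n)%N -> s <= u n.
  move=> sT; have Ts : 0 < T - s by rewrite subr_gt0.
  have [N hN] : exists N : nat, T / (T - s) < N%:R.
    by exists (Num.bound (T / (T - s))); rewrite archi_boundP// divr_ge0// ltW.
  exists N => n Nn; rewrite /u lerBrDr -lerBrDl ler_pdivrMr//.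
  rewrite mulrC -ler_pdivrMr//; apply: le_trans (ltW hN) _.
  by rewrite ler_nat ltnW.
have fcvg : {ae PL, forall p, (setT `*` `[0, T]) p -> f ^~ p @ \oo --> 0%E}.
  exists (setT `*` [set T]); split.
  - exact: measurable_slab.
  - rewrite measure_slab//; exact: lebesgue_measure_set1.
  - move=> [w s] /= H; split => //; apply: contrapT => /eqP sT; apply: H.
    rewrite in_itv/= => -[_ /andP[_ s_T]].
    have {sT} {}s_T : s < T by rewrite lt_neqAle sT.
    have [N hN] := ucvg _ s_T.
    apply: cvg_near_cst; exists N => // n /= Nn.
    rewrite /f patchE ifF//; apply/negbTE; rewrite in_setX/= negb_and; apply/orP; right.
    by rewrite notin_setE/= in_itv/= => /andP[]; rewrite ltNge hN.
have ig : PL.-integrable (setT `*` `[0, T]) g.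
  by apply/integrableP; split => //; under eq_integral do rewrite gee0_abs//.
have dom : {ae PL, forall p n, (setT `*` `[0, T]) p -> (`|f n p| <= g p)%E}.
  apply: aeW => p n _; rewrite /f patchE; case: ifP => _.
    by rewrite gee0_abs.
  by rewrite abse0.
have [_ _] := dominated_convergence m0T mf (measurable_cst 0%E) fcvg ig dom.
rewrite integral0 => C.
have [N _ /(_ N (leqnn N))] := cvge0_lt C e0.
rewrite /= -integral_mkcondr => H.
exists (T / N.+1%:R); first by rewrite divr_gt0.
move=> t t0 Nt; apply: le_trans (ltW H).
apply: ge0_subset_integral => //.
- exact: measurable_slab.
- exact: measurableI.
- by apply: measurable_funS mg => //; exact: subIsetl.
- move=> [w s] /= [_]; rewrite !in_itv/= => /andP[ts sT].
  by rewrite sT (lt_trans Nt ts)/= (le_trans t0) ?ltW.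
Qed.

Variables (alpha : Omega * Rt -> R) (A : R).
Hypothesis malpha : measurable_fun (setT `*` `[0, T]) alpha.
Hypothesis alphaA : forall p, (setT `*` `[0, T]) p -> `|alpha p| <= A.

Variables (c k0 : R) (xi : Omega -> R) (Y : R -> Omega -> R).
Variables (r : Omega * Rt -> R) (X : R -> Omega -> R) (m : Omega * Rt -> \bar R).
Hypothesis Ixi : sq_integrable P setT xi.
Hypothesis mY : forall t, 0 <= t <= T ->
  measurable_fun setT (Y t : filtered P B t -> R).
Hypothesis IY : forall t, 0 <= t <= T -> sq_integrable P setT (Y t).
Hypothesis YT : {ae P, forall w, Y T w = c * xi w}.
Hypothesis Ir : sq_integrable PL (setT `*` `[0, T]) r.
Hypothesis eqY : forall t, 0 <= t <= T -> exists2 I, is_ito_integral P B t X I &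
  {ae P, forall w, Y t w - k0 - \int[leb]_(s in `[0, t]) r (w, s) = I w}.
Hypothesis mm : measurable_fun (setT `*` `[0, T]) m.
Hypothesis m0 : forall p, (0 <= m p)%E.
Hypothesis Xm : {ae PL, forall p, (setT `*` `[0, T]) p ->
  (((X p.2 p.1 - xi p.1 * alpha p) ^+ 2)%:E <= m p)%E}.
Hypothesis m_T : forall e, 0 < e -> exists2 d, 0 < d & forall s, 0 <= s <= T ->
  T - d < s -> (\int[P]_w m (w, s) <= e%:E)%E.

Section fixed_time.
Variables (t : R) (Z : Omega -> R).
Hypotheses (t0 : 0 <= t) (tT : t < T).
Hypothesis mZ : measurable_fun setT (Z : filtered P B t -> R).
Hypothesis IZ : sq_integrable P setT Z.

Let W w := Z w * (B T w - B t w).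
Let rest w := \int[leb]_(s in `]t, T]) r (w, s).

Let tbd : 0 <= t <= T. Proof. by rewrite t0 ltW. Qed.
Let Tbd : 0 <= T <= T. Proof. by rewrite lexx ltW. Qed.
Let IW : sq_integrable P setT W.
Proof. exact: (sq_test hP hB t0 (ltW tT) mZ IZ). Qed.

Let sub_slab : (setT `*` `]t, T] : set (Omega * Rt)) `<=` setT `*` `[0, T].
Proof. exact: tail_sub_slab. Qed.
Let m0T : measurable (setT `*` `[0, T] : set (Omega * Rt)).
Proof. exact: measurable_slab. Qed.
Let mtT : measurable (setT `*` `]t, T] : set (Omega * Rt)).
Proof. exact: measurable_slab. Qed.

Let mrest : measurable_fun setT rest.
Proof.
apply: (measurable_Rintegral_param leb) => //.
by case: Ir => mr _; exact: measurable_funS m0T sub_slab mr.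
Qed.

(** The difference of the equations at times [T] and [t], tested against [W].
    The value [Y t] and the stochastic integral up to [t] are known at time [t]
    and drop out. *)
Lemma test_equation :
  c * \int[P]_w (W w * xi w) - kappa * \int[PL]_(p in setT `*` `]t, T])
    (Z p.1 * X p.2 p.1) = \int[P]_w (W w * rest w).
Proof.
have [IT hIT eqT] := eqY Tbd; have [It hIt eqt] := eqY tbd.
have [_ <-] := ito_test hP hB t0 (ltW tT) mZ IZ hIT.
have sIT := sq_ito hP hB hIT; have sIt := sq_ito hP hB hIt.
have iWxi := sq_integrableM measurableT IW Ixi.
have iWY := sq_integrableM measurableT IW (IY tbd).
have iWIT := sq_integrableM measurableT IW sIT.
have iWIt := sq_integrableM measurableT IW sIt.
have E1 : \int[P]_w (W w * It w) = 0.
  exact: (ito_test_past hP hB t0 (ltW tT) mZ IZ hIt).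
have E2 : \int[P]_w (W w * Y t w) = 0.
  have iZY := sq_integrableM measurableT IZ (IY tbd).
  have mZY : measurable_fun setT ((Z \* Y t) : filtered P B t -> R).
    by apply: (@measurable_funM _ (filtered P B t)) => //; exact: mY.
  have ttT : 0 <= t <= T by [].
  have [_ <-] := increment_mean hP hB ttT mZY iZY.
  by apply: eq_Rintegral => w _; rewrite /W/=; ring.
have ir := ae_integrable_slab Ir.
have icWxi : P.-integrable setT (EFin \o (fun w => c * (W w * xi w))).
  exact: (integrableZl measurableT c iWxi).
pose g w := (c * (W w * xi w) - W w * Y t w) - (W w * IT w - W w * It w).
transitivity (\int[P]_w g w).
  rewrite RintegralB//; last 2 first.
  - exact: (integrableB measurableT icWxi iWY).
  - exact: (integrableB measurableT iWIT iWIt).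
  rewrite RintegralB// RintegralB// RintegralZl// E1 E2 !subr0.
  by congr (_ - _).
have mg : measurable_fun setT g.
  have mW := IW.1; have mxi := Ixi.1; have mYt := (IY tbd).1.
  have mIT := sIT.1; have mIt := sIt.1.
  apply: measurable_funB; apply: measurable_funB.
  - by apply: measurable_funM => //; exact: measurable_funM mW mxi.
  - exact: measurable_funM mW mYt.
  - exact: measurable_funM mW mIT.
  - exact: measurable_funM mW mIt.
rewrite /Rintegral; congr fine; apply: ae_eq_integral => //.
- exact/measurable_EFinP.
- by apply/measurable_EFinP; exact: measurable_funM IW.1 mrest.
near=> w => _; congr EFin; rewrite /g.
have h1 : Y T w = c * xi w by near: w.
have h2 : Y T w - k0 - \int[leb]_(s in `[0, T]) r (w, s) = IT w by near: w.
have h3 : Y t w - k0 - \int[leb]_(s in `[0, t]) r (w, s) = It w by near: w.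
have h4 : leb.-integrable `[0, T] (fun s => (r (w, s))%:E) by near: w.
have h5 : \int[leb]_(s in `[0, T]) r (w, s) - \int[leb]_(s in `[0, t]) r (w, s)
    = rest w.
  by apply: Rintegral_itvB => //; rewrite ?bnd_simp// ltW.
rewrite -h5 -h2 -h3 mulrCA -h1; ring.
Unshelve. all: by end_near. Qed.

(** The drift accumulated after [t] contributes a small multiple of [T - t]:
    [W] has mean square of order [T - t], the length of the interval gives a
    second factor [T - t], and [r] has a small integral near [T]. The weight
    [l] will be of order [1 / (T - t)]. *)
Lemma rest_bound (l C e : R) : 0 < l ->
  (\int[P]_w (Z w ^+ 2)%:E <= C%:E)%E ->
  (\int[PL]_(p in setT `*` `]t, T]) ((r p) ^+ 2)%:E <= e%:E)%E ->
  `|\int[P]_w (W w * rest w)| <=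
  l / 2 * ((T - t) * (kappa * (T - t) * C)) + l^-1 / 2 * e.
Proof.
move=> l0 ZC re; have [mW _] := IW; have [mr _] := Ir.
have mr' : measurable_fun (setT `*` `]t, T]) r by exact: measurable_funS m0T sub_slab mr.
have mWr : measurable_fun (setT `*` `]t, T]) (fun p => (W p.1 * r p)).
  apply: measurable_funM => //; apply: measurable_funTS.
  exact: (measurableT_comp mW measurable_fst).
rewrite -lee_fin; apply: le_trans (normr_Rintegral_le _ measurableT _) _.
  exact: measurable_funM.
apply: (@le_trans _ _ (\int[PL]_(p in setT `*` `]t, T]) `|W p.1 * r p|%:E)%E).
  rewrite ge0_integral_setX//; last exact/measurable_EFinP/measurableT_comp.
  apply: ge0_le_integral_dom => w _ //=.
  have mrw : measurable_fun `]t, T] (fun s => r (w, s)).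
    apply: (measurable_comp _ _ mr') => //.
    - by move=> _ [s /= st <-].
    - by apply: measurable_funTS; exact: pair1_measurable.
  rewrite normrM EFinM; under eq_integral do rewrite normrM EFinM.
  rewrite ge0_integralZl//; last exact/measurable_EFinP/measurableT_comp.
  rewrite lee_wpmul2l//; exact: normr_Rintegral_le.
have mW1 : measurable_fun (setT `*` `]t, T] : set (Omega * Rt)) (W \o fst).
  by apply: measurable_funTS; exact: (measurableT_comp mW measurable_fst).
apply: le_trans (integral_amgm PL mtT mW1 mr' l0) _.
have l1 : (0 <= (l / 2)%:E)%E by rewrite lee_fin divr_ge0// ltW.
have l2 : (0 <= (l^-1 / 2)%:E)%E by rewrite lee_fin divr_ge0// invr_ge0 ltW.
rewrite EFinD; apply: leeD; rewrite [leRHS]EFinM; apply: lee_wpmul2l => //.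
rewrite (integral_sqr_fst P _ mW)// (lebesgue_itv_oc (ltW tT)) [leRHS]EFinM.
apply: lee_wpmul2l; first by rewrite lee_fin subr_ge0 ltW.
have ttT : 0 <= t <= T by [].
have [_ ->] := sq_mul_increment hP hB ttT mZ IZ.
rewrite [leRHS]EFinM; apply: lee_wpmul2l => //.
by rewrite lee_fin mulr_ge0 ?subr_ge0 ?ltW// normal_var_gt0.
Qed.

Let iZfst : sq_integrable PL (setT `*` `]t, T]) (Z \o fst).
Proof. by apply: sq_integrable_fst => //; exact: lebesgue_itv_lty. Qed.

Let sq_sub (f : Omega * Rt -> R) : sq_integrable PL (setT `*` `[0, T]) f ->
  sq_integrable PL (setT `*` `]t, T]) f.
Proof.
move=> [mf f2]; have mf' := measurable_funS m0T sub_slab mf; split => //.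
apply: le_lt_trans f2; apply: ge0_subset_integral => //.
- by apply/measurable_EFinP; exact: measurable_funX.
- by move=> p _; rewrite lee_fin sqr_ge0.
Qed.

Let Ixialpha : sq_integrable PL (setT `*` `[0, T]) (fun p => alpha p * xi p.1).
Proof.
have Ixi' : sq_integrable PL (setT `*` `[0, T]) (xi \o fst).
  by apply: sq_integrable_fst => //; exact: lebesgue_itv_lty.
by apply: (@sq_integrableMb _ _ _ _ _ _ _ A).
Qed.

(** Here [m] dominates the squared distance of the noise integrand [X] to its
    terminal approximation [xi * alpha], and is small near [T]. *)
Lemma drift_bound (l C e : R) : 0 < l ->
  (\int[P]_w (Z w ^+ 2)%:E <= C%:E)%E ->
  (forall s, t < s <= T -> (\int[P]_w m (w, s) <= e%:E)%E) ->
  `|\int[PL]_(p in setT `*` `]t, T]) (Z p.1 * X p.2 p.1) -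
    \int[PL]_(p in setT `*` `]t, T]) (Z p.1 * (alpha p * xi p.1))| <=
  l / 2 * ((T - t) * C) + l^-1 / 2 * ((T - t) * e).
Proof.
move=> l0 ZC me.
have [IT hIT _] := eqY Tbd.
have [IX _] := ito_test hP hB t0 (ltW tT) mZ IZ hIT.
have IX' : sq_integrable PL (setT `*` `]t, T]) (fun p => X p.2 p.1).
  exact: sq_sub.
have Ixa : sq_integrable PL (setT `*` `]t, T]) (fun p => alpha p * xi p.1).
  exact: sq_sub.
have IXa := sq_integrableB mtT IX' Ixa.
rewrite -RintegralB//; [|exact: sq_integrableM..].
rewrite (_ : Rintegral _ _ _ = \int[PL]_(p in setT `*` `]t, T])
    ((Z \o fst) p * (X p.2 p.1 - alpha p * xi p.1))); last first.
  by apply: eq_Rintegral => p _; rewrite mulrBr.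
rewrite -lee_fin; apply: le_trans (normr_Rintegral_le _ mtT _) _.
  exact: measurable_funM iZfst.1 IXa.1.
apply: le_trans (integral_amgm PL mtT iZfst.1 IXa.1 l0) _.
have l1 : (0 <= (l / 2)%:E)%E by rewrite lee_fin divr_ge0// ltW.
have l2 : (0 <= (l^-1 / 2)%:E)%E by rewrite lee_fin divr_ge0// invr_ge0 ltW.
have Tt : (0 <= (T - t)%:E)%E by rewrite lee_fin subr_ge0 ltW.
rewrite EFinD; apply: leeD; rewrite [leRHS]EFinM; apply: lee_wpmul2l => //.
  rewrite (integral_sqr_fst P _ IZ.1)// (lebesgue_itv_oc (ltW tT)) [leRHS]EFinM.
  exact: lee_wpmul2l.
have mmt := measurable_funS m0T sub_slab mm.
apply: (@le_trans _ _ (\int[PL]_(p in setT `*` `]t, T]) m p)%E).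
  apply: ae_ge0_le_integral => //.
  - by move=> p _; rewrite lee_fin sqr_ge0.
  - by apply/measurable_EFinP; exact: measurable_funX IXa.1.
  - have [N [mN N0 sN]] := Xm; exists N; split => // p Hp; apply: sN => H.
    apply: Hp => tp; have := H (sub_slab tp).
    by rewrite /= (mulrC (alpha p)).
rewrite ge0_integral_setX_swap//.
apply: (@le_trans _ _ (\int[leb]_(s in `]t, T]) e%:E)%E).
  apply: ge0_le_integral_dom => s /=; first by move=> _; exact: integral_ge0.
  by rewrite in_itv/=; exact: me.
rewrite [leLHS](_ : _ = e%:E * (T - t)%:E)%E; first by rewrite -EFinM mulrC.
rewrite (integral_cst leb (measurable_itv `]t, T]) e%:E).
by congr (_ * _)%E; exact: lebesgue_itv_oc (ltW tT).
Qed.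

End fixed_time.

(** Just before the terminal time, testing the equation against the increment
    of [B] weighted by [Z] forces a relation between the terminal value [xi]
    and the coefficient [alpha], up to an error that is small compared with
    the length of the remaining time interval. *)
Lemma terminal_relation : tested_relation P B T c alpha xi.
Proof.
move=> C eps C0 eps0; have k0' := @normal_var_gt0 R.
(* The weights and thresholds make each of the two errors equal to
   [eps * (T - t) / 2]; see [F1] and [F2]. *)
pose l1 := eps / (2 * kappa * C).
have l1_gt0 : 0 < l1 by rewrite divr_gt0// !mulr_gt0.
pose e1 := eps * l1 / (2 * kappa).
have e1_gt0 : 0 < e1 by rewrite !(mulr_gt0, invr_gt0).
pose e2 := eps ^+ 2 / (4 * kappa * C).
have e2_gt0 : 0 < e2 by rewrite divr_gt0 ?exprn_gt0 ?mulr_gt0.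
have [d1 d1_gt0 H1] := m_T e1_gt0.
have [mr r2] := Ir.
have mr2 : measurable_fun (setT `*` `[0, T] : set (Omega * Rt)) (fun p => (r p ^+ 2)%:E).
  by apply/measurable_EFinP; exact: measurable_funX.
have r20 p : (0 <= (r p ^+ 2)%:E :> \bar R)%E by rewrite lee_fin sqr_ge0.
have [d2 d2_gt0 H2] := integral_slab_tail mr2 r20 r2 e2_gt0.
exists (Num.min d1 d2); first by rewrite lt_min d1_gt0.
move=> t Z t0 /andP[dt tT] mZ ZC.
have mZ' : measurable_fun setT Z by exact: measurable_filtered mZ.
have IZ : sq_integrable P setT Z.
  split; [exact: mZ'|exact: le_lt_trans ZC (ltry C)].
have Tt : 0 < T - t by rewrite subr_gt0.
have dt1 : T - d1 < t.
  by apply: le_lt_trans dt; rewrite lerD2l lerN2 ge_min lexx.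
have dt2 : T - d2 < t.
  by apply: le_lt_trans dt; rewrite lerD2l lerN2 ge_min lexx orbT.
pose l2 := eps / (2 * kappa * C * (T - t)).
have l2_gt0 : 0 < l2 by rewrite divr_gt0// !mulr_gt0.
have E := test_equation t0 tT mZ IZ.
have D1 := drift_bound t0 tT mZ IZ l1_gt0 ZC (e := e1).
have D2 := rest_bound t0 tT mZ IZ l2_gt0 ZC (H2 t t0 dt2).
have {}D1 : `|\int[PL]_(p in setT `*` `]t, T]) (Z p.1 * X p.2 p.1) -
    \int[PL]_(p in setT `*` `]t, T]) (Z p.1 * (alpha p * xi p.1))| <=
    l1 / 2 * ((T - t) * C) + l1^-1 / 2 * ((T - t) * e1).
  apply: D1 => s /andP[ts sT]; apply: H1; last exact: lt_trans dt1 ts.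
  by rewrite sT (le_trans t0) ?ltW.
move: E D1 D2.
set a := c * _; set b := \int[PL]_(p in _) (Z p.1 * X p.2 p.1).
set b' := \int[PL]_(p in _) _; set q := \int[P]_w (_ * Rintegral _ _ _).
move=> E; rewrite -E => D1 D2.
have -> : a - kappa * b' = (a - kappa * b) + kappa * (b - b') by ring.
apply: le_trans (ler_normD _ _) _; rewrite normrM (gtr0_norm k0').
have F1 : kappa * (l1 / 2 * ((T - t) * C) + l1^-1 / 2 * ((T - t) * e1)) =
    eps * (T - t) / 2.
  by rewrite /e1 /l1; field; rewrite !gt_eqF.
have F2 : l2 / 2 * ((T - t) * (kappa * (T - t) * C)) + l2^-1 / 2 * e2 =
    eps * (T - t) / 2.
  by rewrite /e2 /l2; field; rewrite !gt_eqF.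
have : kappa * `|b - b'| <= eps * (T - t) / 2.
  by rewrite -F1 ler_pM2l.
rewrite F2 in D2; lra.
Qed.

End core.

(** * The bump function on the phase space *)

Section measurable_open.
Context {R : realType} {d : nat}.
Notation Rd := 'rV[R]_d.

Lemma ball_rVE (x y : Rd) (e : R) : 0 < e ->
  (forall i, `|x 0 i - y 0 i| < e) -> ball x e y.
Proof. by move=> e0 xy; split => // i j; rewrite ord1; exact: xy. Qed.

(** An open set is the union of the rational boxes that it contains. There are
    countably many, and the coordinates generate them. *)
Lemma measurable_open (G : set Rd) : open G -> measurable G.
Proof.
move=> oG.
(* [a] encodes a rational centre and the inverse of the half side. *)
pose box (a : 'rV[rat]_d * nat) : set Rd :=
  [set x | forall i, `]ratr (a.1 0 i) - a.2.+1%:R^-1,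
                       ratr (a.1 0 i) + a.2.+1%:R^-1[%classic (x 0 i)].
pose F (a : 'rV[rat]_d * nat) : set Rd := if `[< box a `<=` G >] then box a else set0.
have mF a : measurable (F a).
  rewrite /F; case: asboolP => // _.
  apply: (@measurable_box R d (fun i => `]ratr (a.1 0 i) - a.2.+1%:R^-1,
                       ratr (a.1 0 i) + a.2.+1%:R^-1[%classic)) => i.
  exact: measurable_itv.
rewrite (_ : G = \bigcup_a F a); first exact: countable_bigcupT_measurable.
apply/seteqP; split => [x Gx|x [a _]]; last first.
  by rewrite /F; case: asboolP => // + bx; exact.
have /nbhs_ballP[e /= e0 xe] : nbhs x G by exact: open_nbhs_nbhs.
have [N hN] : exists N : nat, 2 / e < N.+1%:R.
  exists (Num.bound (2 / e)); apply: (lt_trans (archi_boundP _)).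
    by rewrite divr_ge0// ltW.
  by rewrite ltr_nat.
have N0 : 0 < (N.+1%:R : R)^-1 by rewrite invr_gt0.
have Ne : 2 * (N.+1%:R : R)^-1 < e by rewrite ltr_pdivrMr// mulrC -ltr_pdivrMr.
have [u [uE u0 ue]] : exists u : R, [/\ u = N.+1%:R^-1, 0 < u & 2 * u < e].
  by exists N.+1%:R^-1.
have qE i : exists q : rat, x 0 i - u < ratr q < x 0 i + u.
  have : x 0 i - u < x 0 i + u by lra.
  by move=> /rat_in_itvoo[q]; rewrite in_itv/=; exists q.
pose q : 'rV[rat]_d := \row_i projT1 (cid (qE i)).
have hq i : x 0 i - u < ratr (q 0 i) < x 0 i + u.
  by rewrite mxE; case: cid.
exists (q, N) => //; rewrite /F; case: asboolP => [_ i|[]] /=.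
  have /andP[h3 h4] := hq i.
  by rewrite in_itv/= -uE; apply/andP; split; lra.
move=> y /= yq; apply: xe; apply: ball_rVE => // i.
have := yq i; rewrite /= in_itv/= -uE ltr_norml => /andP[h1 h2].
have /andP[h3 h4] := hq i; apply/andP; split; lra.
Qed.

Lemma measurable_closed (G : set Rd) : closed G -> measurable G.
Proof.
move=> cG; rewrite -[G]setCK; apply: measurableC; apply: measurable_open.
by rewrite openC.
Qed.

Lemma measurable_sphere : measurable (sphere d : set Rd).
Proof.
have := @measurable_enorm R d measurableT _ (measurable_set1 (1 : R)).
by rewrite setTI.
Qed.

Definition cube (c : Rd) (a b : R) : set Rd :=
  [set x | forall i, c 0 i + a <= x 0 i <= c 0 i + b].

Lemma cubeE (c : Rd) (a b : R) :
  cube c a b = [set x | forall i, [set` `[c 0 i + a, c 0 i + b]] (x 0 i)].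
Proof. by apply/seteqP; split => x /= hx i; have := hx i; rewrite in_itv. Qed.

Lemma measurable_cube (c : Rd) (a b : R) : measurable (cube c a b).
Proof.
rewrite cubeE; apply: (@measurable_box R d (fun i => [set` `[c 0 i + a, c 0 i + b]])) => i.
exact: measurable_itv.
Qed.

Lemma vol_cubeE (c : Rd) (a b : R) : a < b ->
  vol d (cube c a b) = (\prod_(i < d) (b - a)%:E)%E.
Proof.
move=> ab; rewrite cubeE (@vol_box R d (fun i => [set` `[c 0 i + a, c 0 i + b]])); last first.
  by move=> i; exact: measurable_itv.
apply: eq_bigr => i _; rewrite lebesgue_measure_itv/= lte_fin ltrD2l ab -EFinB.
by congr EFin; ring.
Qed.

Lemma vol_cube_fin (c : Rd) (a b : R) : a < b -> (vol d (cube c a b) < +oo)%E.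
Proof. by move=> ab; rewrite vol_cubeE// prodEFin ltry. Qed.

Lemma vol_cube_gt0 (c : Rd) (a b : R) : a < b -> (0 < vol d (cube c a b))%E.
Proof.
by move=> ab; rewrite vol_cubeE// prodEFin lte_fin prodr_gt0// => i _; rewrite subr_gt0.
Qed.

Lemma coord_le_norm (x : Rd) i : `|x 0 i| <= `|x|.
Proof.
rewrite [leRHS]/Num.norm/= mx_normrE.
by apply: (@le_bigmax _ _ _ 0 (fun ij : 'I_1 * 'I_d => `|x ij.1 ij.2|) (0, i)).
Qed.

Lemma vol_bounded (G : set Rd) : bounded_set G -> measurable G ->
  (vol d G < +oo)%E.
Proof.
move=> [M [_ hM]] mG.
have M0 : - (`|M| + 1) < `|M| + 1 by rewrite gtrN// ltr_wpDl.
apply: le_lt_trans (vol_cube_fin 0 M0).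
apply: le_measure; rewrite ?inE//; first exact: measurable_cube.
move=> x Gx i /=; rewrite mxE !add0r -ler_norml.
apply: le_trans (coord_le_norm _ _) (hM _ _ _ Gx).
by rewrite ltr_pwDr// ler_norm.
Qed.

(** The punctured unit ball contains a cube of the positive orthant. *)
Lemma sphere_measure_gt0 : (0 < d)%N -> (0 < sphere_measure d (sphere d : set Rd))%E.
Proof.
move=> d0; rewrite /sphere_measure /pushforward /mscale/= /mrestr.
have dR : 0 < (d%:R : R) by rewrite ltr0n.
apply: mule_gt0; first by rewrite lte_fin.
have ab : (2 * d%:R)^-1 < (d%:R : R)^-1.
  by rewrite ltf_pV2 ?posrE ?mulr_gt0//; lra.
apply: lt_le_trans (vol_cube_gt0 0 ab) _.
have mS := measurable_sphere.
apply: le_measure; rewrite ?inE.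
- exact: measurable_cube.
- apply: measurableI; last exact: measurable_unit_ball.
  by rewrite -[X in measurable X]setTI; exact: measurable_direction.
move=> x /= hx.
have {}hx i : (2 * d%:R)^-1 <= x 0 i <= d%:R^-1.
  by have := hx i; rewrite mxE !add0r.
have p0 : 0 < (2 * d%:R : R)^-1 by rewrite invr_gt0 mulr_gt0.
have dot0 : 0 < dot x x.
  rewrite /dot (bigD1 (Ordinal d0))//= ltr_wpDr//.
    by apply: sumr_ge0 => i _; rewrite -expr2 sqr_ge0.
  by have /andP[h _] := hx (Ordinal d0); rewrite mulr_gt0//; apply: lt_le_trans h.
have e0 : 0 < enorm x by rewrite sqrtr_gt0.
have e1 : enorm x <= 1.
  rewrite -sqrtr1 ler_wsqrtr//.
  apply: (@le_trans _ _ (\sum_(i < d) (d%:R : R)^-1)); last first.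
    by rewrite sumr_const card_ord -[X in X *+ _]mulr1 -mulrnAr mulVf// gt_eqF.
  apply: ler_sum => i _; have /andP[h1 h2] := hx i.
  have x0 : 0 <= x 0 i by apply: le_trans h1; rewrite ltW.
  apply: le_trans (ler_pM x0 x0 h2 h2) _.
  by rewrite ler_piMr ?invr_ge0// invf_le1// ler1n.
split; last by rewrite /unit_ball/= e0 e1.
rewrite /sphere/= /direction /enorm /dot.
under eq_bigr do rewrite !mxE mulrACA -expr2.
rewrite -mulr_sumr sqrtrM ?sqr_ge0// sqrtr_sqr ger0_norm ?invr_ge0 ?ltW//.
by rewrite mulVf// gt_eqF.
Qed.

End measurable_open.

Section bump.
Context {R : realType}.

Definition pos_sqr (s : R) : R := Num.max 0 s ^+ 2.

Lemma pos_sqr_remainder (s h : R) :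
  `|pos_sqr (s + h) - pos_sqr s - 2 * Num.max 0 s * h| <= h ^+ 2.
Proof.
rewrite /pos_sqr ler_norml; case: (leP 0 s) => s0; case: (leP 0 (s + h)) => sh0;
  rewrite ?expr0n/= !expr2; nra.
Qed.

Lemma is_derive_pos_sqr (s : R) :
  is_derive s (1 : R) pos_sqr (2 * Num.max 0 s).
Proof.
have C : h^-1 *: (pos_sqr (h *: 1 + s) - pos_sqr s) @[h --> 0^'] -->
    2 * Num.max 0 s.
  apply/cvgrPdist_le => e e0; near=> h.
  have h0 : h != 0 by near: h; exact: nbhs_dnbhs_neq.
  have he : `|h| <= e by near: h; apply: dnbhs0_le.
  apply: le_trans he.
  have n0 : 0 < `|h| by rewrite normr_gt0.
  rewrite distrC -(ler_pM2l n0) -[leLHS]normrM mulrBr -[leRHS]expr2 real_normK ?num_real//.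
  rewrite /GRing.scale/= mulrA divff// mul1r mulr1 (addrC h) (mulrC h (2 * _)).
  exact: pos_sqr_remainder.
split; first by apply/cvg_ex; exists (2 * Num.max 0 s).
by apply/cvg_lim.
Unshelve. all: by end_near. Qed.

Lemma continuous_max0 : continuous (fun s : R => Num.max 0 s).
Proof.
have -> : (fun s : R => Num.max 0 s) = (fun s => (s + `|s|) / 2).
  apply/funext => s; case: (leP 0 s) => s0.
    by rewrite ger0_norm//; lra.
  by rewrite ltr0_norm//; lra.
move=> s; apply: cvgM; last exact: cvg_cst.
by apply: cvgD; [exact: cvg_id|exact: norm_continuous].
Qed.

Context {d : nat}.
Notation Rd := 'rV[R]_d.
Variables (c : Rd) (rho : R).

Definition depth (z : Rd * Rd) : R := rho ^+ 2 - \sum_i (z.1 0 i - c 0 i) ^+ 2.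

(** A function of the position alone, of class C^1 because the square of the
    positive part is, and supported in the Euclidean ball of radius [rho]
    around [c]. *)
Definition bump (z : Rd * Rd) : R := pos_sqr (depth z).

Lemma differentiable_coord_fst (i : 'I_d) (z : Rd * Rd) :
  differentiable (fun z : Rd * Rd => z.1 0 i) z.
Proof.
apply: (@differentiable_comp _ _ _ _ (fst : Rd * Rd -> Rd) (fun x : Rd => x 0 i)).
  by apply: linear_differentiable => y; exact: cvg_fst.
exact: differentiable_coord.
Qed.

Lemma is_derive_coord_fst (i : 'I_d) (z v : Rd * Rd) :
  is_derive z v (fun z : Rd * Rd => z.1 0 i) (v.1 0 i).
Proof.
have C : h^-1 *: ((h *: v + z).1 0 i - z.1 0 i) @[h --> 0^'] --> v.1 0 i.
  apply: cvg_near_cst; near=> h.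
  have h0 : h != 0 by near: h; exact: nbhs_dnbhs_neq.
  by rewrite /= !mxE addrK /GRing.scale/= mulrA mulVf// mul1r.
split; first by apply/cvg_ex; exists (v.1 0 i).
by apply/cvg_lim.
Unshelve. all: by end_near. Qed.

Lemma differentiable_depth z : differentiable depth z.
Proof.
apply: differentiableB => //.
rewrite (_ : (fun _ => _) = \sum_i (fun z : Rd * Rd => (z.1 0 i - c 0 i) ^+ 2)).
  apply: differentiable_sum => i.
  have H : differentiable ((fun z : Rd * Rd => z.1 0 i) - cst (c 0 i)) z.
    by apply: differentiableB => //; exact: differentiable_coord_fst.
  exact: (differentiableM H H).
by apply/funext => y; rewrite fct_sumE.
Qed.

Lemma derive_depth (z v : Rd * Rd) :
  'D_v depth z = - \sum_i 2 * (z.1 0 i - c 0 i) * v.1 0 i.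
Proof.
have H i : is_derive z v (fun z : Rd * Rd => (z.1 0 i - c 0 i) ^+ 2)
    (2 * (z.1 0 i - c 0 i) * v.1 0 i).
  have Hi := is_derive_coord_fst i z v.
  pose g : Rd * Rd -> R := (fun z : Rd * Rd => z.1 0 i) - cst (c 0 i).
  have Hg : is_derive z v g (v.1 0 i - 0) by exact: is_deriveB.
  rewrite (_ : (fun _ => _) = g * g)//.
  apply: is_derive_eq; rewrite subr0 /GRing.scale/= -mulrDl; congr (_ * _).
  by rewrite /g !fctE; ring.
have HS := is_derive_sum H.
have -> : depth = cst (rho ^+ 2) - \sum_i (fun z : Rd * Rd => (z.1 0 i - c 0 i) ^+ 2).
  by apply/funext => y; rewrite /depth /= fctE/= fct_sumE.
by have [_ ->] := is_deriveB (is_derive_cst (rho ^+ 2) z v) HS; rewrite sub0r.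
Qed.

Lemma differentiable_bump z : differentiable bump z.
Proof.
apply: differentiable_comp; first exact: differentiable_depth.
by apply/derivable1_diffP; have [] := is_derive_pos_sqr (depth z).
Qed.

Lemma derive_bump (z v : Rd * Rd) :
  'D_v bump z = - (2 * Num.max 0 (depth z)) * \sum_i 2 * (z.1 0 i - c 0 i) * v.1 0 i.
Proof.
have [dp Dp] := is_derive_pos_sqr (depth z).
rewrite deriveE; last exact: differentiable_bump.
have E : 'd bump z = 'd pos_sqr (depth z) \o 'd depth z :> (_ -> _).
  apply: diff_comp; first exact: differentiable_depth.
  exact/derivable1_diffP.
rewrite E/= deriv1E// -deriveE; last exact: differentiable_depth.
by rewrite derive1E Dp derive_depth /GRing.scale/=; ring.
Qed.

Lemma C1_bump : C1 bump.
Proof.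
split; first exact: differentiable_bump.
move=> v; rewrite (_ : (fun z => _) = (fun z => - (2 * Num.max 0 (depth z)) *
  \sum_i 2 * (z.1 0 i - c 0 i) * v.1 0 i)); last first.
  by apply/funext => z; rewrite derive_bump.
move=> z; apply: cvgM.
  apply: cvgN; apply: cvgM; first exact: cvg_cst.
  apply: (cvg_comp depth); last exact: continuous_max0.
  exact: (differentiable_continuous (differentiable_depth z)).
apply: (@differentiable_continuous _ _ _ _ (fun z : Rd * Rd =>
  \sum_i 2 * (z.1 0 i - c 0 i) * v.1 0 i)).
rewrite (_ : (fun _ => _) = \sum_i (fun z : Rd * Rd => 2 * (z.1 0 i - c 0 i) * v.1 0 i)).
  apply: differentiable_sum => i.
  have H : differentiable ((fun z : Rd * Rd => z.1 0 i) - cst (c 0 i)) z.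
    by apply: differentiableB => //; exact: differentiable_coord_fst.
  have H2 := differentiableM (differentiable_cst (2 : R) z) H.
  exact: (differentiableM H2 (differentiable_cst (v.1 0 i) z)).
by apply/funext => y; rewrite fct_sumE.
Qed.

Hypothesis rho0 : 0 < rho.

Lemma bump_ge0 z : 0 <= bump z. Proof. exact: sqr_ge0. Qed.

Lemma max0_depth_le z : Num.max 0 (depth z) <= rho ^+ 2.
Proof.
rewrite ge_max sqr_ge0/= /depth gerBl sumr_ge0// => i _; exact: sqr_ge0.
Qed.

Lemma bump_le z : `|bump z| <= rho ^+ 4.
Proof.
rewrite ger0_norm ?bump_ge0// /bump /pos_sqr (exprM rho 2 2).
by rewrite lerXn2r ?nnegrE ?sqr_ge0 ?max0_depth_le// le_max lexx.
Qed.

Lemma depth_gt0_near z i : 0 < depth z -> `|z.1 0 i - c 0 i| < rho.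
Proof.
rewrite /depth subr_gt0 (bigD1 i)//= => H.
rewrite -(@ltr_pXn2r _ 2)// ?nnegrE// ?(ltW rho0)// real_normK ?num_real//.
by apply: le_lt_trans H; rewrite lerDl sumr_ge0// => j _; exact: sqr_ge0.
Qed.

(** The norm on row vectors is the maximum norm, whose balls contain the
    Euclidean ones. *)
Lemma bump_eq0 (G0 : set Rd) z : ball c rho `<=` G0 -> ~ G0 z.1 -> bump z = 0.
Proof.
move=> cG0 nG0; rewrite /bump /pos_sqr max_l ?expr0n// leNgt; apply/negP => z0.
apply: nG0; apply: cG0; apply: ball_rVE => // i.
by rewrite distrC; exact: depth_gt0_near.
Qed.

Lemma measurable_coord1 i : measurable_fun setT (fun z : Rd * Rd => z.1 0 i).
Proof. exact: (measurableT_comp (measurable_coord i) measurable_fst). Qed.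

Lemma measurable_coord2 i : measurable_fun setT (fun z : Rd * Rd => z.2 0 i).
Proof. exact: (measurableT_comp (measurable_coord i) measurable_snd). Qed.

Lemma measurable_max0_depth :
  measurable_fun setT (fun z : Rd * Rd => Num.max 0 (depth z)).
Proof.
apply: measurable_maxr => //; apply: measurable_funB => //.
apply: measurable_sum => i; apply: measurable_funX; apply: measurable_funB => //.
exact: measurable_coord1.
Qed.

Lemma measurable_bump : measurable_fun setT bump.
Proof. apply: measurable_funX; exact: measurable_max0_depth. Qed.

Lemma gradx_bumpE (z : Rd * Rd) i :
  gradx bump z 0 i = - (4 * Num.max 0 (depth z)) * (z.1 0 i - c 0 i).
Proof.
rewrite mxE derive_bump (bigD1 i)//= big1 => [|j ji].
  by rewrite mxE !eqxx/=; ring.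
by rewrite mxE eqxx (negbTE ji)/= mulr0.
Qed.

Definition transport_bump (z : Rd * Rd) : R := dot z.2 (gradx bump z).

Lemma measurable_transport_bump : measurable_fun setT transport_bump.
Proof.
apply: measurable_sum => i; apply: measurable_funM; first exact: measurable_coord2.
rewrite (_ : (fun _ => _) = fun z =>
    - (4 * Num.max 0 (depth z)) * (z.1 0 i - c 0 i)); last first.
  by apply/funext => z; exact: gradx_bumpE.
apply: measurable_funM.
  apply: measurableT_comp => //; apply: measurable_funM => //.
  exact: measurable_max0_depth.
by apply: measurable_funB => //; exact: measurable_coord1.
Qed.

Lemma transport_bump_le z : sphere d z.2 ->
  `|transport_bump z| <= d%:R * (4 * rho ^+ 3).
Proof.
move=> z2; apply: le_trans (ler_norm_sum _ _ _) _.
rewrite -[X in X%:R * _](card_ord d) mulr_natl -sumr_const; apply: ler_sum => i _.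
rewrite gradx_bumpE normrM -[leRHS]mul1r; apply: ler_pM => //.
  move: z2; rewrite /sphere/= /enorm => z2.
  have z21 : dot z.2 z.2 = 1.
    by rewrite -[LHS]sqr_sqrtr ?z2 ?expr1n// sumr_ge0// => j _; rewrite -expr2 sqr_ge0.
  rewrite -(@ler_pXn2r _ 2)// ?nnegrE// expr1n real_normK ?num_real// -z21.
  rewrite /dot (bigD1 i)//= -expr2 lerDl sumr_ge0// => j _.
  by rewrite -expr2 sqr_ge0.
have [z0|z0] := leP (depth z) 0; last first.
  rewrite normrM normrN normrM ger0_norm// ger0_norm ?(ltW z0)//.
  rewrite (exprSr _ 2) mulrA; apply: ler_pM => //.
  - by rewrite mulr_ge0// ltW.
  - by rewrite ler_pM2l//; have := max0_depth_le z; rewrite max_r// ltW.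
  - by rewrite ltW// depth_gt0_near.
by rewrite mulr0 oppr0 mul0r normr0 mulr_ge0// exprn_ge0// ltW.
Qed.

(** The bump vanishes on the whole boundary of [G], not only on its outgoing
    part; the boundary control will therefore leave no trace. *)
Lemma test_function_bump (G : set Rd) nu : open G -> ball c rho `<=` G ->
  test_function G nu bump.
Proof.
move=> oG cG; split; first exact: C1_bump.
move=> z [[[_ nGz] _] _]; apply: (bump_eq0 cG) => Gz; apply: nGz.
by move: oG; rewrite interior_id => ->.
Qed.

Lemma integral_bump_gt0 (G : set Rd) : (0 < d)%N -> measurable G ->
  (vol d G < +oo)%E -> ball c rho `<=` G ->
  0 < \int[phase_measure]_(z in G `*` sphere d) bump z.
Proof.
move=> d0 mG Goo cG.
have mS := @measurable_sphere R d.
have mD : measurable (G `*` sphere d) := measurableX mG mS.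
(* The cube of half side [a] around [c] lies well inside the Euclidean ball. *)
pose a := rho / d.+1%:R.
have a0 : 0 < a by rewrite divr_gt0.
have aa : - a < a by rewrite gtrN.
have d1 : (1 : R) <= d%:R by rewrite ler1n.
have ad : d%:R * a ^+ 2 <= rho ^+ 2 / 2.
  rewrite /a expr_div_n mulrA ler_pdivrMr ?exprn_gt0// -natr1.
  have h : 0 <= (d%:R : R) ^+ 2 + 1 by rewrite addr_ge0// sqr_ge0.
  rewrite -subr_ge0 (_ : _ - _ = rho ^+ 2 * (d%:R ^+ 2 + 1) / 2); last by field.
  by rewrite divr_ge0// mulr_ge0// sqr_ge0.
have near_c (x : Rd) i : cube c (- a) a x -> `|x 0 i - c 0 i| <= a.
  move=> /(_ i) /andP[h1 h2]; rewrite ler_norml; apply/andP; split; lra.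
have arho : a < rho by rewrite ltr_pdivrMr// ltr_pMr// ltr1n.
have cubeG : cube c (- a) a `<=` G.
  move=> x cx; apply: cG; apply: ball_rVE => // i; rewrite distrC.
  by apply: le_lt_trans arho; exact: near_c.
have mC := measurable_cube c (- a) a.
have mCS : measurable (cube c (- a) a `*` sphere d) := measurableX mC mS.
have bumpE z : cube c (- a) a z.1 -> rho ^+ 4 / 4 <= bump z.
  move=> cz; have dz : rho ^+ 2 / 2 <= depth z.
    rewrite /depth lerBrDr -lerBrDl; apply: (@le_trans _ _ (d%:R * a ^+ 2)).
      rewrite -[X in X%:R * _](card_ord d) mulr_natl -sumr_const; apply: ler_sum => i _.
      rewrite -(real_normK (num_real (_ - _))) lerXn2r ?nnegrE ?(ltW a0)//.
      exact: near_c.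
    by apply: le_trans ad _; lra.
  rewrite /bump /pos_sqr max_r; last by apply: le_trans dz; rewrite divr_ge0 ?sqr_ge0.
  rewrite (_ : rho ^+ 4 / 4 = (rho ^+ 2 / 2) ^+ 2); last by field.
  by rewrite lerXn2r ?nnegrE ?divr_ge0 ?sqr_ge0//; apply: le_trans dz; rewrite divr_ge0 ?sqr_ge0.
have muD : (phase_measure (G `*` sphere d) < +oo)%E.
  rewrite /phase_measure product_measure1E// lte_mul_pinfty// ?ge0_fin_numE//.
  by rewrite ltey_eq fin_num_measure.
have posC : (0 < phase_measure (cube c (- a) a `*` sphere d))%E.
  rewrite /phase_measure product_measure1E//.
  by rewrite mule_gt0 ?vol_cube_gt0 ?sphere_measure_gt0.
have mb : measurable_fun (G `*` sphere d) (fun z => (bump z)%:E).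
  by apply/measurable_EFinP/measurable_funTS; exact: measurable_bump.
apply: fine_gt0; apply/andP; split.
  apply: (@lt_le_trans _ _ (\int[phase_measure]_(z in cube c (- a) a `*` sphere d)
    (rho ^+ 4 / 4)%:E)%E).
    rewrite integral_cst// mule_gt0//.
    by rewrite lte_fin divr_gt0// exprn_gt0.
  apply: (@le_trans _ _ (\int[phase_measure]_(z in cube c (- a) a `*` sphere d)
    (bump z)%:E)%E).
    apply: ge0_le_integral_dom => z [/= cz _]; rewrite lee_fin.
      by rewrite divr_ge0// exprn_ge0// ltW.
    exact: bumpE.
  apply: ge0_subset_integral => //.
    by move=> z _; rewrite lee_fin bump_ge0.
  by move=> z [/= cz Sz]; split => //; exact: cubeG.
apply: (@le_lt_trans _ _ (\int[phase_measure]_(z in G `*` sphere d) (rho ^+ 4)%:E)%E).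
  apply: ge0_le_integral_dom => z _; rewrite lee_fin ?bump_ge0//.
  by apply: le_trans (bump_le z); rewrite ler_norm.
by rewrite integral_cst// lte_mul_pinfty// lee_fin exprn_ge0// ltW.
Qed.

End bump.

(** * Integrals of zero *)

Section integral_zero_raw.
Import HBNNSimple.

(** Meant for [hausdorff], which is a mere set function. In the sum that
    defines the integral of the zero simple function, either the term of every
    nonzero value vanishes or infinitely many terms do not, and such a sum is
    zero by convention. *)
Lemma integral_zero_raw d (T : measurableType d) (R : realType)
    (m : set T -> \bar R) (D : set T) (f : T -> \bar R) :
  (forall x, D x -> f x = 0%E) -> (\int[m]_(x in D) f x = 0)%E.
Proof.
move=> f0; rewrite /integral.
have -> : f \_ D = cst 0%E.
  by apply/funext => x; rewrite patchE; case: ifPn => // /set_mem/f0.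
have S0 : sintegral m (cst 0 : T -> R) = 0%E.
  rewrite /sintegral; have [m0|m0] := eqVneq (m set0) 0%E.
    rewrite fsbig1// => x _; rewrite preimage_cst.
    by case: ifPn => [/[!inE] <-|_]; rewrite ?mul0e// m0 mule0.
  rewrite fsbig_dflt//.
  apply: (@sub_infinite_set _ [set (n.+1%:R : R) | n in [set: nat]]).
    move=> _ [n _ <-]; split => //= /eqP; apply/negP.
    rewrite preimage_cst ifF; last first.
      by apply/negbTE; rewrite notin_setE/= => /eqP; rewrite eq_sym pnatr_eq0.
    by rewrite mule_eq0 negb_or m0 andbT eqe pnatr_eq0.
  rewrite (eq_finite_set (inj_card_eq _)); first exact: infinite_nat.
  by move=> a b _ _ /eqP; rewrite eqr_nat => /eqP[].
have E (g : T -> \bar R) : g = cst 0%E ->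
    (ereal_sup [set sintegral m h | h in
      [set h : {nnsfun T >-> R} | forall x, (h x)%:E <= g x]] = 0)%E.
  move=> ->; rewrite [X in ereal_sup X](_ : _ = [set 0%E]) ?ereal_sup1//.
  apply/seteqP; split => [_ [h /= h0 <-]|_ ->].
    rewrite (_ : (h : T -> R) = cst 0)//; apply/funext => x; apply/eqP.
    by rewrite eq_le -[X in X && _]lee_fin h0/=.
  by exists nnsfun0 => //= x; rewrite lexx.
rewrite !E ?sube0//; apply/funext => x.
  by rewrite funenegE oppe0; exact: maxxx.
by rewrite funeposE; exact: maxxx.
Qed.

End integral_zero_raw.

(** * Null sets of the time slab *)

Lemma ae_mono d (T : measurableType d) {R : realType} (m : set T -> \bar R)
    (A B : T -> Prop) : (forall x, A x -> B x) ->
  {ae m, forall x, A x} -> {ae m, forall x, B x}.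
Proof.
move=> AB [N [mN N0 sN]]; exists N; split => // x nB; apply: sN => Ax.
exact/nB/AB.
Qed.

Section integral_estimates.
Context d (T : measurableType d) {R : realType}.
Variable mu : {measure set T -> \bar R}.

Lemma sqr_Rintegral_le (D : set T) (g h : T -> R) (C m : R) : measurable D ->
  measurable_fun D g -> measurable_fun D h -> 0 <= C ->
  (mu D <= m%:E)%E -> 0 < m ->
  {ae mu, forall z, D z -> `|g z| <= C * `|h z|} ->
  (((\int[mu]_(z in D) g z) ^+ 2)%:E <=
    (C ^+ 2 * m)%:E * \int[mu]_(z in D) (h z ^+ 2)%:E)%E.
Proof.
move=> mD mg mh C0 Dm m0 gh.
rewrite -[X in (X%:E <= _)%E](real_normK (num_real _)).
have mh2 : measurable_fun D (fun z => C * h z) by exact: measurable_funM.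
apply: (@le_trans _ _ (m%:E * \int[mu]_(z in D) ((C * h z) ^+ 2)%:E)%E).
  apply: sqr_le_integral_sqr => //.
  apply: le_trans (normr_Rintegral_le mu mD mg) _.
  apply: ae_ge0_le_integral => //.
  - by apply/measurable_EFinP; exact: measurableT_comp.
  - by apply/measurable_EFinP; exact: measurableT_comp.
  - by apply: filterS gh => z H /H; rewrite lee_fin normrM ger0_norm.
under eq_integral do rewrite exprMn EFinM.
rewrite ge0_integralZl ?lee_fin ?sqr_ge0//; last 2 first.
- by apply/measurable_EFinP; exact: measurable_funX.
- by move=> z _; rewrite lee_fin sqr_ge0.
by rewrite muleA -EFinM mulrC.
Qed.

Lemma ae_eq_Rintegral (D : set T) (g h : T -> R) : measurable D ->
  measurable_fun D g -> measurable_fun D h ->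
  {ae mu, forall z, D z -> g z = h z} ->
  \int[mu]_(z in D) g z = \int[mu]_(z in D) h z.
Proof.
move=> mD mg mh gh; rewrite /Rintegral; congr fine.
apply: ae_eq_integral => //; [exact/measurable_EFinP..|].
by apply: filterS gh => z H /H ->.
Qed.

End integral_estimates.

Section slab.
Context {R : realType} {dO dZ : measure_display}.
Context {Omega : measurableType dO} {Z : measurableType dZ}.
Variables (P : probability Omega R) (mu : {sigma_finite_measure set Z -> \bar R}).
Notation Rt := (measurableTypeR R).
Notation leb := (@lebesgue_measure R).
Notation PL := (P \x leb)%E.
Variables (T : R) (D : set Z).
Hypothesis mD : measurable D.
Notation slab := (setT `*` `[0, T] : set (Omega * Rt)).

Let mslab : measurable slab. Proof. exact: measurable_slab. Qed.

Lemma adapted_slab (B : R -> Omega -> R) (X : R -> Omega -> Z -> R) :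
  adapted P B T D X ->
  measurable_fun (slab `*` D) (fun q : (Omega * Rt) * Z => X q.1.2 q.1.1 q.2).
Proof.
move=> [mX _].
have mdom : measurable (`[0, T] `*` setT `*` D : set (Rt * Omega * Z)).
  by apply: measurableX => //; exact: measurableX.
have ms : measurable_fun (slab `*` D)
    (fun q : (Omega * Rt) * Z => ((q.1.2, q.1.1), q.2) : Rt * Omega * Z).
  apply: measurable_funTS; apply/measurable_fun_pair => //.
  apply/measurable_fun_pair; exact: measurableT_comp.
apply: (measurable_comp mdom _ mX ms).
by move=> _ [[[w s] z] [[/= _ sT] Dz] <-].
Qed.

Lemma ae_fst (Q : Omega -> Prop) : {ae P, forall w, Q w} ->
  {ae PL, forall p, Q p.1}.
Proof.
move=> [N [mN N0 sN]]; exists (N `*` setT); split.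
- exact: measurableX.
- by rewrite product_measure1E// [X in (X * _)%E]N0 mul0e.
- by move=> [w s] /= H; split => //; apply: sN.
Qed.

(** Turns null sets given for almost every time, then almost surely, into one
    null set of the time slab. The integral [g] of the absolute value is
    measurable on the slab, so the exceptional set [E], where it does not
    vanish, is measurable, and its sections are null. *)
Lemma ae_slab (b : (Omega * Rt) * Z -> R) :
  measurable_fun (slab `*` D) b ->
  {ae leb, forall s, 0 < s < T -> {ae P, forall w, {ae mu, forall z, D z ->
    b ((w, s), z) = 0}}} ->
  {ae PL, forall p, slab p -> {ae mu, forall z, D z -> b (p, z) = 0}}.
Proof.
move=> mb H.
pose g p := (\int[mu]_(z in D) `|b (p, z)|%:E)%E.
have mg : measurable_fun slab g.
  apply: (measurable_integral_param mu (g := fun q => `|b q|%:E)) => //.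
  by apply/measurable_EFinP; exact: measurableT_comp.
have mbp p : slab p -> measurable_fun D (fun z => b (p, z)).
  move=> sp; apply: (measurable_comp _ _ mb).
  - exact: measurableX.
  - by move=> _ [z /= Dz <-].
  - by apply: measurable_funTS; exact: pair1_measurable.
have gP p : slab p -> g p = 0%E <-> {ae mu, forall z, D z -> b (p, z) = 0}.
  move=> sp.
  have mE : measurable_fun D (EFin \o (fun z => b (p, z))).
    by apply/measurable_EFinP; exact: mbp.
  split => [g0|b0].
    have [N [mN N0 sN]] := (ae_eq_integral_abs mu mD mE).1 g0.
    exists N; split => // z Hz; apply: sN => H1; apply: Hz => /H1.
    by move=> /= [].
  apply/(ae_eq_integral_abs mu mD mE).
  by apply: filterS b0 => z H1 /H1 /= ->.
pose E := slab `&` g @^-1` (~` [set 0%E]).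
have mE : measurable E by apply: mg => //; exact: measurableC.
exists E; split => //.
  apply: negligible_setX => //.
  case: H => N [mN N0 sN].
  have nN : leb.-negligible (N `|` ([set 0] `|` [set T])).
    apply: negligibleU; first by exists N; split.
    by apply: negligibleU; apply/negligibleP => //; exact: lebesgue_measure_set1.
  apply: negligibleS nN.
  move=> s /= Hs; apply: contrapT => /not_orP[nNs /not_orP[s0 sT]]; apply: Hs.
  have [s0T|ns0T] := pselect (0 < s < T); last first.
    apply/eqP; rewrite -measure_le0 (_ : ysection E s = set0) ?measure0//.
    apply/seteqP; split => // w; rewrite /ysection/= inE => -[[_ /=]].
    rewrite in_itv/= => /andP[a1 a2] _; apply: ns0T.
    by rewrite !lt_neqAle a1 a2 !andbT; apply/andP; split; apply/eqP => // /esym.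
  have {}H : {ae P, forall w, {ae mu, forall z, D z -> b ((w, s), z) = 0}}.
    by apply: contrapT => H; apply: nNs; apply: sN => /(_ s0T).
  have [N2 [mN2 N20 sN2]] := H.
  apply/eqP; rewrite -measure_le0 -N20 le_measure ?inE//.
    exact: measurable_ysection.
  move=> w; rewrite /ysection/= inE => -[sp gp]; apply: sN2 => /= /(gP (w, s) sp).
  exact: gp.
move=> p /= Hp; apply: contrapT => nE; apply: Hp => sp; apply/gP => //.
by apply: contrapT => gp; apply: nE.
Qed.

(** An essential bound holds where the excess over the bound vanishes, to which
    [ae_slab] applies. *)
Lemma LooF_slab (B : R -> Omega -> R) (a : R -> Omega -> Z -> R) :
  LooF P B mu T D a ->
  exists2 M, 0 < M & {ae PL, forall p, slab p ->
    {ae mu, forall z, D z -> `|a p.2 p.1 z| <= M}}.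
Proof.
move=> [aa [M HM]]; have ma := adapted_slab aa.
exists (Num.max 1 M); first by rewrite lt_max ltr01.
pose b (q : (Omega * Rt) * Z) := Num.max 0 (`|a q.1.2 q.1.1 q.2| - Num.max 1 M).
have mb : measurable_fun (slab `*` D) b.
  apply: measurable_maxr => //; apply: measurable_funB => //.
  exact: measurableT_comp.
have [|N [mN N0 sN]] := @ae_slab b mb _.
  apply: ae_mono HM => s H /andP[s0 sT].
  apply: ae_mono (H _) => [w|]; last by rewrite !ltW.
  apply: ae_mono => z Hz /Hz az; rewrite /b/= max_l// subr_le0.
  by rewrite le_max az orbT.
exists N; split => // p Hp; apply: sN => H; apply: Hp => /H.
apply: filterS => z Hz /Hz; rewrite /b/=.
by move=> b0; rewrite -subr_le0 -[leRHS]b0 le_max lexx orbT.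
Qed.

End slab.

(** * Trajectories of a solution *)

Lemma sigma_finite_phase (R : realType) (d : nat) :
  sigma_finite setT (@phase_measure R d).
Proof.
have [F TF Foo] := sigma_finiteT (@vol R d).
exists (fun k => F k `*` setT).
  by rewrite -setXTT TF setX_bigcupl.
move=> k; have [mF Fk] := Foo k; split; first exact: measurableX.
rewrite /phase_measure product_measure1E// lte_mul_pinfty// ?ge0_fin_numE//.
by rewrite ltey_eq fin_num_measure.
Qed.

HB.instance Definition _ (R : realType) (d : nat) :=
  Measure_isSigmaFinite.Build _ _ _ (@phase_measure R d)
    (@sigma_finite_phase R d).

Lemma measurable_section d1 d2 d3 (T1 : measurableType d1)
    (T2 : measurableType d2) (T3 : measurableType d3)
    (A : set T1) (D : set T2) (g : T1 * T2 -> T3) x :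
  measurable A -> measurable D -> measurable_fun (A `*` D) g -> A x ->
  measurable_fun D (fun y => g (x, y)).
Proof.
move=> mA mD mg Ax; apply: (measurable_comp _ _ mg (g := fun y => (x, y))).
- exact: measurableX.
- by move=> _ [y /= Dy <-].
- by apply: measurable_funTS; exact: pair1_measurable.
Qed.

Section trajectory.
Context {R : realType} {d : nat}.
Notation Rd := 'rV[R]_d.
Context {dO : measure_display} {Omega : measurableType dO}.
Variables (P : probability Omega R) (B : R -> Omega -> R).
Hypotheses (hP : measure_is_complete P) (hB : brownian_motion P B).
Notation Rt := (measurableTypeR R).
Notation leb := (@lebesgue_measure R).
Notation PL := (P \x leb)%E.
Notation mu := (@phase_measure R d).
Variables (G : set Rd) (nu : Rd -> Rd) (T : R).
Hypotheses (T0 : 0 < T) (oG : open G) (Goo : (vol d G < +oo)%E).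
Notation D := (G `*` sphere d).
Notation slab := (setT `*` `[0, T] : set (Omega * Rt)).

Let mG : measurable G. Proof. exact: measurable_open. Qed.
Let mS := @measurable_sphere R d.
Lemma measurable_phase : measurable (D : set (Rd * Rd)).
Proof. exact: measurableX mG mS. Qed.
Let mD := measurable_phase.
Let mslab : measurable slab. Proof. exact: measurable_slab. Qed.

Lemma phase_lty : (mu D < +oo)%E.
Proof.
rewrite /phase_measure product_measure1E// lte_mul_pinfty// ?ge0_fin_numE//.
by rewrite ltey_eq fin_num_measure.
Qed.

Let m := fine (mu D) + 1.
Let m0 : 0 < m. Proof. by rewrite ltr_wpDl// fine_ge0. Qed.
Let Dm : (mu D <= m%:E)%E.
Proof.
rewrite -[leLHS]fineK ?ge0_fin_numE ?phase_lty//.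
by rewrite lee_fin lerDl.
Qed.

Section norms.
Variable y : R -> Omega -> Rd * Rd -> R.
Hypothesis hy : L2FC P B T D (sqnorm_L2 G) y.

Let ady : adapted P B T D y. Proof. by case: hy. Qed.

Lemma measurable_time (t : R) : 0 <= t <= T ->
  measurable_fun (setT `*` D) (fun q : Omega * (Rd * Rd) => y t q.1 q.2).
Proof.
move=> tT; have [_ /(_ t tT) my] := ady.
have mid : measurable_fun (setT `*` D)
    (fun q : Omega * (Rd * Rd) => (q.1, q.2) : filtered P B t * (Rd * Rd)).
  apply: measurable_funTS; apply/measurable_fun_pair => //.
  move=> _ A mA; have mA' := filtered_sub hP hB mA.
  exact: (@measurable_fst _ _ Omega (Rd * Rd)%type measurableT _ mA').
apply: (measurable_comp _ _ my mid).
- by apply: measurableX.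
- by move=> _ [q /= Dq <-].
Qed.

Lemma measurable_sqnorm_time (t : R) : 0 <= t <= T ->
  measurable_fun setT (fun w => sqnorm_L2 G (y t w)).
Proof.
move=> tT; apply: (measurable_integral_param mu
    (g := fun q : Omega * (Rd * Rd) => (y t q.1 q.2 ^+ 2)%:E)) => //.
by apply/measurable_EFinP/measurable_funX; exact: measurable_time.
Qed.

Lemma sqnorm_ge0 (g : Rd * Rd -> R) : (0 <= sqnorm_L2 G g)%E.
Proof. by apply: integral_ge0 => z _; rewrite lee_fin sqr_ge0. Qed.

Lemma sqnorm_bounded : exists2 L, 0 <= L & forall t, 0 <= t <= T ->
  (\int[P]_w sqnorm_L2 G (y t w) <= L%:E)%E.
Proof.
have [_ _ hsup] := hy.
set S := (\int[P]_w _)%E in hsup.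
have S0 : (0 <= S)%E.
  apply: integral_ge0 => w _; apply: le_trans (sqnorm_ge0 (y 0 w)) _.
  by apply: ereal_sup_ubound; exists 0 => //=; rewrite in_itv/= lexx ltW.
exists (fine S); first exact: fine_ge0.
move=> t tT; rewrite fineK ?ge0_fin_numE//.
apply: ge0_le_integral_dom => w _; first exact: sqnorm_ge0.
by apply: ereal_sup_ubound; exists t => //=; rewrite in_itv.
Qed.

Let my := adapted_slab mD ady.

Lemma integral_sqnorm_slab :
  (\int[PL]_(p in slab) sqnorm_L2 G (y p.2 p.1) < +oo)%E.
Proof.
have [L L0 hL] := sqnorm_bounded.
have ms : measurable_fun slab (fun p => sqnorm_L2 G (y p.2 p.1)).
  apply: (measurable_integral_param mu
    (g := fun q : (Omega * Rt) * (Rd * Rd) => (y q.1.2 q.1.1 q.2 ^+ 2)%:E)) => //.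
  by apply/measurable_EFinP/measurable_funX; exact: my.
rewrite ge0_integral_setX_swap//; last by move=> p _; exact: sqnorm_ge0.
apply: (@le_lt_trans _ _ (\int[leb]_(s in `[0%R, T]) L%:E)%E).
  apply: ge0_le_integral_dom => s /= sT.
    by apply: integral_ge0 => w _; exact: sqnorm_ge0.
  by apply: hL; rewrite in_itv in sT.
rewrite (_ : integral _ _ _ = L%:E * leb `[0%R, T])%E; last first.
  exact: (integral_cst leb (measurable_itv `[0, T]) L%:E).
by rewrite lebesgue_measure_itv/= lte_fin T0 -EFinB -EFinM ltry.
Qed.

(** Dominated convergence along a sequence of times that tends to [T]. The
    supremum of the norms over all times need not be measurable, but the
    supremum over the sequence is, and dominates. *)
Lemma mean_square_continuous e : 0 < e -> exists2 dl, 0 < dl &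
  forall s, 0 <= s <= T -> T - dl < s ->
  (\int[P]_w sqnorm_L2 G (y s w \- y T w)%R <= e%:E)%E.
Proof.
move=> e0; apply: contrapT => nex.
have TT : 0 <= T <= T by rewrite lexx ltW.
have bad n : exists s, [/\ 0 <= s <= T, T - n.+1%:R^-1 < s &
    ~ (\int[P]_w sqnorm_L2 G (y s w \- y T w)%R <= e%:E)%E].
  apply: contrapT => nb; apply: nex; exists n.+1%:R^-1; first by rewrite invr_gt0.
  by move=> s sT ns; apply: contrapT => H; apply: nb; exists s.
pose s n := projT1 (cid (bad n)).
have sP n : [/\ 0 <= s n <= T, T - n.+1%:R^-1 < s n &
    ~ (\int[P]_w sqnorm_L2 G (y (s n) w \- y T w)%R <= e%:E)%E].
  by rewrite /s; case: cid.
have s_T : s n @[n --> \oo] --> T.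
  apply/cvgrPdist_le => r r0; near=> n.
  have [/andP[_ sT] Ts _] := sP n.
  rewrite ger0_norm ?subr_ge0//.
  have nr : n.+1%:R^-1 < r by near: n; exact: near_infty_natSinv_lt (PosNum r0).
  by apply: ltW; apply: lt_trans nr; rewrite ltrBlDr addrC -ltrBlDr.
pose F n w := sqnorm_L2 G (y (s n) w \- y T w)%R.
(* the times of the sequence together with [T] *)
pose u n := if n is n'.+1 then s n' else T.
have uT n : 0 <= u n <= T by case: n => [//|n] /=; have [] := sP n.
pose S w := esups (fun n => sqnorm_L2 G (y (u n) w)) 0.
have mSup : measurable_fun setT S.
  by apply: measurable_fun_esups => n; exact: measurable_sqnorm_time.
have SE w n : (sqnorm_L2 G (y (u n) w) <= S w)%E.
  by apply: ereal_sup_ubound; exists n.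
have S0 w : (0 <= S w)%E by apply: le_trans (SE w 0); exact: sqnorm_ge0.
have [_ hc hsup] := hy.
have iS : (\int[P]_w S w < +oo)%E.
  apply: le_lt_trans hsup; apply: ge0_le_integral_dom => // w _.
  apply: ge_ereal_sup => _ [n _ <-]; apply: ereal_sup_ubound; exists (u n) => //=.
  by rewrite in_itv; exact: uT.
have mF n : measurable_fun setT (F n).
  have [sT _ _] := sP n.
  apply: (measurable_integral_param mu
    (g := fun q : Omega * (Rd * Rd) => ((y (s n) q.1 \- y T q.1) q.2 ^+ 2)%:E)) => //.
  apply/measurable_EFinP/measurable_funX.
  by apply: measurable_funB; exact: measurable_time.
have FS n w : (F n w <= 4%:E * S w)%E.
  have [sT _ _] := sP n.
  have myn (t : R) : 0 <= t <= T -> measurable_fun D (y t w).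
    by move=> tT; exact: (measurable_section measurableT mD (measurable_time tT)).
  have my2 (t : R) : 0 <= t <= T -> measurable_fun D (fun z => (y t w z ^+ 2)%:E).
    by move=> tT; apply/measurable_EFinP/measurable_funX; exact: myn.
  apply: (@le_trans _ _ (\int[mu]_(z in D)
      (2%:E * (y (s n) w z ^+ 2)%:E + 2%:E * (y T w z ^+ 2)%:E))%E).
    apply: ge0_le_integral_dom => z _; first by rewrite lee_fin sqr_ge0.
    rewrite -!EFinM -EFinD lee_fin.
    by have := sqr_ge0 (y (s n) w z + y T w z); rewrite !expr2/=; nra.
  rewrite ge0_integralD//; last 4 first.
  - by move=> z _; rewrite mule_ge0// lee_fin sqr_ge0.
  - exact: measurable_funeM (my2 _ sT).
  - by move=> z _; rewrite mule_ge0// lee_fin sqr_ge0.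
  - exact: measurable_funeM (my2 _ TT).
  rewrite !ge0_integralZl//; first last.
  - by move=> z _; rewrite lee_fin sqr_ge0.
  - exact: my2.
  - by move=> z _; rewrite lee_fin sqr_ge0.
  - exact: my2.
  rewrite (_ : 4%:E * S w = 2%:E * S w + 2%:E * S w)%E; last first.
    by rewrite -ge0_muleDl// -EFinD; congr (_%:E * _)%E; ring.
  by apply: leeD; apply: lee_wpmul2l => //; [exact: (SE w n.+1)|exact: (SE w 0)].
have F0 : {ae P, forall w, setT w -> F ^~ w @ \oo --> 0%E}.
  apply: ae_mono hc => w /(_ T TT) H _.
  apply: (cvg_comp s _ _ H) => A wA.
  have : \forall n \near \oo, `[0, T]%classic (s n) -> A (s n) by exact: s_T wA.
  by apply: filterS => n; apply; rewrite /= in_itv/=; have [] := sP n.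
have i4S : P.-integrable setT (fun w => 4%:E * S w)%E.
  apply: integrableZl => //; apply/integrableP; split => //.
  by under eq_integral do rewrite gee0_abs//.
have dom : {ae P, forall w n, setT w -> (`|F n w| <= 4%:E * S w)%E}.
  by apply: aeW => w n _; rewrite gee0_abs ?FS//; exact: sqnorm_ge0.
have [_ _] := dominated_convergence measurableT mF (measurable_cst 0%E) F0 i4S dom.
rewrite integral0 => C.
have [N _ /(_ N (leqnn N)) H] := cvge0_lt C e0.
by have [_ _] := sP N; apply; exact: ltW.
Unshelve. all: by end_near. Qed.

End norms.
End trajectory.

(** * The equation tested against the bump *)

Definition clamp {R : realType} (M x : R) : R := Num.max (- M) (Num.min M x).

Lemma clamp_le {R : realType} (M x : R) : 0 <= M -> `|clamp M x| <= M.
Proof.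
move=> M0; rewrite ler_norml /clamp le_max lexx/= ge_max ge_min lexx andbT.
by rewrite (le_trans _ M0)// oppr_le0.
Qed.

Lemma clamp_id {R : realType} (M x : R) : `|x| <= M -> clamp M x = x.
Proof. by rewrite ler_norml => /andP[h1 h2]; rewrite /clamp min_r// max_r. Qed.

Section noise_weight.
Context {R : realType} {d : nat}.
Notation Rd := 'rV[R]_d.
Context {dO : measure_display} {Omega : measurableType dO}.
Variables (P : probability Omega R) (B : R -> Omega -> R).
Notation Rt := (measurableTypeR R).
Notation mu := (@phase_measure R d).
Variables (G : set Rd) (T : R) (a : R -> Omega -> Rd * Rd -> R).
Variables (c : Rd) (rho M : R).
Notation D := (G `*` sphere d).
Notation slab := (setT `*` `[0, T] : set (Omega * Rt)).
Hypotheses (oG : open G) (Goo : (vol d G < +oo)%E) (rho0 : 0 < rho) (M0 : 0 < M).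
Hypothesis ada : adapted P B T D a.

(** The coefficient of [xi] in the noise of the tested equation near the
    terminal time. Clamping at the essential bound of [a] changes nothing almost
    everywhere, and makes the weight bounded at every point of the slab. *)
Definition noise_weight (p : Omega * Rt) : R :=
  \int[mu]_(z in D) (clamp M (a p.2 p.1 z) * bump c rho z).

Lemma measurable_clamp : measurable_fun (slab `*` D)
  (fun q : (Omega * Rt) * (Rd * Rd) => clamp M (a q.1.2 q.1.1 q.2) * bump c rho q.2).
Proof.
have mD := measurable_phase oG.
apply: measurable_funM.
  apply: measurable_maxr => //; apply: measurable_minr => //.
  exact: (adapted_slab mD ada).
by apply: measurable_funTS; exact: (measurableT_comp (measurable_bump _ _) measurable_snd).
Qed.

Lemma measurable_noise_weight : measurable_fun slab noise_weight.
Proof.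
exact: (measurable_Rintegral_param mu (measurable_slab (measurable_itv _))
  (measurable_phase oG) measurable_clamp).
Qed.

Lemma clamp_bump_le p z : `|clamp M (a p.2 p.1 z) * bump c rho z| <= M * rho ^+ 4.
Proof.
by rewrite normrM; apply: ler_pM => //; [exact/clamp_le/ltW|exact: bump_le].
Qed.

Lemma noise_weight_le p : slab p ->
  `|noise_weight p| <= M * rho ^+ 4 * (fine (mu D) + 1).
Proof.
have mD := measurable_phase oG.
move=> sp; have C0 : 0 <= M * rho ^+ 4 by rewrite mulr_ge0 ?exprn_ge0// ltW.
have mp := measurable_section (measurable_slab (measurable_itv `[0, T])) mD
  measurable_clamp sp.
rewrite -lee_fin; apply: le_trans (normr_Rintegral_le mu mD mp) _.
apply: (@le_trans _ _ (\int[mu]_(z in D) (M * rho ^+ 4)%:E)%E).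
  by apply: ge0_le_integral_dom => z _; rewrite lee_fin// clamp_bump_le.
rewrite [leLHS](integral_cst mu mD (M * rho ^+ 4)%:E) [leRHS]EFinM.
apply: lee_wpmul2l; rewrite ?lee_fin// -[leLHS]fineK ?ge0_fin_numE ?phase_lty//.
by rewrite lee_fin lerDl.
Qed.

End noise_weight.

Section controlled.
Context {R : realType} {d : nat}.
Notation Rd := 'rV[R]_d.
Context {dO : measure_display} {Omega : measurableType dO}.
Variables (P : probability Omega R) (B : R -> Omega -> R).
Hypotheses (hP : measure_is_complete P) (hB : brownian_motion P B).
Notation Rt := (measurableTypeR R).
Notation leb := (@lebesgue_measure R).
Notation PL := (P \x leb)%E.
Notation mu := (@phase_measure R d).
Variables (G : set Rd) (nu : Rd -> Rd) (T : R).
Hypotheses (T0 : 0 < T) (oG : open G) (Goo : (vol d G < +oo)%E).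
Notation D := (G `*` sphere d).
Notation slab := (setT `*` `[0, T] : set (Omega * Rt)).
Variables (a1 : R -> Omega -> Rd * Rd -> R)
  (a2 : R -> Omega -> Rd * Rd * Rd -> R) (a3 f : R -> Omega -> Rd * Rd -> R).
Hypothesis hcoef : coefficients P B G T a1 a2 a3 f.
Variables (G0 : set Rd) (c : Rd) (rho : R).
Hypotheses (rho0 : 0 < rho) (cG0 : ball c rho `<=` G0) (G0G : G0 `<=` G).
Notation phi := (bump c rho).

Let mG : measurable G. Proof. exact: measurable_open. Qed.
Let mS := @measurable_sphere R d.
Let mD := measurable_phase oG.
Let mslab : measurable slab. Proof. exact: measurable_slab. Qed.
Let m := fine (mu D) + 1.
Let m0 : 0 < m. Proof. by rewrite ltr_wpDl// fine_ge0. Qed.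
Let Dm : (mu D <= m%:E)%E.
Proof.
rewrite -[leLHS]fineK ?ge0_fin_numE ?phase_lty//.
by rewrite lee_fin lerDl.
Qed.
Let sg := fine (sphere_measure d (sphere d : set Rd)) + 1.
Let sg0 : 0 < sg. Proof. by rewrite ltr_wpDl// fine_ge0. Qed.
Let Ssg : (sphere_measure d (sphere d : set Rd) <= sg%:E)%E.
Proof.
have Sfin : sphere_measure d (sphere d : set Rd) \is a fin_num.
  by rewrite fin_num_measure.
by rewrite -[leLHS]fineK// lee_fin lerDl.
Qed.
Let Cp := rho ^+ 4.
Let Cp0 : 0 <= Cp. Proof. by rewrite exprn_ge0// ltW. Qed.

Let mphi : measurable_fun (slab `*` D)
  (fun q : (Omega * Rt) * (Rd * Rd) => phi q.2).
Proof.
by apply: measurable_funTS; exact: (measurableT_comp (measurable_bump _ _) measurable_snd).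
Qed.

Variable y : R -> Omega -> Rd * Rd -> R.
Hypothesis hy : L2FC P B T D (sqnorm_L2 G) y.

Let my : measurable_fun (slab `*` D)
  (fun q : (Omega * Rt) * (Rd * Rd) => y q.1.2 q.1.1 q.2).
Proof. by case: hy => /(adapted_slab mD). Qed.
Let mf : measurable_fun (slab `*` D)
  (fun q : (Omega * Rt) * (Rd * Rd) => f q.1.2 q.1.1 q.2).
Proof. by case: hcoef => _ _ _ [/(adapted_slab mD)]. Qed.

Let h p z := `|y p.2 p.1 z| + `|f p.2 p.1 z|.
Let mh : measurable_fun (slab `*` D)
  (fun q : (Omega * Rt) * (Rd * Rd) => h q.1 q.2).
Proof. by apply: measurable_funD; exact: measurableT_comp. Qed.

(* Almost everywhere, [K] dominates the squares of the three drift terms up to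
   constant factors. *)
Let K p := (\int[mu]_(z in D) (h p z ^+ 2)%:E)%E.
Let mK : measurable_fun slab K.
Proof.
apply: (measurable_integral_param mu
  (g := fun q : (Omega * Rt) * (Rd * Rd) => (h q.1 q.2 ^+ 2)%:E)) => //.
by apply/measurable_EFinP; exact: measurable_funX.
Qed.
Let K0 p : (0 <= K p)%E.
Proof. by apply: integral_ge0 => z _; rewrite lee_fin sqr_ge0. Qed.

Let K_fin : (\int[PL]_(p in slab) K p < +oo)%E.
Proof.
have [_ _ _ [adf f2]] := hcoef.
have mn (g : R -> Omega -> Rd * Rd -> R) : measurable_fun (slab `*` D)
    (fun q : (Omega * Rt) * (Rd * Rd) => g q.1.2 q.1.1 q.2) ->
    measurable_fun slab (fun p => sqnorm_L2 G (g p.2 p.1)).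
  move=> mg; apply: (measurable_integral_param mu
    (g := fun q : (Omega * Rt) * (Rd * Rd) => (g q.1.2 q.1.1 q.2 ^+ 2)%:E)) => //.
  by apply/measurable_EFinP; exact: measurable_funX.
have f2' : (\int[PL]_(p in slab) sqnorm_L2 G (f p.2 p.1) < +oo)%E.
  by rewrite ge0_integral_setX//; [exact: mn|move=> p _; exact: sqnorm_ge0].
have y2 : (\int[PL]_(p in slab) sqnorm_L2 G (y p.2 p.1) < +oo)%E.
  by apply: integral_sqnorm_slab hy.
apply: (@le_lt_trans _ _ (\int[PL]_(p in slab)
   (2%:E * sqnorm_L2 G (y p.2 p.1) + 2%:E * sqnorm_L2 G (f p.2 p.1)))%E).
  apply: ge0_le_integral_dom => p sp; first exact: K0.
  have myp := measurable_section mslab mD my sp.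
  have mfp := measurable_section mslab mD mf sp.
  rewrite /= in myp mfp.
  have my2 : measurable_fun D (fun z => (y p.2 p.1 z ^+ 2)%:E).
    by apply/measurable_EFinP; exact: measurable_funX.
  have mf2 : measurable_fun D (fun z => (f p.2 p.1 z ^+ 2)%:E).
    by apply/measurable_EFinP; exact: measurable_funX.
  apply: (@le_trans _ _ (\int[mu]_(z in D)
      (2%:E * (y p.2 p.1 z ^+ 2)%:E + 2%:E * (f p.2 p.1 z ^+ 2)%:E))%E).
    apply: ge0_le_integral_dom => z _; first by rewrite lee_fin sqr_ge0.
    rewrite -!EFinM -EFinD lee_fin /h -(real_normK (num_real (y _ _ _))).
    rewrite -(real_normK (num_real (f _ _ _))).
    by have := sqr_ge0 (`|y p.2 p.1 z| - `|f p.2 p.1 z|); rewrite !expr2/=; nra.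
  rewrite ge0_integralD//; last 4 first.
  - by move=> z _; rewrite mule_ge0// lee_fin sqr_ge0.
  - exact: measurable_funeM.
  - by move=> z _; rewrite mule_ge0// lee_fin sqr_ge0.
  - exact: measurable_funeM.
  by rewrite !ge0_integralZl//; move=> z _; rewrite lee_fin sqr_ge0.
rewrite ge0_integralD//; last 4 first.
- by move=> p _; rewrite mule_ge0// sqnorm_ge0.
- exact: measurable_funeM (mn _ my).
- by move=> p _; rewrite mule_ge0// sqnorm_ge0.
- exact: measurable_funeM (mn _ mf).
rewrite !ge0_integralZl//; first last.
- by move=> p _; exact: sqnorm_ge0.
- exact: mn.
- by move=> p _; exact: sqnorm_ge0.
- exact: mn.
have n0 : (0 <= 2%:E :> \bar R)%E by rewrite lee_fin.
by apply: lte_add_pinfty; apply: (lte_mul_pinfty n0).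
Qed.

Let sq_of_bound (r : Omega * Rt -> R) (C : R) : 0 <= C -> measurable_fun slab r ->
  {ae PL, forall p, slab p -> ((r p ^+ 2)%:E <= C%:E * K p)%E} ->
  sq_integrable PL slab r.
Proof.
move=> C0 mr rK; split => //.
apply: (@le_lt_trans _ _ (\int[PL]_(p in slab) (C%:E * K p))%E).
  apply: ae_ge0_le_integral => //.
  - by move=> p _; rewrite lee_fin sqr_ge0.
  - by apply/measurable_EFinP; exact: measurable_funX.
  - by move=> p _; rewrite mule_ge0.
  - exact: measurable_funeM.
rewrite ge0_integralZl//.
by apply: lte_mul_pinfty => //; rewrite lee_fin.
Qed.

Let sqr_le_K (p : Omega * Rt) (g : Rd * Rd -> R) (C : R) : slab p -> 0 <= C ->
  measurable_fun D g -> {ae mu, forall z, D z -> `|g z| <= C * h p z} ->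
  (((\int[mu]_(z in D) g z) ^+ 2)%:E <= (C ^+ 2 * m)%:E * K p)%E.
Proof.
move=> sp C0 mg gh; apply: sqr_Rintegral_le => //.
  exact: (measurable_section mslab mD mh sp).
apply: ae_mono gh => z H Dz; rewrite [X in _ <= _ * X]ger0_norm; first exact: H.
by rewrite addr_ge0.
Qed.

(* the transport, reaction and scattering terms of the equation *)
Let r1 p := \int[mu]_(z in D) (y p.2 p.1 z * transport_bump c rho z).
Let r2 p := \int[mu]_(z in D) ((a1 p.2 p.1 z * y p.2 p.1 z + f p.2 p.1 z) * phi z).
Let inner (q : (Omega * Rt) * (Rd * Rd)) :=
  \int[sphere_measure d]_(V in sphere d)
     (a2 q.1.2 q.1.1 (q.2, V) * y q.1.2 q.1.1 (q.2.1, V)).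
Let r3 p := \int[mu]_(z in D) (inner (p, z) * phi z).

Let sq_r1 : sq_integrable PL slab r1.
Proof.
have mg : measurable_fun (slab `*` D) (fun q : (Omega * Rt) * (Rd * Rd) =>
    y q.1.2 q.1.1 q.2 * transport_bump c rho q.2).
  apply: measurable_funM => //; apply: measurable_funTS.
  exact: (measurableT_comp (measurable_transport_bump _ _) measurable_snd).
pose C := d%:R * (4 * rho ^+ 3).
have C0 : 0 <= C by rewrite mulr_ge0// mulr_ge0// exprn_ge0// ltW.
apply: (@sq_of_bound _ (C ^+ 2 * m)).
- by rewrite mulr_ge0 ?sqr_ge0// ltW.
- exact: (measurable_Rintegral_param mu mslab mD mg).
apply: aeW => p sp; apply: sqr_le_K => //.
  exact: (measurable_section mslab mD mg sp).
apply: aeW => z [_ /= Sz]; rewrite normrM mulrC; apply: ler_pM => //.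
  exact: transport_bump_le.
by rewrite /h lerDl.
Qed.

Let sq_r2 : sq_integrable PL slab r2.
Proof.
have [La1 _ _ _] := hcoef.
have ma1 : measurable_fun (slab `*` D)
    (fun q : (Omega * Rt) * (Rd * Rd) => a1 q.1.2 q.1.1 q.2).
  by case: La1 => /(adapted_slab mD).
have [M M0 a1M] := LooF_slab mD La1.
have mg : measurable_fun (slab `*` D) (fun q : (Omega * Rt) * (Rd * Rd) =>
    (a1 q.1.2 q.1.1 q.2 * y q.1.2 q.1.1 q.2 + f q.1.2 q.1.1 q.2) * phi q.2).
  by apply: measurable_funM => //; apply: measurable_funD => //; exact: measurable_funM.
pose C := (M + 1) * Cp.
have C0 : 0 <= C by rewrite mulr_ge0// addr_ge0// ltW.
apply: (@sq_of_bound _ (C ^+ 2 * m)).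
- by rewrite mulr_ge0 ?sqr_ge0// ltW.
- exact: (measurable_Rintegral_param mu mslab mD mg).
apply: ae_mono a1M => p Hp sp; apply: sqr_le_K => //.
  exact: (measurable_section mslab mD mg sp).
apply: ae_mono (Hp sp) => z Hz Dz; rewrite normrM /C mulrAC; apply: ler_pM => //.
  apply: le_trans (ler_normD _ _) _; rewrite normrM /h mulrDr mulrDl mul1r.
  have a1z := Hz Dz.
  have : `|a1 p.2 p.1 z| * `|y p.2 p.1 z| <= M * `|y p.2 p.1 z|.
    by rewrite ler_wpM2r.
  have := mulr_ge0 (ltW M0) (normr_ge0 (f p.2 p.1 z)).
  have := normr_ge0 (y p.2 p.1 z); lra.
exact: bump_le.
Qed.

Let sq_r3 : sq_integrable PL slab r3.
Proof.
have [_ [ada2 [M0 a2M]] _ _] := hcoef.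
pose M := Num.max 0 M0.
have MM : 0 <= M by rewrite le_max lexx.
have mGc : measurable (closure G).
  by apply: measurable_closed; exact: closed_closure.
have mDS : measurable (closure G `*` sphere d `*` sphere d) :=
  measurableX (measurableX mGc mS) mS.
have ma2 := adapted_slab mDS ada2.
have mg : measurable_fun ((slab `*` D) `*` sphere d)
    (fun q : ((Omega * Rt) * (Rd * Rd)) * Rd =>
       a2 q.1.1.2 q.1.1.1 (q.1.2, q.2) * y q.1.1.2 q.1.1.1 (q.1.2.1, q.2)).
  apply: measurable_funM.
    have ms : measurable_fun ((slab `*` D) `*` sphere d)
        (fun q : ((Omega * Rt) * (Rd * Rd)) * Rd => (q.1.1, (q.1.2, q.2))).
      apply: measurable_funTS; apply/measurable_fun_pair.
        exact: measurableT_comp.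
      by apply/measurable_fun_pair => //; exact: measurableT_comp.
    apply: (measurable_comp _ _ ma2 ms); first exact: measurableX.
    move=> _ [[[[w s] [x U]] V] [[/= ws [Gx SU]] SV] <-]; split => //=.
    by split => //; split => //; exact: subset_closure.
  have ms : measurable_fun ((slab `*` D) `*` sphere d)
      (fun q : ((Omega * Rt) * (Rd * Rd)) * Rd => (q.1.1, (q.1.2.1, q.2))).
    apply: measurable_funTS; apply/measurable_fun_pair.
      exact: measurableT_comp.
    apply/measurable_fun_pair => //.
    apply: (measurableT_comp measurable_fst).
    exact: (measurableT_comp measurable_snd measurable_fst).
  apply: (measurable_comp _ _ my ms); first exact: measurableX.
  by move=> _ [[[[w s] [x U]] V] [[/= ws [Gx SU]] SV] <-].
have mslabD : measurable (slab `*` D) := measurableX mslab mD.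
have minner : measurable_fun (slab `*` D) inner.
  exact: (measurable_Rintegral_param (sphere_measure d) mslabD mS mg).
have mgi : measurable_fun (slab `*` D)
    (fun q : (Omega * Rt) * (Rd * Rd) => inner q * phi q.2).
  exact: measurable_funM.
pose C := (Cp ^+ 2 * m) * (M ^+ 2 * sg * sg).
have C0 : 0 <= C by rewrite !mulr_ge0 ?sqr_ge0// ltW.
apply: (@sq_of_bound _ C) => //.
  exact: (measurable_Rintegral_param mu mslab mD mgi).
have := ae_fst a2M; apply: ae_mono => p [_ _ a2p] sp.
have mip := measurable_section mslab mD minner sp.
have mgp := measurable_section mslab mD mgi sp.
have step1 : (((r3 p) ^+ 2)%:E <=
    (Cp ^+ 2 * m)%:E * \int[mu]_(z in D) (inner (p, z) ^+ 2)%:E)%E.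
  apply: sqr_Rintegral_le => //; apply: aeW => z _.
  by rewrite normrM mulrC ler_wpM2r// bump_le.
apply: (le_trans step1).
rewrite /C [X in (_ <= X * _)%E]EFinM -muleA; apply: lee_wpmul2l.
  by rewrite lee_fin mulr_ge0 ?sqr_ge0// ltW.
have myp := measurable_section mslab mD my sp; rewrite /= in myp.
have my2 : measurable_fun D (fun z => (y p.2 p.1 z ^+ 2)%:E).
  by apply/measurable_EFinP; exact: measurable_funX.
have mI : measurable_fun G (fun x => \int[sphere_measure d]_(V in sphere d)
    (y p.2 p.1 (x, V) ^+ 2)%:E)%E.
  exact: (measurable_integral_param (sphere_measure d) mG mS my2).
have I0 x : (0 <= \int[sphere_measure d]_(V in sphere d)
    (y p.2 p.1 (x, V) ^+ 2)%:E)%E.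
  by apply: integral_ge0 => V _; rewrite lee_fin sqr_ge0.
apply: (@le_trans _ _ (\int[mu]_(z in D) ((M ^+ 2 * sg)%:E *
    \int[sphere_measure d]_(V in sphere d) (y p.2 p.1 (z.1, V) ^+ 2)%:E))%E).
  apply: ge0_le_integral_dom => z Dz; first by rewrite lee_fin sqr_ge0.
  apply: sqr_Rintegral_le => //.
  - exact: (measurable_section mslabD mS mg (x := (p, z))).
  - apply: (measurable_section mG mS (x := z.1) myp); exact: Dz.1.
  - apply: aeW => V SV; rewrite normrM ler_wpM2r//.
    rewrite /M le_max; apply/orP; right; apply: a2p.
      by have [_] := sp; rewrite /= in_itv.
    by split => //; split; [exact/subset_closure/Dz.1|exact: Dz.2].
have mIf : measurable_fun D (fun z : Rd * Rd =>
    \int[sphere_measure d]_(V in sphere d) (y p.2 p.1 (z.1, V) ^+ 2)%:E)%E.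
  apply: (measurable_comp mG _ mI); first by move=> _ [z [Gz _] <-].
  by apply: measurable_funTS; exact: measurable_fst.
rewrite ge0_integralZl//; last by rewrite lee_fin mulr_ge0 ?sqr_ge0// ltW.
rewrite [X in (_ <= X * _)%E]EFinM -muleA; apply: lee_wpmul2l.
  by rewrite lee_fin mulr_ge0 ?sqr_ge0// ltW.
apply: (@le_trans _ _ (sg%:E * \int[mu]_(z in D) (y p.2 p.1 z ^+ 2)%:E)%E); last first.
  apply: lee_wpmul2l; first by rewrite lee_fin ltW.
  apply: ge0_le_integral_dom => z _; first by rewrite lee_fin sqr_ge0.
  rewrite lee_fin -(real_normK (num_real (y _ _ _))) lerXn2r ?nnegrE//.
    by rewrite addr_ge0.
  by rewrite /h lerDl.
rewrite /phase_measure ge0_integral_setX//.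
rewrite [X in (_ <= _ * X)%E]ge0_integral_setX//; last first.
  by move=> z _; rewrite lee_fin sqr_ge0.
rewrite -ge0_integralZl//; last by rewrite lee_fin ltW.
apply: ge0_le_integral_dom => x _; first exact: integral_ge0.
rewrite [leLHS](_ : _ = (\int[sphere_measure d]_(V in sphere d)
    (y p.2 p.1 (x, V) ^+ 2)%:E) * sphere_measure d (sphere d : set Rd))%E; last first.
  exact: (integral_cst (sphere_measure d) mS (\int[sphere_measure d]_(V in sphere d)
    (y p.2 p.1 (x, V) ^+ 2)%:E)%E).
by rewrite [leLHS]muleC; apply: lee_wpmul2r.
Qed.

Variables (y0 : Rd * Rd -> R) (u v : R -> Omega -> Rd * Rd -> R).
Hypothesis hv : internal_control P B G T v.
Hypothesis hv0 : vanishes_on P T G0 v.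
Hypothesis hsol : solution P B G nu T a1 a2 a3 f y0 u v y.
Variable xi : Omega -> R.
Hypothesis Ixi : sq_integrable P setT xi.
Hypothesis y_T : {ae P, forall w, {ae mu, forall z, D z -> y T w z = xi w}}.

Let TT : 0 <= T <= T. Proof. by rewrite lexx ltW. Qed.
Let Doo : (mu D < +oo)%E. Proof. exact: phase_lty. Qed.
Let Y t w := \int[mu]_(z in D) (y t w z * phi z).
Let c0 := \int[mu]_(z in D) phi z.

Let mphiD : measurable_fun D phi.
Proof. exact: measurable_funTS (measurable_bump c rho). Qed.

Let sq_phi : sq_integrable mu D phi.
Proof.
have := @sq_integrableMb _ _ _ mu D (cst 1) phi Cp mD.
rewrite (_ : phi \* cst 1 = phi); last by apply/funext => z /=; rewrite mulr1.
apply => //; first exact: sq_integrable_cst.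
by move=> z _; exact: bump_le.
Qed.

Let mY (t : R) : 0 <= t <= T ->
  measurable_fun setT (Y t : filtered P B t -> R).
Proof.
move=> tT; have [[_ /(_ t tT) myt] _ _] := hy.
apply: (@measurable_Rintegral_param _ _ (filtered P B t) (Rd * Rd)%type R mu
  setT D (fun q => y t q.1 q.2 * phi q.2)) => //.
apply: measurable_funM => //; apply: measurable_funTS.
exact: (measurableT_comp (measurable_bump _ _) measurable_snd).
Qed.

Let myt (t : R) : 0 <= t <= T -> forall w, measurable_fun D (y t w).
Proof.
move=> tT w; have mt := measurable_time hP hB oG hy tT.
exact: (measurable_section measurableT mD mt (x := w)).
Qed.

Let IY (t : R) : 0 <= t <= T -> sq_integrable P setT (Y t).
Proof.
move=> tT; have mYt := measurable_filtered hP hB (mY tT); split => //.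
have [L L0 hL] := sqnorm_bounded T0 hy.
apply: (@le_lt_trans _ _ (\int[P]_w ((Cp ^+ 2 * m)%:E * sqnorm_L2 G (y t w)))%E).
  apply: ge0_le_integral_dom => w _; first by rewrite lee_fin sqr_ge0.
  have mw := myt tT w.
  apply: sqr_Rintegral_le => //; first exact: measurable_funM.
  by apply: aeW => z _; rewrite normrM mulrC ler_wpM2r// bump_le.
have C0 : 0 <= Cp ^+ 2 * m by rewrite mulr_ge0 ?sqr_ge0// ltW.
rewrite ge0_integralZl//.
- apply: lte_mul_pinfty => //; exact: le_lt_trans (hL t tT) (ltry _).
- exact: (measurable_sqnorm_time hP hB oG hy tT).
- by move=> w _; exact: sqnorm_ge0.
Qed.

Let YT : {ae P, forall w, Y T w = c0 * xi w}.
Proof.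
apply: ae_mono y_T => w Hw.
rewrite mulrC /c0 -RintegralZl//; last exact: sq_integrable_int.
apply: ae_eq_Rintegral => //.
- by apply: measurable_funM => //; exact: myt.
- exact: measurable_funM.
- by apply: ae_mono Hw => z Hz /Hz ->.
Qed.

Let r p := r1 p + r2 p + r3 p.
Let X s w := \int[mu]_(z in D) ((a3 s w z * y s w z + v s w z) * phi z).

Let Ir : sq_integrable PL slab r.
Proof. exact: (sq_integrableD mslab (sq_integrableD mslab sq_r1 sq_r2) sq_r3). Qed.

(* [hausdorff] is a mere set function, hence the appeal to
   [integral_zero_raw]. *)
Let bdry0 (g : Rd * Rd -> R) :
  integral_GammaS_minus G nu (fun z => g z * phi z * dot z.2 (nu z.1)) = 0%E.
Proof.
apply: integral_zero_raw => x [_ xG]; apply: integral_zero_raw => U _ /=.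
rewrite (bump_eq0 _ (G0 := G) (c := c) (rho := rho)) ?mulr0 ?mul0r//.
  by move=> z /cG0/G0G.
by move: oG; rewrite interior_id => oGE; rewrite /= -oGE.
Qed.

Let eqY (t : R) : 0 <= t <= T -> exists2 I, is_ito_integral P B t X I &
  {ae P, forall w, Y t w - (\int[mu]_(z in D) (y0 z * phi z))
    - \int[leb]_(s in `[0, t]) r (w, s) = I w}.
Proof.
move=> tT; have [_ /(_ t tT phi)] := hsol.
have tphi : test_function G nu phi.
  by apply: test_function_bump => // z /cG0/G0G.
move=> /(_ tphi)[I hI eqI]; exists I => //.
have i1 := ae_integrable_slab sq_r1.
have i2 := ae_integrable_slab sq_r2.
have i3 := ae_integrable_slab sq_r3.
near=> w.
have m0T : measurable (`[0, T]%classic : set Rt) by exact: measurable_itv.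
have m0t : measurable (`[0, t]%classic : set Rt) by exact: measurable_itv.
have sub0 : (`[0, t]%classic : set Rt) `<=` `[0, T]%classic.
  move=> s /=; rewrite !in_itv/= => /andP[-> st].
  by apply: le_trans st _; case/andP: tT.
have j1 : leb.-integrable `[0, t] (EFin \o (fun s => r1 (w, s))).
  have h1 : leb.-integrable `[0, T] (fun s => (r1 (w, s))%:E) by near: w.
  exact: (integrableS m0T m0t sub0 h1).
have j2 : leb.-integrable `[0, t] (EFin \o (fun s => r2 (w, s))).
  have h2 : leb.-integrable `[0, T] (fun s => (r2 (w, s))%:E) by near: w.
  exact: (integrableS m0T m0t sub0 h2).
have j3 : leb.-integrable `[0, t] (EFin \o (fun s => r3 (w, s))).
  have h3 : leb.-integrable `[0, T] (fun s => (r3 (w, s))%:E) by near: w.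
  exact: (integrableS m0T m0t sub0 h3).
have E1 : \int[leb]_(s in `[0, t]) r (w, s) = \int[leb]_(s in `[0, t]) r1 (w, s) +
    \int[leb]_(s in `[0, t]) r2 (w, s) + \int[leb]_(s in `[0, t]) r3 (w, s).
  rewrite -RintegralD// -RintegralD//; exact: (integrableD m0t j1 j2).
have E2 : \int[leb]_(s in `[0, t]) fine (integral_GammaS_minus G nu
    (fun z => u s w z * phi z * dot z.2 (nu z.1))) = 0.
  by rewrite /Rintegral integral0_eq// => s _; rewrite bdry0.
have H : Y t w - (\int[mu]_(z in D) (y0 z * phi z)) -
  \int[leb]_(s in `[0, t]) r1 (w, s)
  + \int[leb]_(s in `[0, t]) fine (integral_GammaS_minus G nu
    (fun z => u s w z * phi z * dot z.2 (nu z.1)))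
  = \int[leb]_(s in `[0, t]) r2 (w, s) +
  \int[leb]_(s in `[0, t]) r3 (w, s) + I w by near: w.
rewrite E1; rewrite E2 addr0 in H.
by rewrite opprD addrA opprD addrA H; ring.
Unshelve. all: by end_near. Qed.

Variable M3 : R.
Hypotheses (M30 : 0 < M3) (a3M : {ae PL, forall p, slab p ->
  {ae mu, forall z, D z -> `|a3 p.2 p.1 z| <= M3}}).

Let a3c p z := clamp M3 (a3 p.2 p.1 z).
Let alpha := @noise_weight R d dO Omega G a3 c rho M3.

Let ada3 : adapted P B T D a3. Proof. by case: hcoef => _ _ []. Qed.
Let ma3 := adapted_slab mD ada3.

Let malpha : measurable_fun slab alpha.
Proof. exact: measurable_noise_weight ada3. Qed.

Let ma3p p : slab p -> measurable_fun D (fun z => a3c p z * phi z).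
Proof.
move=> sp.
exact: (measurable_section mslab mD (measurable_clamp c rho M3 oG ada3) sp).
Qed.

Let a3phi_le p z : `|a3c p z * phi z| <= M3 * Cp.
Proof. exact: clamp_bump_le. Qed.

Let alpha_le p : slab p -> `|alpha p| <= M3 * Cp * m.
Proof. by move=> sp; apply: (noise_weight_le c oG Goo rho0 M30 ada3 sp). Qed.

Let Cx := (M3 * Cp) ^+ 2 * m + 1.
Let Cx0 : 0 < Cx.
Proof. by rewrite ltr_wpDl// mulr_ge0 ?sqr_ge0// ltW. Qed.
(* The noise term of the equation, which is [X s w], differs from
   [xi * alpha] by an integral of [a3 * bump * (y - xi)], as the internal
   control does not meet the bump. *)
Let gap p := (Cx%:E * \int[mu]_(z in D) ((y p.2 p.1 z - xi p.1) ^+ 2)%:E)%E.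

Let myxi : measurable_fun (slab `*` D)
  (fun q : (Omega * Rt) * (Rd * Rd) => y q.1.2 q.1.1 q.2 - xi q.1.1).
Proof.
apply: measurable_funB => //; apply: measurable_funTS.
by apply: (measurableT_comp Ixi.1); exact: measurableT_comp.
Qed.

Let mgap : measurable_fun slab gap.
Proof.
apply: measurable_funeM; apply: (measurable_integral_param mu
  (g := fun q : (Omega * Rt) * (Rd * Rd) =>
    ((y q.1.2 q.1.1 q.2 - xi q.1.1) ^+ 2)%:E)) => //.
by apply/measurable_EFinP; exact: measurable_funX.
Qed.

Let gap_ge0 p : (0 <= gap p)%E.
Proof.
rewrite mule_ge0//; first by rewrite lee_fin ltW.
by apply: integral_ge0 => z _; rewrite lee_fin sqr_ge0.
Qed.

Let vphi0 : {ae PL, forall p, slab p ->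
  {ae mu, forall z, D z -> v p.2 p.1 z * phi z = 0}}.
Proof.
have [adv _] := hv; have mv := adapted_slab mD adv.
apply: (@ae_slab _ _ _ _ _ P mu T D mD
  (fun q : (Omega * Rt) * (Rd * Rd) => v q.1.2 q.1.1 q.2 * phi q.2)).
  exact: measurable_funM.
apply: ae_mono hv0 => s H /H; apply: ae_mono => w; apply: ae_mono => z Hz [_ Sz] /=.
have [Gz|nGz] := pselect (G0 z.1); first by rewrite Hz// mul0r.
by rewrite (bump_eq0 rho0 cG0 nGz) mulr0.
Qed.

Let Xgap : {ae PL, forall p, slab p ->
  (((X p.2 p.1 - xi p.1 * alpha p) ^+ 2)%:E <= gap p)%E}.
Proof.
have [N1 [mN1 N10 sN1]] := a3M; have [N2 [mN2 N20 sN2]] := vphi0.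
have nN : PL.-negligible (N1 `|` N2).
  by apply: negligibleU; [exists N1|exists N2]; split.
apply: negligibleS nN => p /= np; apply: contrapT => /not_orP[n1 n2].
apply: np => sp.
have {}n1 : {ae mu, forall z, D z -> `|a3 p.2 p.1 z| <= M3}.
  by apply: contrapT => H; apply: n1; apply: sN1 => /(_ sp).
have {}n2 : {ae mu, forall z, D z -> v p.2 p.1 z * phi z = 0}.
  by apply: contrapT => H; apply: n2; apply: sN2 => /(_ sp).
have myp := measurable_section mslab mD my sp; rewrite /= in myp.
have mdp := measurable_section mslab mD myxi sp; rewrite /= in mdp.
have ma3q := measurable_section mslab mD ma3 sp; rewrite /= in ma3q.
have [adv _] := hv; have mv := adapted_slab mD adv.
have mvp := measurable_section mslab mD mv sp; rewrite /= in mvp.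
have [Joo|Joo] := eqVneq (\int[mu]_(z in D) ((y p.2 p.1 z - xi p.1) ^+ 2)%:E)%E +oo%E.
  by rewrite /gap Joo gt0_muley ?leey// lte_fin.
have sq_diff : sq_integrable mu D (fun z => y p.2 p.1 z - xi p.1).
  by split => //; rewrite ltey.
have sq_y : sq_integrable mu D (y p.2 p.1).
  have := sq_integrableD mD sq_diff (sq_integrable_cst (xi p.1) mD Doo).
  rewrite (_ : _ \+ _ = y p.2 p.1)//.
  by apply/funext => z /=; rewrite subrK.
have a3b : forall z, D z -> `|a3c p z * phi z| <= M3 * Cp by move=> z _.
have i1 : mu.-integrable D (EFin \o (fun z => (a3c p z * phi z) * y p.2 p.1 z)).
  apply: sq_integrable_int => //.
  exact: (sq_integrableMb mD sq_y (ma3p sp) a3b).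
have i2 : mu.-integrable D (EFin \o (fun z => a3c p z * phi z)).
  apply: sq_integrable_int => //.
  have := sq_integrableMb mD (sq_integrable_cst 1 mD Doo) (ma3p sp) a3b.
  rewrite (_ : _ \* _ = (fun z => a3c p z * phi z))//.
  by apply/funext => z /=; rewrite mulr1.
have i3 : mu.-integrable D (EFin \o (fun z => xi p.1 * (a3c p z * phi z))).
  exact: (integrableZl mD (xi p.1) i2).
have -> : X p.2 p.1 - xi p.1 * alpha p =
    \int[mu]_(z in D) ((a3c p z * phi z) * (y p.2 p.1 z - xi p.1)).
  have -> : X p.2 p.1 = \int[mu]_(z in D) ((a3c p z * phi z) * y p.2 p.1 z).
    apply: ae_eq_Rintegral => //.
    - by apply: measurable_funM => //; apply: measurable_funD => //; exact: measurable_funM.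
    - by apply: measurable_funM => //; exact: ma3p.
    - move: n1 n2 => [K1 [mK1 K10 sK1]] [K2 [mK2 K20 sK2]].
      have nK : mu.-negligible (K1 `|` K2).
        by apply: negligibleU; [exists K1|exists K2]; split.
      apply: negligibleS nK => z /= nz; apply: contrapT => /not_orP[k1 k2].
      apply: nz => Dz.
      have az : `|a3 p.2 p.1 z| <= M3.
        by apply: contrapT => H; apply: k1; apply: sK1 => /(_ Dz).
      have vz : v p.2 p.1 z * phi z = 0.
        by apply: contrapT => H; apply: k2; apply: sK2 => /(_ Dz).
      by rewrite /a3c (clamp_id az) mulrDl vz addr0; ring.
  rewrite /alpha /noise_weight -RintegralZl// -RintegralB//.
  by apply: eq_Rintegral => z _; rewrite /a3c; ring.
apply: (@le_trans _ _ (((M3 * Cp) ^+ 2 * m)%:E *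
    \int[mu]_(z in D) ((y p.2 p.1 z - xi p.1) ^+ 2)%:E)%E).
  apply: sqr_Rintegral_le => //.
  - by apply: measurable_funM => //; exact: ma3p.
  - by rewrite mulr_ge0// ltW.
  - by apply: aeW => z _; rewrite normrM ler_wpM2r.
rewrite /gap; apply: lee_wpmul2r; last by rewrite lee_fin /Cx lerDl.
by apply: integral_ge0 => z _; rewrite lee_fin sqr_ge0.
Qed.

Let gap_T e : 0 < e -> exists2 dl, 0 < dl & forall s, 0 <= s <= T ->
  T - dl < s -> (\int[P]_w gap (w, s) <= e%:E)%E.
Proof.
move=> e0; have eC : 0 < e / Cx by rewrite divr_gt0.
have [dl dl0 Hdl] := mean_square_continuous hP hB T0 oG hy eC.
exists dl => // s sT Ts.
have msT : measurable_fun setT (fun w => sqnorm_L2 G (y s w \- y T w)).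
  apply: (measurable_integral_param mu
    (g := fun q : Omega * (Rd * Rd) => ((y s q.1 \- y T q.1) q.2 ^+ 2)%:E)) => //.
  apply/measurable_EFinP/measurable_funX.
  exact: (measurable_funB (measurable_time hP hB oG hy sT) (measurable_time hP hB oG hy TT)).
apply: (@le_trans _ _ (\int[P]_w (Cx%:E * sqnorm_L2 G (y s w \- y T w)%R))%E).
  apply: ae_ge0_le_integral => //.
  - apply: measurable_funeM; apply: (measurable_integral_param mu
      (g := fun q : Omega * (Rd * Rd) => ((y s q.1 q.2 - xi q.1) ^+ 2)%:E)) => //.
    apply/measurable_EFinP/measurable_funX; apply: measurable_funB.
      exact: (measurable_time hP hB oG hy sT).
    by apply: measurable_funTS; exact: (measurableT_comp Ixi.1 measurable_fst).
  - by move=> w _; rewrite mule_ge0 ?sqnorm_ge0// lee_fin ltW.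
  - exact: measurable_funeM.
  - apply: ae_mono y_T => w Hw _; rewrite /gap/=; apply: lee_wpmul2l.
      by rewrite lee_fin ltW.
    apply: ae_ge0_le_integral => //.
    + by move=> z _; rewrite lee_fin sqr_ge0.
    + by apply/measurable_EFinP/measurable_funX/measurable_funB => //; exact: myt.
    + by move=> z _; rewrite lee_fin sqr_ge0.
    + by apply/measurable_EFinP/measurable_funX/measurable_funB; exact: myt.
    + by apply: ae_mono Hw => z Hz Dz; rewrite lee_fin /= Hz.
rewrite ge0_integralZl//.
- apply: (@le_trans _ _ (Cx%:E * (e / Cx)%:E)%E).
    by apply: lee_wpmul2l; [rewrite lee_fin ltW|exact: Hdl].
  by rewrite -EFinM mulrC divfK// gt_eqF.
- by move=> w _; exact: sqnorm_ge0.
- by rewrite lee_fin ltW.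
Qed.

(** Neither control appears here: the bump vanishes on the boundary of [G], and
    [v] vanishes where the bump does not. The target is constant over the phase
    space, so that it factors out of its integral against the bump. *)
Lemma controlled_relation :
  tested_relation P B T c0 (noise_weight G a3 c rho M3) xi.
Proof.
exact: (terminal_relation hP hB T0 malpha alpha_le Ixi mY IY YT Ir eqY mgap
  gap_ge0 Xgap gap_T).
Qed.

End controlled.

(** * Two incompatible terminal values *)

Section incompatibility.
Context {R : realType} {dO : measure_display} {Omega : measurableType dO}.
Variables (P : probability Omega R) (B : R -> Omega -> R).
Hypotheses (hP : measure_is_complete P) (hB : brownian_motion P B).
Notation Rt := (measurableTypeR R).
Notation leb := (@lebesgue_measure R).
Notation PL := (P \x leb)%E.
Notation kappa := (@normal_var R).

Let PToo : (P setT < +oo)%E. Proof. by rewrite probability_setT ltry. Qed.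

Lemma sq_increment (s t : R) : 0 <= s <= t ->
  sq_integrable P setT (fun w => B t w - B s w) /\
  (\int[P]_w ((B t w - B s w) ^+ 2)%:E = (kappa * (t - s))%:E)%E.
Proof.
move=> st.
have m1 : measurable_fun setT (cst 1 : filtered P B s -> R) by [].
have [I1 I2] := sq_mul_increment hP hB st m1 (sq_integrable_cst 1 measurableT PToo).
have E : (fun w => cst 1 w * (B t w - B s w)) = (fun w => B t w - B s w).
  by apply/funext => w /=; rewrite mul1r.
rewrite E in I1; split => //; move: I2.
under eq_integral do rewrite /= mul1r.
move=> ->; under eq_integral do rewrite /= expr1n.
rewrite [X in (_ * X)%E](_ : _ = 1)%E ?mule1//.
by rewrite (integral_cst P measurableT 1%E) mul1e; exact: probability_setT.
Qed.

Variables (T c A : R) (alpha : Omega * Rt -> R).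
Hypotheses (T0 : 0 < T) (c0 : 0 < c).
Hypothesis malpha : measurable_fun (setT `*` `[0, T]) alpha.
Hypothesis alphaA : forall p, (setT `*` `[0, T]) p -> `|alpha p| <= A.

(** For the terminal value 1, the test with weight [B t - B 0] gives zero, so
    the integral of [alpha * (B t - B 0)] after [t] is small compared with
    [T - t]. For the terminal value [B T - B 0], the test with weight 1 gives
    [c * kappa * (T - t)], to be matched by the integral of
    [alpha * (B T - B 0)] after [t]. But [B T - B 0] differs from [B t - B 0] by
    an increment of mean square of order [T - t], which contributes an error of
    order [(T - t)^(3/2)] only. *)
Lemma tested_relations_incompatible :
  tested_relation P B T c alpha (cst 1) ->
  tested_relation P B T c alpha (fun w => B T w - B 0 w) -> False.
Proof.
move=> rel1 rel2; have k0 := @normal_var_gt0 R.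
(* The three errors add up to at most [eps * (2 + kappa) * (T - t)], one half of
   the term that they would have to compensate. *)
pose eps := c * kappa / (2 * (2 + kappa)).
have k2 : 0 < 2 + kappa by rewrite addr_gt0.
have eps0 : 0 < eps by rewrite divr_gt0 ?mulr_gt0.
have kT : 0 < kappa * T by rewrite mulr_gt0.
have [d1 d10 H1] := rel1 _ _ kT eps0.
have [d2 d20 H2] := rel2 _ _ ltr01 eps0.
(* Below [d3], the last of the three errors is at most [eps * (T - t)]. *)
pose d3 := eps ^+ 2 / ((A ^+ 2 + 1) * kappa).
have A1 : 0 < A ^+ 2 + 1 by rewrite ltr_wpDl ?sqr_ge0.
have d30 : 0 < d3 by rewrite divr_gt0 ?exprn_gt0// mulr_gt0.
pose dl := Num.min (Num.min d1 d2) (Num.min d3 T).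
have dl0 : 0 < dl by rewrite !lt_min d10 d20 d30 T0.
have [dl1 dl2 dl3 dlT] : [/\ dl <= d1, dl <= d2, dl <= d3 & dl <= T].
  by split; rewrite /dl !ge_min !(lexx, orbT).
pose t := T - dl / 2.
have t0 : 0 <= t by rewrite /t; lra.
have tT : t < T by rewrite /t; lra.
have Tt : T - t <= d3 by rewrite /t; lra.
have Tt0 : 0 < T - t by rewrite subr_gt0.
have b0t : 0 <= (0 : R) <= t by rewrite lexx.
have btT : 0 <= t <= T by rewrite t0 ltW.
have ttt : 0 <= t <= t by rewrite t0 lexx.
have ztt : 0 <= (0 : R) <= t by rewrite lexx.
have mtT : measurable (setT `*` `]t, T] : set (Omega * Rt)) by exact: measurable_slab.
have m0T : measurable (setT `*` `[0, T] : set (Omega * Rt)) by exact: measurable_slab.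
have sub := @tail_sub_slab _ _ Omega t T t0.
have mat := measurable_funS m0T sub malpha.
have aA p : (setT `*` `]t, T] : set (Omega * Rt)) p -> `|alpha p| <= A.
  by move=> /sub; exact: alphaA.
have lebTt : leb `]t, T] = (T - t)%:E by exact: lebesgue_itv_oc (ltW tT).
have Ioo : (leb `]t, T] < +oo)%E by exact: lebesgue_itv_lty.
have [IW EW] := sq_increment btT.
have [IV EV] := sq_increment ztt.
have mV : measurable_fun setT ((fun w => B t w - B 0 w) : filtered P B t -> R).
  exact: measurable_increment.
have iV := sq_integrable_int measurableT PToo IV.
have iW := sq_integrable_int measurableT PToo IW.
have [iVW EVW] := increment_mean hP hB btT mV iV.
(* the terminal value 1 *)
have {}H1 : `|kappa * \int[PL]_(p in setT `*` `]t, T])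
    ((B t p.1 - B 0 p.1) * alpha p)| <= eps * (T - t).
  have := H1 t (fun w => B t w - B 0 w) t0 _ mV _.
  rewrite EV lee_fin ler_pM2l// subr0 (ltW tT) tT andbT.
  have -> : T - d1 < t by rewrite /t; lra.
  have E0 : \int[P]_w ((B t w - B 0 w) * (B T w - B t w) * 1) = 0.
    by apply: etrans EVW; apply: eq_Rintegral => w _; rewrite mulr1.
  move=> /(_ isT isT) /=; rewrite E0 mulr0 sub0r normrN.
  by under eq_Rintegral do rewrite mulr1.
(* the terminal value B T - B 0 *)
have m1 : measurable_fun setT (cst 1 : filtered P B t -> R) by [].
have {}H2 : `|c * (kappa * (T - t)) - kappa * \int[PL]_(p in setT `*` `]t, T])
    (alpha p * (B T p.1 - B 0 p.1))| <= eps * (T - t).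
  have := H2 t (cst 1) t0 _ m1 _.
  have -> : (\int[P]_w ((cst 1 w : R) ^+ 2)%:E = 1)%E.
    under eq_integral do rewrite /= expr1n.
    by rewrite (integral_cst P measurableT 1%E) mul1e; exact: probability_setT.
  rewrite lexx tT andbT.
  have -> : T - d2 < t by rewrite /t; lra.
  have E1 : \int[P]_w (1 * (B T w - B t w) * (B T w - B 0 w)) = kappa * (T - t).
    transitivity (\int[P]_w ((B t w - B 0 w) * (B T w - B t w) +
       (B T w - B t w) ^+ 2)).
      by apply: eq_Rintegral => w _ /=; ring.
    rewrite RintegralD//; last first.
      have := sq_integrableM measurableT IW IW.
      by apply: eq_integrable => // w _ /=; rewrite expr2.
    by rewrite EVW add0r /Rintegral EW.
  move=> /(_ isT isT) /=; rewrite E1.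
  by under eq_Rintegral do rewrite mul1r.
have IVt := sq_integrable_fst (measurable_itv `]t, T]) Ioo IV.
have IWt := sq_integrable_fst (measurable_itv `]t, T]) Ioo IW.
have iaV := sq_integrable_int mtT (slab_lty P false t T)
   (sq_integrableMb mtT IVt mat aA).
have iaW := sq_integrable_int mtT (slab_lty P false t T)
   (sq_integrableMb mtT IWt mat aA).
have J : \int[PL]_(p in setT `*` `]t, T]) (alpha p * (B T p.1 - B 0 p.1)) =
    \int[PL]_(p in setT `*` `]t, T]) ((B t p.1 - B 0 p.1) * alpha p) +
    \int[PL]_(p in setT `*` `]t, T]) (alpha p * (B T p.1 - B t p.1)).
  rewrite (_ : \int[PL]_(p in _) ((B t p.1 - B 0 p.1) * alpha p) =
    \int[PL]_(p in setT `*` `]t, T]) (alpha p * (B t p.1 - B 0 p.1))); last first.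
    by apply: eq_Rintegral => p _; rewrite mulrC.
  by rewrite -RintegralD//; apply: eq_Rintegral => p _; ring.
pose l := eps / (A ^+ 2 + 1).
have l0 : 0 < l by rewrite divr_gt0.
have H3 : `|\int[PL]_(p in setT `*` `]t, T]) (alpha p * (B T p.1 - B t p.1))|
    <= eps * (T - t).
  rewrite -lee_fin; apply: le_trans (normr_Rintegral_le _ mtT _) _.
    exact: measurable_funM mat IWt.1.
  apply: le_trans (integral_amgm PL mtT mat IWt.1 l0) _.
  have l1 : (0 <= (l / 2)%:E)%E by rewrite lee_fin divr_ge0// ltW.
  apply: (@le_trans _ _ ((l / 2)%:E * ((A ^+ 2) * (T - t))%:E +
    (l^-1 / 2)%:E * ((T - t) * (kappa * (T - t)))%:E)%E).
    apply: leeD.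
      apply: lee_wpmul2l => //.
      apply: (@le_trans _ _ (\int[PL]_(p in setT `*` `]t, T]) (A ^+ 2)%:E)%E).
        apply: ge0_le_integral_dom => p tp; rewrite lee_fin ?sqr_ge0//.
        rewrite -real_normK ?num_real// lerXn2r ?nnegrE// ?aA//.
        by rewrite (le_trans _ (aA p tp)).
      rewrite [leLHS](integral_cst PL mtT (A ^+ 2)%:E) EFinM.
      rewrite [X in (_ * X <= _)%E](_ : _ = (T - t)%:E)//.
      by etransitivity; [exact: (measure_slab P (measurable_itv `]t, T]))|exact: lebTt].
    by rewrite (integral_sqr_fst P (measurable_itv `]t, T]) IW.1) lebTt EW -EFinM.
  rewrite -!EFinM -EFinD lee_fin.
  have e1 : l / 2 * (A ^+ 2 * (T - t)) <= eps / 2 * (T - t).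
    have lE : l * (A ^+ 2 + 1) = eps by rewrite /l divfK ?gt_eqF.
    have lA : l * A ^+ 2 <= eps by rewrite -lE mulrDr mulr1 lerDl ltW.
    rewrite (_ : l / 2 * _ = l * A ^+ 2 / 2 * (T - t)); last by field.
    by rewrite ler_wpM2r ?(ltW Tt0)// ler_wpM2r.
  have e2 : l^-1 / 2 * ((T - t) * (kappa * (T - t))) <= eps / 2 * (T - t).
    have : (T - t) * ((A ^+ 2 + 1) * kappa) <= eps ^+ 2.
      by rewrite -ler_pdivlMr ?mulr_gt0.
    move=> h; rewrite (_ : l^-1 / 2 * _ =
       (T - t) * ((A ^+ 2 + 1) * kappa) / eps / 2 * (T - t)); last first.
      by rewrite /l; field; rewrite !gt_eqF.
    apply: (ler_wpM2r (ltW Tt0)); apply: ler_wpM2r; first by [].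
    by rewrite (ler_pdivrMr _ _ eps0).
  lra.
move: H1 H2 H3; rewrite J; set a := Rintegral _ _ _; set b := Rintegral _ _ _.
rewrite !ler_norml (mulrDr kappa a b) => /andP[h1 h2] /andP[h3 h4] /andP[h5 h6].
have h7 : kappa * b <= kappa * (eps * (T - t)) by rewrite ler_pM2l.
have h8 : c * (kappa * (T - t)) <= eps * (2 + kappa) * (T - t).
  rewrite (mulrDr eps 2 kappa) (mulrDl (eps * 2)); lra.
have h9 : eps * (2 + kappa) = c * kappa / 2.
  by rewrite /eps; field; rewrite gt_eqF.
move: h8; rewrite h9 mulrA ler_pM2r//.
have : 0 < c * kappa by rewrite mulr_gt0.
lra.
Qed.

End incompatibility.

(** * The theorem *)

Theorem theorem1p3 (R : realType) (d : nat) (hd : (0 < d)%N)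
    (G : set 'rV[R]_d) (nu : 'rV[R]_d -> 'rV[R]_d)
    (hG : strictly_convex_C1_domain G) (hnu : unit_outward_normal G nu)
    (dO : measure_display) (Omega : measurableType dO)
    (P : probability Omega R) (hP : measure_is_complete P)
    (B : R -> Omega -> R) (hB : brownian_motion P B)
    (T : R) (hT : 0 < T)
    (a1 : R -> Omega -> 'rV[R]_d * 'rV[R]_d -> R)
    (a2 : R -> Omega -> 'rV[R]_d * 'rV[R]_d * 'rV[R]_d -> R)
    (a3 f : R -> Omega -> 'rV[R]_d * 'rV[R]_d -> R)
    (hcoef : coefficients P B G T a1 a2 a3 f)
    (G0 : set 'rV[R]_d) (oG0 : open G0) (nG0 : G0 !=set0)
    (sG0 : G0 `<=` G) :
  ~ exactly_controllable_off P B G nu T a1 a2 a3 f G0.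
Proof.
move=> ctrl; have [[oG _ _] [bG _ _]] := hG.
have mG := measurable_open oG; have Goo := vol_bounded bG mG.
have mD := measurable_phase oG.
have PToo : (P setT < +oo)%E by rewrite probability_setT ltry.
have [c G0c] := nG0.
have /nbhs_ballP[rho /= rho0 cG0] : nbhs c G0 by exact: open_nbhs_nbhs.
have [_ _ La3 _] := hcoef; have [ada3 _] := La3.
have [M M0 a3M] := LooF_slab mD La3.
have T0T : 0 <= (0 : R) <= T by rewrite lexx ltW.
have [IB EB] := sq_increment hP hB T0T.
have mBT : measurable_fun setT ((fun w => B T w - B 0 w) : filtered P B T -> R).
  by apply: measurable_increment; rewrite ?lexx ltW.
have init0 : initial_state G (fun _ => 0).
  split => //; rewrite /sqnorm_L2 integral0_eq ?ltry// => z _.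
  by rewrite expr0n.
(* Only the target varies here: [c], [rho] and [M] do not depend on it. *)
have relation (xi : Omega -> R) : sq_integrable P setT xi ->
    measurable_fun setT (xi : filtered P B T -> R) ->
    tested_relation P B T (\int[phase_measure]_(z in G `*` sphere d) bump c rho z)
      (noise_weight G a3 c rho M) xi.
  move=> Ixi mxi.
  have final : final_state P B G T (fun w _ => xi w).
    split.
      apply: measurable_funTS.
      exact: (measurableT_comp mxi (@measurable_fst _ _ (filtered P B T) _)).
    rewrite (_ : (\int[P]_w _)%E = (\int[P]_w ((xi w ^+ 2)%:E *
        phase_measure (G `*` sphere d)))%E); last first.
      apply: eq_integral => w _.
      exact: (integral_cst phase_measure mD (xi w ^+ 2)%:E).
    have P0 : (0 <= phase_measure (G `*` sphere d))%E by exact: measure_ge0.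
    rewrite ge0_integralZr//.
    - apply: lte_mul_pinfty; [| |exact: phase_lty].
        by apply: integral_ge0 => w _; rewrite lee_fin sqr_ge0.
      rewrite ge0_fin_numE; first exact: Ixi.2.
      by apply: integral_ge0 => w _; rewrite lee_fin sqr_ge0.
    - by apply/measurable_EFinP/measurable_funX; exact: Ixi.1.
    - by move=> w _; rewrite lee_fin sqr_ge0.
  have [u [v [_ hv hv0 [y hsol y_T]]]] := ctrl _ _ init0 final.
  exact: (controlled_relation hP hB hT oG Goo hcoef rho0 cG0 sG0 hsol.1 hv hv0
    hsol Ixi y_T M0 a3M).
apply: (tested_relations_incompatible hP hB hT
  (integral_bump_gt0 rho0 hd mG Goo (fun x cx => sG0 x (cG0 x cx)))
  (measurable_noise_weight c rho M oG ada3)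
  (fun p sp => noise_weight_le c oG Goo rho0 M0 ada3 sp)).
- by apply: relation => //; exact: sq_integrable_cst.
- exact: relation.
Qed.
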